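(* The Chern-Simons action depends not only on the underlying $C^*$-algebra but also on the particular spectral triple, hence it is not a topological invariant. That is: there exist a unital $C^*$-algebra $A$, and two three-dimensional spectral triples $(\mathcal A_1,\mathcal H_1,\mathcal D_1)$ and $(\mathcal A_2,\mathcal H_2,\mathcal D_2)$ satisfying the Dimension, Regularity and Dimension Spectrum conditions, with $\mathcal A_1,\mathcal A_2$ dense pre-$C^*$-subalgebras of the same $C^*$-algebra $A$, such that for nonzero level $k\in\mathbb Z$ the associated Chern-Simons actions differ: they take different values on some hermitian matrix of $1$-forms over $\mathcal A_1\cap\mathcal A_2$.
   Context: A spectral triple $(\mathcal A,\mathcal H,\mathcal D)$ consists of a unital pre-$C^*$-algebra $\mathcal A$ (closed under holomorphic functional calculus), a separable Hilbert space $\mathcal H$, a faithful representation of $\mathcal A$ by bounded operators on $\mathcal H$ and a densely defined self-adjoint operator $\mathcal D$ such that $[\mathcal D,a]$ extends to a bounded operator for all $a\in\mathcal A$ and $(\mathcal D-\lambda)^{-1}$ is compact for $\lambda\notin\mathbb R$. Put $|\mathcal D|=\sqrt{\mathcal D^2}$ ($|\mathcal D|^{-1}$ is the inverse on $(\ker\mathcal D)^\perp$ and $0$ on $\ker\mathcal D$), $\delta(T)=[|\mathcal D|,T]$, $\nabla(T)=[\mathcal D^2,T]$. Conditions. Dimension: there is an integer $n$ such that the decreasing eigenvalues $\lambda_k$ of $|\mathcal D|^{-1}$ satisfy $\lambda_k=O(k^{-1/n})$; the smallest such $n$ is the dimension. Regularity: every element of the algebra generated by $\mathcal A$ and $[\mathcal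 D,\mathcal A]$ lies in the domain of $\delta^k$ for all $k$ (i.e. $\delta^k(b)$ is densely defined with bounded extension). Dimension Spectrum: for $b$ in the algebra generated by all $\delta^k(a),\delta^k([\mathcal D,a])$, $a\in\mathcal A$, $k\geq 0$, the functions $\zeta_b(z)=\mathrm{Trace}(b|\mathcal D|^{-2z})$ extend holomorphically to $\mathbb C\setminus\Sigma$ for a discrete set $\Sigma$ (and are meromorphic). Chern-Simons action. With $\tau_k(b|\mathcal D|^y)=\mathrm{Res}_{z=0}\,z^k\,\mathrm{Trace}(b|\mathcal D|^{y-2z})$, put $$\phi_3(a^0da^1da^2da^3)=\tfrac1{12}\tau_0\big(a^0[\mathcal D,a^1][\mathcal D,a^2][\mathcal D,a^3]|\mathcal D|^{-3}\big)-\tfrac16\tau_1\big(a^0[\mathcal D,a^1][\mathcal D,a^2][\mathcal D,a^3]|\mathcal D|^{-3}\big),$$ $$\phi_1(a^0da^1)=\tau_0(a^0[\mathcal D,a^1]|\mathcal D|^{-1})-\tfrac14\tau_0(a^0\nabla([\mathcal D,a^1])|\mathcal D|^{-1})-\tfrac12\tau_1(a^0\nabla([\mathcal D,a^1])|\mathcal D|^{-3})+\tfrac18\tau_0(a^0\nabla^2([\mathcal D,a^1])|\mathcal D|^{-5})+\tfrac13\tau_1(a^0\nabla^2([\mathcal D,a^1])|\mathcal D|^{-5})+\tfrac1{12}\tau_2(a^0\nabla^2([\mathcal D,a^1])|\mathcal D|^{-5}),$$ extended to matrix-valued forms by the matrix trace. For $N\in\mathbb N$, an integer $k$ (the level) and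 a hermitian $\omega\in M_N(\Omega^1(\mathcal A))$, $$S_{CS}(\omega)=6\pi k\,\phi_3\left(\omega\,d\omega+\tfrac23\omega^3\right)-2\pi k\,\phi_1(\omega).$$ Forms. $\Omega^n(\mathcal A)=\mathcal A\otimes(\mathcal A/\mathbb C1)^{\otimes n}$, elements written $a^0da^1\cdots da^n$; $\Omega(\mathcal A)$ is the universal differential graded algebra with $d(a^0da^1\cdots da^n)=da^0\cdots da^n$, product determined by $d(ab)=(da)b+a\,db$, involution $(a^0da^1\cdots da^n)^*=(-1)^nda^{n*}\cdots da^{1*}a^{0*}$. A matrix of $1$-forms $(\omega_{ij})$ is hermitian if $\omega_{ji}^*=\omega_{ij}$ for all $i,j$. *)

(* Defs.v *)
From HB Require Import structures.
From mathcomp Require Import all_boot all_order all_algebra.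
From mathcomp Require Import complex.
From mathcomp Require Import all_classical all_reals all_analysis.
Set Implicit Arguments.
Unset Strict Implicit.
Unset Printing Implicit Defensive.
Import Order.TTheory GRing.Theory Num.Theory.
Import numFieldNormedType.Exports.
Local Open Scope classical_set_scope.
Local Open Scope ring_scope.

(* The alias lets R[i] inherit the topology and the norm that
   MathComp-Analysis puts on every numClosedFieldType. *)
Definition cplx (R : realType) : numClosedFieldType := R[i]%C.

Definition toC (R : realType) (x : R) : cplx R := (x%:C)%C.
Definition reC (R : realType) (z : cplx R) : R := complex.Re z.
Definition imC (R : realType) (z : cplx R) : R := complex.Im z.

(* mu ^ w = exp (w ln mu), for mu > 0. *)
Definition cpow (R : realType) (mu : R) (w : cplx R) : cplx R :=
  toC (expR (reC w * ln mu)) *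
  (cos (imC w * ln mu) +i* sin (imC w * ln mu))%C.

Section ComplexAnalysis.
Variable R : realType.
Notation C := (cplx R).

(* No accumulation point anywhere in C, so that the complement is open. *)
Definition discrete_in_C (S : set C) : Prop :=
  forall z : C, \forall w \near z^', ~ S w.

(* Finite principal part at p: the c j are the Laurent coefficients of
   (z - p)^-(j+1). *)
Definition is_residue (F : C -> C) (p r : C) : Prop :=
  exists (m : nat) (c : nat -> C) (G : C -> C),
    [/\ (\forall z \near p, derivable G z 1),
        (\forall z \near p^',
           F z = (\sum_(j < m.+1) c j / (z - p) ^+ j.+1) + G z)
      & r = c 0%N].

Definition meromorphic_at (F : C -> C) (p : C) : Prop :=
  exists r, is_residue F p r.

Definition meromorphic_off (S : set C) (F : C -> C) : Prop :=
  [/\ discrete_in_C S, forall z, ~ S z -> derivable F z 1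
    & forall z, meromorphic_at F z].

(* Riemann sums over uniform subdivisions; used for continuous g only. *)
Definition is_segment_integral (V : normedModType C) (g : C -> V)
    (p q : C) (v : V) : Prop :=
  ((q - p) / n.+1%:R *:
     \sum_(j < n.+1) g (p + j%:R / n.+1%:R * (q - p))) @[n --> \oo] --> v.

(* A polygonal cycle is a finite list of oriented segments such that every
   point is the origin of as many segments as it is the end of. *)
Definition polygonal_cycle (G : seq (C * C)) : Prop :=
  perm_eq (map fst G) (map snd G).

Definition trace_of_cycle (G : seq (C * C)) : set C :=
  [set z | exists s (t : R), [/\ s \in G, 0 <= t <= 1
     & z = s.1 + toC t * (s.2 - s.1)]].

Definition is_contour_integral (V : normedModType C) (g : C -> V)
    (G : seq (C * C)) (v : V) : Prop :=
  exists I : C * C -> V,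
    (forall s, s \in G -> is_segment_integral g s.1 s.2 (I s)) /\
    v = \sum_(s <- G) I s.

Definition two_pi_i : C := (0 +i* (2 * pi))%C.

Definition winding_number (G : seq (C * C)) (w : C) (n : int) : Prop :=
  is_contour_integral (fun z => (z - w)^-1 : C) G (two_pi_i * n%:~R).

End ComplexAnalysis.

HB.mixin Record isHilbert (R : realType) H
    of CompleteNormedModule (cplx R) H := {
  inner : H -> H -> cplx R ;
  innerP : forall (c : cplx R) (x y z : H),
    inner (c *: x + y) z = c * inner x z + inner y z ;
  inner_conj : forall x y : H, inner y x = (inner x y)^* ;
  inner_norm : forall x : H, inner x x = `|x| ^+ 2 ;
  hilbert_separable : exists S : set H, countable S /\ dense S
}.

#[short(type="hilbertType")]
HB.structure Definition Hilbert (R : realType) :=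
  {H of CompleteNormedModule (cplx R) H & isHilbert R H}.

(* The multiplication is part of the mixin because algType and
   completeNormedModType have no common substructure in the hierarchy. *)
HB.mixin Record isCstar (R : realType) A of CompleteNormedModule (cplx R) A := {
  cone : A ;
  cmul : A -> A -> A ;
  star : A -> A ;
  cmulA : associative cmul ;
  cmul1l : left_id cone cmul ;
  cmul1r : right_id cone cmul ;
  cmulPl : forall (c : cplx R) (x y z : A),
    cmul (c *: x + y) z = c *: cmul x z + cmul y z ;
  cmulPr : forall (c : cplx R) (x y z : A),
    cmul z (c *: x + y) = c *: cmul z x + cmul z y ;
  starK : involutive star ;
  starP : forall (c : cplx R) (x y : A),
    star (c *: x + y) = c^* *: star x + star y ;
  starM : forall x y : A, star (cmul x y) = cmul (star y) (star x) ;
  cnormM : forall x y : A, `|cmul x y| <= `|x| * `|y| ;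
  cnorm_star : forall x : A, `|cmul (star x) x| = `|x| ^+ 2
}.

#[short(type="cstarType")]
HB.structure Definition Cstar (R : realType) :=
  {A of CompleteNormedModule (cplx R) A & isCstar R A}.

Reserved Notation "a ** b" (at level 40, left associativity).
Notation "a ** b" := (cmul a b) : ring_scope.

Section PreCstar.
Variables (R : realType) (A : cstarType R).
Notation C := (cplx R).

Definition is_inverse (a b : A) : Prop := a ** b = cone /\ b ** a = cone.

Definition spectrum (a : A) : set C :=
  [set z | ~ exists b, is_inverse (z *: cone - a) b].

(* b = f(a) = (2 pi i)^-1 \oint f(z) (z - a)^-1 dz, the contour lying in
   U \ spectrum a and winding once around spectrum a and not at all around
   the points outside U; r is the resolvent of a along the contour. *)
Definition is_holomorphic_calculus (a : A) (U : set C) (f : C -> C)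
    (b : A) : Prop :=
  [/\ open U, spectrum a `<=` U, forall z, U z -> derivable f z 1
    & exists (G : seq (C * C)) (r : C -> A),
      [/\ polygonal_cycle G,
          trace_of_cycle G `<=` U `\` spectrum a,
          forall w, spectrum a w -> winding_number G w 1,
          forall w, ~ U w -> winding_number G w 0
        & (forall z, trace_of_cycle G z -> is_inverse (z *: cone - a) (r z)) /\
          is_contour_integral (fun z => f z *: r z) G (two_pi_i R *: b)]].

Record pre_cstar (B : set A) : Prop := PreCstar {
  pre1 : B cone ;
  preP : forall (c : C) a b, B a -> B b -> B (c *: a + b) ;
  preM : forall a b, B a -> B b -> B (a ** b) ;
  pre_star : forall a, B a -> B (star a) ;
  pre_dense : dense B ;
  pre_holomorphic : forall a U f b,
    B a -> is_holomorphic_calculus a U f b -> B b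
}.

End PreCstar.

(* A possibly unbounded operator; fn is irrelevant outside dom. *)
Record uop (H : Type) := Uop { dom : set H ; fn :> H -> H }.

Section Operators.
Variables (R : realType) (H : hilbertType R).
Notation C := (cplx R).
Implicit Types (S T D P : uop H) (B E K Q : H -> H).

Definition ueq S T : Prop :=
  dom S = dom T /\ forall x, dom S x -> S x = T x.
Definition ucomp S T : uop H := Uop (dom T `&` T @^-1` dom S) (S \o T).
Definition usub S T : uop H := Uop (dom S `&` dom T) (fun x => S x - T x).
Definition ucomm S T : uop H := usub (ucomp S T) (ucomp T S).
Definition everywhere B : uop H := Uop setT B.

Definition bounded_op B : Prop :=
  linear B /\ exists M : C, forall x, `|B x| <= M * `|x|.

Definition compact_op K : Prop :=
  bounded_op K /\ precompact (K @` [set x | `|x| <= 1]).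

(* T is densely defined and B is its bounded extension. *)
Definition bounded_extension T B : Prop :=
  [/\ dense (dom T), bounded_op B & forall x, dom T x -> T x = B x].

Definition linear_uop T : Prop :=
  dom T 0 /\ forall (c : C) x y, dom T x -> dom T y ->
    dom T (c *: x + y) /\ T (c *: x + y) = c *: T x + T y.

(* The last clause says that T and its adjoint have the same graph. *)
Definition self_adjoint T : Prop :=
  [/\ linear_uop T, dense (dom T)
    & forall y z, dom T y /\ T y = z <->
        forall x, dom T x -> inner (T x) y = inner x z].

Definition compact_resolvent D : Prop :=
  forall z : C, imC z != 0 -> exists K,
    [/\ compact_op K,
        forall x, dom D (K x) /\ D (K x) - z *: K x = x
      & forall x, dom D x -> K (D x - z *: x) = x].

Definition uker D : set H := [set x | dom D x /\ D x = 0].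

(* Objects that need not exist for an arbitrary operator (|D|, its powers,
   traces, meromorphic continuations, residues) are given by relations, each of
   which determines its last argument when D has compact resolvent. *)

(* P = |D|, the positive square root of D^2. *)
Definition is_abs D P : Prop :=
  [/\ self_adjoint P, forall x, dom P x -> 0 <= inner (P x) x
    & ueq (ucomp P P) (ucomp D D)].

(* Q = |D|^-1: inverse of |D| on the orthogonal of ker D, 0 on ker D. *)
Definition is_abs_inv D Q : Prop :=
  exists P, [/\ is_abs D P, bounded_op Q, forall x, uker D x -> Q x = 0
    & forall x, (forall v, uker D v -> inner x v = 0) ->
        [/\ dom P (Q x), P (Q x) = x
          & forall v, uker D v -> inner (Q x) v = 0]].

(* E = |D|^w, bounded, with the convention that it vanishes on ker D. When D
   has compact resolvent the eigenvectors of |D| span a dense subspace, hence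
   determine E. *)
Definition is_abs_power D (w : C) E : Prop :=
  exists P, [/\ is_abs D P, bounded_op E, forall x, uker D x -> E x = 0
    & forall (mu : R) x, 0 < mu -> dom P x -> P x = toC mu *: x ->
        E x = cpow mu w *: x].

(* Orthonormal basis, padded with zero vectors so that finite-dimensional
   spaces are covered as well. *)
Definition orthonormal_basis (e : nat -> H) : Prop :=
  [/\ forall j k, j != k -> inner (e j) (e k) = 0,
      forall k, e k = 0 \/ `|e k| = 1
    & forall x, (forall k, inner x (e k) = 0) -> x = 0].

Definition hilbert_schmidt B : Prop :=
  bounded_op B /\ exists e, orthonormal_basis e /\
    cvgn (series (fun k => `|B (e k)| ^+ 2)).

Definition trace_class B : Prop :=
  exists B1 B2, [/\ hilbert_schmidt B1, hilbert_schmidt B2 & B = B1 \o B2].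

Definition is_trace T (t : C) : Prop :=
  exists B e, [/\ bounded_extension T B, trace_class B, orthonormal_basis e
    & series (fun k => inner (B (e k)) (e k)) @ \oo --> t].

(* lam lists the eigenvalues of the positive compact operator Q in decreasing
   order, with multiplicity; if Q has finite rank, lam ends with zeros. *)
Definition eigenvalue_sequence Q (lam : nat -> R) : Prop :=
  exists e : nat -> H,
    [/\ forall k, 0 <= lam k.+1 <= lam k,
        forall j k, 0 < lam j -> 0 < lam k ->
          inner (e j) (e k) = (j == k)%:R,
        forall k, 0 < lam k -> Q (e k) = toC (lam k) *: e k
      & forall x, (forall k, 0 < lam k -> inner x (e k) = 0) -> Q x = 0].

(* lam_k = O(k^(-1/n)), where the eigenvalues are numbered from 1. *)
Definition decay_order (lam : nat -> R) (n : nat) : Prop :=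
  exists M : R, forall k, lam k <= M * k.+1%:R `^ (- n%:R^-1).

Definition has_dimension D (n : nat) : Prop :=
  exists Q lam, [/\ is_abs_inv D Q, eigenvalue_sequence Q lam,
    (0 < n)%N, decay_order lam n
    & forall m, (0 < m)%N -> decay_order lam m -> (n <= m)%N].

(* c = delta^k(b), each delta(c') being the bounded extension of the densely
   defined operator [|D|, c']. *)
Fixpoint is_delta_iter P (k : nat) B E : Prop :=
  if k is k'.+1 then
    exists E', is_delta_iter P k' B E' /\
      bounded_extension (ucomm P (everywhere E')) E
  else bounded_op B /\ E = B.

Inductive generated_algebra (G : set (H -> H)) : (H -> H) -> Prop :=
| gen_base B of G B : generated_algebra G B
| gen_lin (c : C) B E of generated_algebra G B & generated_algebra G E :
    generated_algebra G (fun x => c *: B x + E x)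
| gen_mul B E of generated_algebra G B & generated_algebra G E :
    generated_algebra G (B \o E).

(* F is the meromorphic continuation of z |-> Trace(T |D|^(y - 2z)), which is
   defined for Re z large; its poles lie in Sg. *)
Definition is_zeta D T (y : C) (Sg : set C) (F : C -> C) : Prop :=
  meromorphic_off Sg F /\
  exists s : R, forall z : C, s < reC z -> exists E,
    is_abs_power D (y - 2 * z) E /\ is_trace (ucomp T (everywhere E)) (F z).

(* r = tau_k(T |D|^y). *)
Definition is_tau D (k : nat) T (y r : C) : Prop :=
  exists Sg F, is_zeta D T y Sg F /\ is_residue (fun z => z ^+ k * F z) 0 r.

Definition nabla D T : uop H := ucomm (ucomp D D) T.

End Operators.

Record spectral_triple (R : realType) (A : cstarType R) := SpectralTriple {
  st_alg : set A ;
  st_space : hilbertType R ;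
  st_rep : A -> st_space -> st_space ; (* only used on st_alg *)
  st_D : uop st_space ;
  st_pre_cstar : pre_cstar st_alg ;
  st_rep_bounded : forall a, st_alg a -> bounded_op (st_rep a) ;
  st_rep1 : forall x, st_rep cone x = x ;
  st_repP : forall (c : cplx R) a b x, st_alg a -> st_alg b ->
    st_rep (c *: a + b) x = c *: st_rep a x + st_rep b x ;
  st_repM : forall a b x, st_alg a -> st_alg b ->
    st_rep (a ** b) x = st_rep a (st_rep b x) ;
  st_rep_star : forall a x y, st_alg a ->
    inner (st_rep a x) y = inner x (st_rep (star a) y) ;
  st_rep_faithful : forall a b, st_alg a -> st_alg b ->
    st_rep a = st_rep b -> a = b ;
  st_D_self_adjoint : self_adjoint st_D ;
  st_D_compact : compact_resolvent st_D ;
  st_D_dom : forall a x, st_alg a -> dom st_D x -> dom st_D (st_rep a x) ;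
  st_D_comm : forall a, st_alg a ->
    exists B, bounded_extension (ucomm st_D (everywhere (st_rep a))) B
}.

Section Conditions.
Variables (R : realType) (A : cstarType R) (T : spectral_triple A).
Notation H := (st_space T).
Notation D := (st_D T).

(* B is the bounded extension of [D, a]. *)
Definition is_Dcomm (a : A) (B : H -> H) : Prop :=
  bounded_extension (ucomm D (everywhere (st_rep a))) B.

Definition first_order_generators : set (H -> H) :=
  [set B | exists2 a, st_alg T a & B = st_rep a \/ is_Dcomm a B].

Definition regularity_condition : Prop :=
  exists P, is_abs D P /\
    forall B, generated_algebra first_order_generators B ->
    forall k, exists E, is_delta_iter P k B E.

Definition dimension_spectrum_condition : Prop :=
  exists P Sg, is_abs D P /\
    forall B, generated_algebra
      [set E | exists k, exists2 B0, first_order_generators B0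
                                   & is_delta_iter P k B0 E] B ->
    exists F, is_zeta D (everywhere B) 0 Sg F.

End Conditions.

(* Universal differential forms: the pair (a0, [:: a1; ...; an]) stands for
   a0 da1 ... dan, and a sequence of such pairs for their sum. Equality of
   forms is form_eq below. *)
Definition uform (A : Type) := seq (A * seq A).

Section Forms.
Variables (R : realType) (A : cstarType R).
Notation C := (cplx R).
Implicit Types (u v : uform A) (s : seq A).

Definition form_over (B : set A) (n : nat) u : Prop :=
  forall t, t \in u ->
    [/\ B t.1, size t.2 = n & forall x, x \in t.2 -> B x].

(* The relations defining B (x) (B / C1) (x) ... (x) (B / C1). *)
Inductive form_eq (B : set A) : uform A -> uform A -> Prop :=
| form_eq_perm u v of perm_eq u v : form_eq B u v
| form_eq_sym u v of form_eq B u v : form_eq B v u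
| form_eq_trans u v w of form_eq B u v & form_eq B v w : form_eq B u w
| form_eq_cat u u' v v' of form_eq B u u' & form_eq B v v' :
    form_eq B (u ++ v) (u' ++ v')
| form_eq_zero s of (forall x, x \in s -> B x) : form_eq B [:: (0, s)] [::]
| form_eq_add0 a b s of B a & B b & (forall x, x \in s -> B x) :
    form_eq B [:: (a + b, s)] [:: (a, s); (b, s)]
| form_eq_addi a s1 b c s2
    of B a & B b & B c & (forall x, x \in s1 ++ s2 -> B x) :
    form_eq B [:: (a, s1 ++ (b + c) :: s2)]
              [:: (a, s1 ++ b :: s2); (a, s1 ++ c :: s2)]
| form_eq_scale (z : C) a s1 b s2
    of B a & B b & (forall x, x \in s1 ++ s2 -> B x) :
    form_eq B [:: (a, s1 ++ (z *: b) :: s2)] [:: (z *: a, s1 ++ b :: s2)]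
| form_eq_unit a s1 s2 of B a & (forall x, x \in s1 ++ s2 -> B x) :
    form_eq B [:: (a, s1 ++ cone :: s2)] [::].

Definition form_lmul (a : A) u : uform A := [seq (a ** t.1, t.2) | t <- u].
Definition form_scale (z : C) u : uform A := form_lmul (z *: cone) u.
Definition form_d u : uform A := [seq (cone, t.1 :: t.2) | t <- u].

(* da1 ... dan u, computed with the Leibniz rule da w = d(a w) - a dw. *)
Fixpoint form_dmul s u : uform A :=
  if s is a :: s' then
    let w := form_dmul s' u in
    form_d (form_lmul a w) ++ form_scale (-1) (form_lmul a (form_d w))
  else u.

Definition form_mul u v : uform A :=
  flatten [seq form_lmul t.1 (form_dmul t.2 v) | t <- u].

(* (a0 da1 ... dan)^* = (-1)^n dan^* ... da1^* a0^* *)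
Definition form_star u : uform A :=
  flatten [seq form_scale ((-1) ^+ size t.2)
                 (form_dmul (rev (map (@star R A) t.2)) [:: (star t.1, [::])])
          | t <- u].

Variable N : nat.
Implicit Types w : 'M[uform A]_N.

Definition mform_add w w' : 'M[uform A]_N := \matrix_(i, j) (w i j ++ w' i j).
Definition mform_scale (z : C) w : 'M[uform A]_N := map_mx (form_scale z) w.
Definition mform_d w : 'M[uform A]_N := map_mx form_d w.
Definition mform_mul w w' : 'M[uform A]_N :=
  \matrix_(i, j) \big[cat/[::]]_(l < N) form_mul (w i l) (w' l j).
Definition mform_tr w : uform A := \big[cat/[::]]_(i < N) w i i.

Definition hermitian_one_form (B : set A) w : Prop :=
  (forall i j, form_over B 1 (w i j)) /\
  (forall i j, form_eq B (form_star (w j i)) (w i j)).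

End Forms.

Section ChernSimons.
Variables (R : realType) (A : cstarType R) (T : spectral_triple A).
Notation C := (cplx R).
Notation D := (st_D T).
Notation op a := (everywhere (st_rep a : st_space T -> st_space T)).

Definition is_phi3 (t : A * seq A) (v : C) : Prop :=
  exists a0 a1 a2 a3 B1 B2 B3 t0 t1,
    let X := everywhere ((st_rep a0 : st_space T -> st_space T)
                      \o B1 \o B2 \o B3) in
    [/\ t = (a0, [:: a1; a2; a3]),
        [/\ is_Dcomm a1 B1, is_Dcomm a2 B2 & is_Dcomm a3 B3],
        is_tau D 0 X (- 3) t0,
        is_tau D 1 X (- 3) t1
      & v = 12^-1 * t0 - 6^-1 * t1].

Definition is_phi1 (t : A * seq A) (v : C) : Prop :=
  exists a0 a1 B t0 t1 t2 t3 t4 t5,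
    let X0 := ucomp (op a0) (everywhere B) in
    let X1 := ucomp (op a0) (nabla D (everywhere B)) in
    let X2 := ucomp (op a0) (nabla D (nabla D (everywhere B))) in
    [/\ t = (a0, [:: a1]), is_Dcomm a1 B,
        [/\ is_tau D 0 X0 (- 1) t0, is_tau D 0 X1 (- 1) t1
          & is_tau D 1 X1 (- 3) t2],
        [/\ is_tau D 0 X2 (- 5) t3, is_tau D 1 X2 (- 5) t4
          & is_tau D 2 X2 (- 5) t5]
      & v = t0 - 4^-1 * t1 - 2^-1 * t2 + 8^-1 * t3 + 3^-1 * t4 + 12^-1 * t5].

(* Value of the cochain phi on a sum of elementary forms. *)
Definition is_value (phi : A * seq A -> C -> Prop) (u : uform A) (v : C) :=
  exists f : A * seq A -> C,
    (forall t, t \in u -> phi t (f t)) /\ v = \sum_(t <- u) f t.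

(* s = S_CS(w) at level k. *)
Definition is_chern_simons (k : int) (N : nat) (w : 'M[uform A]_N) (s : C) :=
  exists v3 v1,
    [/\ is_value is_phi3
          (mform_tr (mform_add (mform_mul w (mform_d w))
             (mform_scale (2 / 3) (mform_mul w (mform_mul w w))))) v3,
        is_value is_phi1 (mform_tr w) v1
      & s = 6 * toC pi * k%:~R * v3 - 2 * toC pi * k%:~R * v1].

End ChernSimons.

(* Main.v *)
(** Let M_2(C) act on l2(N; C^2 (x) C^2) through the second factor of the fibre and
let D be the direct sum of the blocks mu_n F_n, where F_n is a self-adjoint symmetry
and mu_n takes the value 2^j with multiplicity 7 * 8^j, so that mu_n ~ n^(1/3).
Then |D| is the scalar mu_n on the n-th fibre; it commutes with M_2(C) and with
[D, M_2(C)], hence delta and nabla vanish there. For an operator b whose block traces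
are p(1/mu_n), with p a polynomial, Trace(b |D|^w) is the sum over m of
7 p_m / (1 - 2^(3 - m + w)); its poles are simple and lie on a lattice, and the
residue of Trace(b |D|^(y - 2z)) at z = 0 is 7 p_(3 + y) / (2 ln 2).
For theta = 0, F_n is diag(1, -1) (x) 1 and commutes with the algebra, so the action
vanishes. For theta = 1, F_n is that symmetry turned by a small angle, and the trace
of a0 [D, a1] on the n-th fibre is 2 kappa(a0, a1) mu_n^(-2), where kappa(a0, a1) =
a0_21 a1_12 - a0_12 a1_21. Thus phi_1(a0 da1) = 7 kappa(a0, a1) / ln 2, while phi_3 = 0 because the block traces
of a0 [D, a1] [D, a2] [D, a3] tend to 0. On 2 b^* db - d(b^* b), with b a matrix
unit, phi_1 is 14 / ln 2. *)
Require Import Defs.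
From HB Require Import structures.
From mathcomp Require Import all_boot all_order all_algebra.
From mathcomp Require Import complex.
From mathcomp Require Import all_classical all_reals all_analysis.
From mathcomp Require Import ring lra zify.
Local Open Scope classical_set_scope.
Local Open Scope ring_scope.
Set Implicit Arguments.
Unset Strict Implicit.
Unset Printing Implicit Defensive.
Import Order.TTheory GRing.Theory Num.Theory.
Import numFieldNormedType.Exports.

(** The trace of a0 [D, a1] on a fibre sees D only through its partial trace over the first factor.
    Turning the plane of e_1 (x) e_2 and e_2 (x) e_1 makes this partial trace tau_n diag(1, -1),
    which is not scalar; turning the plane of e_1 (x) e_1 and e_2 (x) e_1 would leave 0. The residue
    dictates the size of the turn: at y = -1 it reads the coefficient of mu_n^(-2), so mu_n (1 -
    cos) has to be of that order, that is cos = 1 - theta mu_n^(-3). Then mu_n sin is at most of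
    order mu_n^(-1/2): commutators stay bounded, but the sine is a square root and not a polynomial
    in 1/mu_n. It occupies only the off-diagonal blocks, so products bring only its square, which is
    a polynomial, to the diagonal blocks; this is why the block traces are polynomials. Eigenvalues
    in powers of 2 turn the Dirichlet series into geometric ones, whose continuation and poles are
    explicit. The form 2 b^* db is not hermitian by itself; the exact term restores the symmetry and
    contributes nothing, since kappa(1, a) = 0. *)

Section ComplexNumbers.
Variable R : realType.
Notation C := (cplx R).
Implicit Types (x y : R) (z w : C).

(** * Real and imaginary parts, modulus and limits of complex numbers *)

Definition cabs z : R := Num.sqrt (reC z ^+ 2 + imC z ^+ 2).
Definition mkC (x y : R) : C := (x +i* y)%C.

Lemma cplx_eq z w : reC z = reC w -> imC z = imC w -> z = w.
Proof. by case: z => a b; case: w => c d; rewrite /reC /imC /= => -> ->. Qed.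

Lemma reD z w : reC (z + w) = reC z + reC w.
Proof. by case: z => a b; case: w. Qed.
Lemma imD z w : imC (z + w) = imC z + imC w.
Proof. by case: z => a b; case: w. Qed.
Lemma reN z : reC (- z) = - reC z. Proof. by case: z. Qed.
Lemma imN z : imC (- z) = - imC z. Proof. by case: z. Qed.
Lemma reB z w : reC (z - w) = reC z - reC w.
Proof. by rewrite reD reN. Qed.
Lemma imB z w : imC (z - w) = imC z - imC w.
Proof. by rewrite imD imN. Qed.
Lemma reM z w : reC (z * w) = reC z * reC w - imC z * imC w.
Proof. by case: z => a b; case: w. Qed.
Lemma imM z w : imC (z * w) = reC z * imC w + imC z * reC w.
Proof. by case: z => a b; case: w => c d; rewrite /imC /reC /= addrC. Qed.
Lemma reJ z : reC z^* = reC z. Proof. by case: z. Qed.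
Lemma imJ z : imC z^* = - imC z. Proof. by case: z. Qed.
Lemma re_toC x : reC (toC x) = x. Proof. by []. Qed.
Lemma im_toC x : imC (toC x) = 0. Proof. by []. Qed.
Lemma re0 : reC (0 : C) = 0. Proof. by []. Qed.
Lemma im0 : imC (0 : C) = 0. Proof. by []. Qed.
Lemma re1 : reC (1 : C) = 1. Proof. by []. Qed.
Lemma im1 : imC (1 : C) = 0. Proof. by []. Qed.
Lemma re_mkC x y : reC (mkC x y) = x. Proof. by []. Qed.
Lemma im_mkC x y : imC (mkC x y) = y. Proof. by []. Qed.
Definition reimE := (reB, imB, reD, imD, reN, imN, reM, imM, reJ, imJ,
  re_toC, im_toC, re0, im0, re1, im1, re_mkC, im_mkC).

Lemma re_sum I (r : seq I) (P : pred I) (F : I -> C) :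
  reC (\sum_(i <- r | P i) F i) = \sum_(i <- r | P i) reC (F i).
Proof. by elim/big_rec2: _ => // i a b _ <-; rewrite reD. Qed.
Lemma im_sum I (r : seq I) (P : pred I) (F : I -> C) :
  imC (\sum_(i <- r | P i) F i) = \sum_(i <- r | P i) imC (F i).
Proof. by elim/big_rec2: _ => // i a b _ <-; rewrite imD. Qed.

Lemma toCD x y : toC (x + y) = toC x + toC y.
Proof. by apply: cplx_eq; rewrite !reimE ?addr0. Qed.
Lemma toCN x : toC (- x) = - toC x.
Proof. by apply: cplx_eq; rewrite !reimE ?oppr0. Qed.
Lemma toCB x y : toC (x - y) = toC x - toC y.
Proof. by rewrite toCD toCN. Qed.
Lemma toCM x y : toC (x * y) = toC x * toC y.
Proof. by apply: cplx_eq; rewrite !reimE; lra. Qed.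
Lemma toC0 : toC (0 : R) = 0. Proof. by []. Qed.
Lemma toC1 : toC (1 : R) = 1. Proof. by []. Qed.
Lemma toCX x n : toC (x ^+ n) = toC x ^+ n.
Proof. by elim: n => [//|n IH]; rewrite !exprS toCM IH. Qed.
Lemma toC_nat n : toC (n%:R : R) = n%:R.
Proof. by elim: n => [//|n IH]; rewrite -!natr1 toCD IH. Qed.
Lemma toC_sum I (r : seq I) (P : pred I) (F : I -> R) :
  toC (\sum_(i <- r | P i) F i) = \sum_(i <- r | P i) toC (F i).
Proof. by elim/big_rec2: _ => // i a b _ <-; rewrite toCD. Qed.
Lemma toCV x : toC x^-1 = (toC x)^-1.
Proof.
have [->|x0] := eqVneq x 0; first by rewrite invr0 toC0 invr0.
have h : toC x^-1 * toC x = 1 by rewrite -toCM mulVf.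
have x1 : toC x != 0 by apply/eqP => -[] /eqP; exact/negP.
by apply: (mulIf x1); rewrite h mulVf.
Qed.
Lemma toC_inj : injective (@toC R).
Proof. by move=> x y []. Qed.
Lemma toC_eq0 x : (toC x == 0) = (x == 0).
Proof. by rewrite -toC0 (inj_eq toC_inj). Qed.
Lemma toCJ x : (toC x)^* = toC x.
Proof. by apply: cplx_eq; rewrite !reimE ?oppr0. Qed.

Lemma toC_le x y : (toC x <= toC y) = (x <= y).
Proof. exact: lecR. Qed.
Lemma toC_lt x y : (toC x < toC y) = (x < y).
Proof. exact: ltcR. Qed.
Lemma toC_ge0 x : (0 <= toC x) = (0 <= x).
Proof. exact: toC_le 0 x. Qed.
Lemma toC_gt0 x : (0 < toC x) = (0 < x).
Proof. exact: toC_lt 0 x. Qed.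

Lemma normCE z : `|z| = toC (cabs z). Proof. exact: normc_def. Qed.
Lemma cabs_ge0 z : 0 <= cabs z. Proof. exact: sqrtr_ge0. Qed.
Lemma cabs_sqr z : cabs z ^+ 2 = reC z ^+ 2 + imC z ^+ 2.
Proof. by rewrite sqr_sqrtr // addr_ge0 ?sqr_ge0. Qed.
Lemma cabsM z w : cabs (z * w) = cabs z * cabs w.
Proof. by apply: toC_inj; rewrite toCM -!normCE normrM. Qed.
Lemma cabsD z w : cabs (z + w) <= cabs z + cabs w.
Proof. by rewrite -toC_le toCD -!normCE ler_normD. Qed.
Lemma cabsN z : cabs (- z) = cabs z.
Proof. by apply: toC_inj; rewrite -!normCE normrN. Qed.
Lemma cabsX z n : cabs (z ^+ n) = cabs z ^+ n.
Proof. by apply: toC_inj; rewrite toCX -!normCE normrX. Qed.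
Lemma cabsV z : cabs z^-1 = (cabs z)^-1.
Proof. by apply: toC_inj; rewrite toCV -!normCE normfV. Qed.
Lemma cabsJ z : cabs z^* = cabs z.
Proof. by rewrite /cabs !reimE sqrrN. Qed.
Lemma cabs0 : cabs 0 = 0.
Proof. by apply: toC_inj; rewrite -normCE normr0. Qed.
Lemma cabs1 : cabs 1 = 1.
Proof. by apply: toC_inj; rewrite -normCE normr1. Qed.
Lemma cabs_eq0 z : (cabs z == 0) = (z == 0).
Proof. by rewrite -toC_eq0 -normCE normr_eq0. Qed.
Lemma cabs_gt0 z : (0 < cabs z) = (z != 0).
Proof. by rewrite lt_def cabs_ge0 cabs_eq0 andbT. Qed.
Lemma cabs_toC x : cabs (toC x) = `|x|.
Proof. by rewrite /cabs !reimE expr0n addr0 sqrtr_sqr. Qed.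
Lemma cabs_sum I (r : seq I) (P : pred I) (F : I -> C) :
  cabs (\sum_(i <- r | P i) F i) <= \sum_(i <- r | P i) cabs (F i).
Proof.
elim/big_rec2: _ => [|i a b _ h]; first by rewrite cabs0.
by rewrite (le_trans (cabsD _ _)) // lerD2l.
Qed.
Lemma re_le_cabs z : `|reC z| <= cabs z.
Proof. by rewrite -sqrtr_sqr ler_wsqrtr // lerDl sqr_ge0. Qed.
Lemma im_le_cabs z : `|imC z| <= cabs z.
Proof. by rewrite -sqrtr_sqr ler_wsqrtr // lerDr sqr_ge0. Qed.
Lemma cabs_le_reim z : cabs z <= `|reC z| + `|imC z|.
Proof.
suff : cabs z ^+ 2 <= (`|reC z| + `|imC z|) ^+ 2.
  by rewrite ler_sqr // nnegrE ?cabs_ge0 // addr_ge0.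
rewrite cabs_sqr.
rewrite -(real_normK (num_real (reC z))) -(real_normK (num_real (imC z))).
have := normr_ge0 (reC z); have := normr_ge0 (imC z); nra.
Qed.
Lemma mulCJ z : z * z^* = toC (cabs z ^+ 2).
Proof. by apply: cplx_eq; rewrite !reimE ?cabs_sqr; ring. Qed.

(** The radii in the topology of [cplx R] are themselves complex numbers; positivity makes them
    real, so that later estimates can use a real epsilon. *)
Lemma posC (e : C) : 0 < e -> e = toC (reC e) /\ 0 < reC e.
Proof.
case: e => a b; rewrite ltcE /= => /andP[/eqP -> a0]; split=> //.
Qed.

Lemma cplx_near (p : C) (P : set C) :
  nbhs p P <-> exists2 e : R, 0 < e & forall z, cabs (z - p) < e -> P z.
Proof.
split.
  move=> /nbhs_ballP[e /= e0 he]; have [ee e0'] := posC e0.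
  exists (reC e) => // z hz; apply: he.
  by rewrite /ball /= ee distrC normCE toC_lt.
move=> [e e0 he]; apply/nbhs_ballP; exists (toC e); first by rewrite /= toC_gt0.
by move=> z; rewrite /ball /= distrC normCE toC_lt => /he.
Qed.

Lemma cplx_dnear (p : C) (P : set C) :
  nbhs p^' P <->
  exists2 e : R, 0 < e & forall z, z != p -> cabs (z - p) < e -> P z.
Proof.
split.
  by move=> /cplx_near[e e0 he]; exists e => // z zp hz; exact: he.
by move=> [e e0 he]; apply/cplx_near; exists e => // z hz zp; exact: he.
Qed.

Lemma cvg_cplxP (T : Type) (F : set_system T) (FF : Filter F) (f : T -> C) l :
  f @ F --> l <-> forall e : R, 0 < e -> \forall t \near F, cabs (f t - l) < e.
Proof.
split.
  move=> /cvgrPdist_lt fl e e0; have := fl (toC e).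
  rewrite toC_gt0 => /(_ e0); apply: filterS => t.
  by rewrite distrC normCE toC_lt.
move=> fl; apply/cvgrPdist_lt => e e0; have [-> e0'] := posC e0.
by apply: filterS (fl _ e0') => t; rewrite distrC normCE toC_lt.
Qed.

Lemma cvg_reim (T : Type) (F : set_system T) (FF : Filter F) (f : T -> C) a b :
  (@reC R \o f) @ F --> a -> (@imC R \o f) @ F --> b -> f @ F --> mkC a b.
Proof.
move=> /cvgrPdist_lt fa /cvgrPdist_lt fb; apply/cvg_cplxP => e e0.
have e2 : 0 < e / 2 by rewrite divr_gt0.
near=> t; apply: (le_lt_trans (cabs_le_reim _)); rewrite !reimE.
rewrite [ltRHS](splitr e) ltrD // distrC; near: t; [exact: fa|exact: fb].
Unshelve. all: by end_near. Qed.

Lemma cvg_re (T : Type) (F : set_system T) (FF : Filter F) (f : T -> C) l :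
  f @ F --> l -> (@reC R \o f) @ F --> reC l.
Proof.
move=> /cvg_cplxP fl; apply/cvgrPdist_lt => e e0.
apply: filterS (fl _ e0) => t; apply: le_lt_trans.
by rewrite distrC /= -reB re_le_cabs.
Qed.

Lemma cvg_im (T : Type) (F : set_system T) (FF : Filter F) (f : T -> C) l :
  f @ F --> l -> (@imC R \o f) @ F --> imC l.
Proof.
move=> /cvg_cplxP fl; apply/cvgrPdist_lt => e e0.
apply: filterS (fl _ e0) => t; apply: le_lt_trans.
by rewrite distrC /= -imB im_le_cabs.
Qed.

Lemma cvg_toC (T : Type) (F : set_system T) (FF : Filter F) (f : T -> R) l :
  f @ F --> l -> (@toC R \o f) @ F --> toC l.
Proof. by move=> fl; apply: cvg_reim => //=; exact: cvg_cst. Qed.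

Lemma ccvgD (T : Type) (F : set_system T) (FF : Filter F) (f g : T -> C) (a b : C) :
  f @ F --> a -> g @ F --> b -> (fun t => f t + g t) @ F --> a + b.
Proof. by move=> fa gb; exact: (@cvgD _ _ _ F FF f g a b fa gb). Qed.

Lemma ccvgB (T : Type) (F : set_system T) (FF : Filter F) (f g : T -> C) (a b : C) :
  f @ F --> a -> g @ F --> b -> (fun t => f t - g t) @ F --> a - b.
Proof. by move=> fa gb; exact: (@cvgB _ _ _ F FF f g a b fa gb). Qed.

Lemma ccvgM (T : Type) (F : set_system T) (FF : Filter F) (f g : T -> C) (a b : C) :
  f @ F --> a -> g @ F --> b -> (fun t => f t * g t) @ F --> a * b.
Proof. by move=> fa gb; exact: (@cvgM _ _ F FF f g a b fa gb). Qed.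

Lemma ccvg_cst (T : Type) (F : set_system T) (FF : Filter F) (a : C) :
  (fun _ : T => a) @ F --> a.
Proof. exact: (@cvg_cst _ a _ F FF). Qed.

End ComplexNumbers.

(** * The complex exponential and its Taylor remainders *)

Section ComplexExponential.
Variable R : realType.
Notation C := (cplx R).

Definition cexp (z : C) : C :=
  toC (expR (reC z)) * mkC (cos (imC z)) (sin (imC z)).

Lemma cpowE (mu : R) (w : C) : cpow mu w = cexp (toC (ln mu) * w).
Proof.
rewrite /cpow /cexp !reimE !mul0r subr0 addr0.
by rewrite ![ln mu * _]mulrC.
Qed.

Lemma cexp0 : cexp 0 = 1.
Proof. by rewrite /cexp !reimE expR0 cos0 sin0 mul1r. Qed.

Lemma cexpD z w : cexp (z + w) = cexp z * cexp w.
Proof.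
by apply: cplx_eq; rewrite /cexp !reimE expRD cosD sinD; ring.
Qed.

Lemma cabs_cexp z : cabs (cexp z) = expR (reC z).
Proof.
rewrite /cexp cabsM cabs_toC ger0_norm ?expR_ge0 // /cabs !reimE.
by rewrite cos2Dsin2 sqrtr1 mulr1.
Qed.

Lemma cexp_neq0 z : cexp z != 0.
Proof. by rewrite -cabs_eq0 cabs_cexp gt_eqF // expR_gt0. Qed.

Lemma cexpN z : cexp (- z) = (cexp z)^-1.
Proof.
by apply: (mulIf (cexp_neq0 z)); rewrite -cexpD addNr cexp0 mulVf ?cexp_neq0.
Qed.

Definition cexp_tail k (z : C) : C := cexp z - \sum_(i < k) (i`!%:R)^-1 * z ^+ i.

Lemma cexp_tailS k z :
  cexp_tail k.+1 z = cexp_tail k z - (k`!%:R)^-1 * z ^+ k.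
Proof. by rewrite /cexp_tail big_ord_recr /= opprD addrA. Qed.

Lemma cexp_tailS0 k : cexp_tail k.+1 0 = 0.
Proof.
rewrite /cexp_tail big_ord_recl big1 ?addr0 => [|i _].
  by rewrite cexp0 fact0 invr1 mul1r expr0 subrr.
by rewrite expr0n mulr0.
Qed.

(** Derivative along a real parameter, taken componentwise so that the real mean value theorem
    applies to each part. *)
Definition is_cderive (f : R -> C) (t : R) (d : C) :=
  is_derive t 1 (@reC R \o f) (reC d) /\ is_derive t 1 (@imC R \o f) (imC d).

Lemma is_cderive_cexp (h : C) (t : R) :
  is_cderive (fun s => cexp (toC s * h)) t (h * cexp (toC t * h)).
Proof.
have lin (a : R) : is_derive t 1 (fun s : R => s * a) a.
  have -> : (fun s : R => s * a) = a \*: (@id R).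
    by apply/funext => s; rewrite mulrC.
  by apply: is_derive_eq; rewrite /GRing.scale /= mulr1.
pose f1 := @expR R \o (fun s : R => s * reC h).
pose f2 := @cos R \o (fun s : R => s * imC h).
pose f3 := @sin R \o (fun s : R => s * imC h).
have d1 : is_derive t 1 f1 (reC h * expR (t * reC h)).
  have h1 := is_derive_expR (t * reC h); have h2 := lin (reC h).
  by apply: is_derive_eq; rewrite /GRing.scale /= mulrC.
have d2 : is_derive t 1 f2 (- imC h * sin (t * imC h)).
  have h1 := is_derive_cos (t * imC h); have h2 := lin (imC h).
  by apply: is_derive_eq; rewrite /GRing.scale /=; ring.
have d3 : is_derive t 1 f3 (imC h * cos (t * imC h)).
  have h1 := is_derive_sin (t * imC h); have h2 := lin (imC h).
  by apply: is_derive_eq; rewrite /GRing.scale /=; ring.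
split.
  have -> : @reC R \o (fun s => cexp (toC s * h)) = f1 * f2.
    apply/funext => s; rewrite /= /cexp !reimE /f1 /f2 /=.
    by rewrite !mul0r !subr0 ?addr0.
  apply: is_derive_eq; rewrite /GRing.scale /= /f1 /f2 /= /cexp !reimE.
  by rewrite !mul0r !subr0 !addr0; ring.
have -> : @imC R \o (fun s => cexp (toC s * h)) = f1 * f3.
  apply/funext => s; rewrite /= /cexp !reimE /f1 /f3 /=.
  by rewrite !mul0r ?subr0 !addr0.
apply: is_derive_eq; rewrite /GRing.scale /= /f1 /f3 /= /cexp !reimE.
by rewrite !mul0r !subr0 !addr0; ring.
Qed.

Lemma is_cderive_tail k (h : C) (t : R) :
  is_cderive (fun s => cexp_tail k.+1 (toC s * h)) t
    (h * cexp_tail k (toC t * h)).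
Proof.
have mono (c : R) n : is_derive t 1 (fun s : R => c * s ^+ n.+1)
    (c * (n.+1%:R * t ^+ n)).
  have -> : (fun s : R => c * s ^+ n.+1) = c \*: ((@id R) ^+ n.+1).
    by apply/funext => s; rewrite /= exprfctE.
  by apply: is_derive_eq; rewrite /GRing.scale /= mulr1.
elim: k => [|k [IH1 IH2]].
  have [h1 h2] := is_cderive_cexp h t.
  have E0 z : cexp_tail 0 z = cexp z by rewrite /cexp_tail big_ord0 subr0.
  rewrite E0; split.
    have -> : @reC R \o (fun s => cexp_tail 1 (toC s * h)) =
        (@reC R \o (fun s => cexp (toC s * h))) - cst 1.
      apply/funext => s; rewrite /= cexp_tailS E0 fact0 invr1 mul1r expr0.
      by rewrite reB.
    by apply: is_derive_eq; rewrite subr0.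
  have -> : @imC R \o (fun s => cexp_tail 1 (toC s * h)) =
      (@imC R \o (fun s => cexp (toC s * h))) - cst 0.
    apply/funext => s; rewrite /= cexp_tailS E0 fact0 invr1 mul1r expr0.
    by rewrite imB.
  by apply: is_derive_eq; rewrite subr0.
pose c : C := (k.+1`!%:R)^-1 * h ^+ k.+1.
have E s : cexp_tail k.+2 (toC s * h) =
    cexp_tail k.+1 (toC s * h) - toC (s ^+ k.+1) * c.
  by rewrite cexp_tailS exprMn toCX /c mulrCA.
have E2 : h * cexp_tail k.+1 (toC t * h) = h * cexp_tail k (toC t * h) -
    toC (k.+1%:R * t ^+ k) * c.
  rewrite cexp_tailS mulrBr; congr (_ - _).
  have k0 : (k.+1%:R : C) != 0 by rewrite pnatr_eq0.
  rewrite /c factS natrM toCM toC_nat toCX exprMn exprS invfM.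
  by move: (k.+1%:R : C) k0 (k`!%:R^-1 : C) => n n0 f; field.
clearbody c; rewrite E2; split.
  have -> : @reC R \o (fun s => cexp_tail k.+2 (toC s * h)) =
      (@reC R \o (fun s => cexp_tail k.+1 (toC s * h))) -
      (fun s => reC c * s ^+ k.+1).
    by apply/funext => s; rewrite /= E reB reM re_toC im_toC mul0r subr0 [_ * reC c]mulrC.
  have h2 := mono (reC c) k.
  by apply: is_derive_eq; rewrite reB [reC (toC _ * c)]reM mul0r subr0 [_ * reC c]mulrC.
have -> : @imC R \o (fun s => cexp_tail k.+2 (toC s * h)) =
    (@imC R \o (fun s => cexp_tail k.+1 (toC s * h))) -
    (fun s => imC c * s ^+ k.+1).
  by apply/funext => s; rewrite /= E imB imM re_toC im_toC mul0r addr0 [_ * imC c]mulrC.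
have h2 := mono (imC c) k.
by apply: is_derive_eq; rewrite imB [imC (toC _ * c)]imM mul0r addr0 [_ * imC c]mulrC.
Qed.

(** Along the segment from 0 to [h] the derivative of the remainder of order k + 1 is [h] times the
    remainder of order k, and the former vanishes at 0. The mean value theorem is applied to the
    real and to the imaginary part separately, which doubles the constant at each step. *)
Lemma cexp_tail_bound k :
  exists2 M : R, 0 <= M & forall z : C, cabs z <= 1 ->
    cabs (cexp_tail k z) <= M * cabs z ^+ k.
Proof.
elim: k => [|k [M M0 IH]].
  exists (expR 1); rewrite ?expR_ge0 // => z z1.
  rewrite /cexp_tail big_ord0 subr0 cabs_cexp expr0 mulr1 ler_expR.
  by rewrite (le_trans _ z1) // (le_trans (ler_norm _)) // re_le_cabs.
exists (M + M) => [|h h1]; first by rewrite addr_ge0.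
have bnd (c : R) : c \in `[0, 1]%R ->
    cabs (h * cexp_tail k (toC c * h)) <= M * cabs h ^+ k.+1.
  rewrite in_itv /= => /andP[c0 c1].
  have ch : cabs (toC c * h) <= cabs h.
    by rewrite cabsM cabs_toC ger0_norm // ler_piMl // cabs_ge0.
  rewrite cabsM exprS mulrCA ler_wpM2l ?cabs_ge0 //.
  apply: (le_trans (IH _ (le_trans ch h1))).
  by rewrite ler_wpM2l // lerXn2r // nnegrE cabs_ge0.
have cont (f : R -> R) (df : R -> R) :
    (forall x : R, is_derive x 1 f (df x)) -> {within `[0, 1], continuous f}.
  move=> fd; apply: continuous_subspaceT => x.
  exact/differentiable_continuous/derivable1_diffP/ex_derive.
apply: (le_trans (cabs_le_reim _)); rewrite mulrDl.
have E0 : cexp_tail k.+1 (toC 0 * h) = 0 by rewrite toC0 mul0r cexp_tailS0.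
have E1 : cexp_tail k.+1 (toC 1 * h) = cexp_tail k.+1 h by rewrite toC1 mul1r.
apply: lerD.
  pose df t := reC (h * cexp_tail k (toC t * h)).
  have fd (x : R) : is_derive x 1
      (@reC R \o (fun s => cexp_tail k.+1 (toC s * h))) (df x).
    by have [] := is_cderive_tail k h x.
  have [c c01] := @MVT_segment _ _ df 0 1 ler01 (fun x _ => fd x) (cont _ _ fd).
  rewrite /= E0 E1 re0 !subr0 mulr1 => ->.
  exact: le_trans (re_le_cabs _) (bnd _ c01).
pose df t := imC (h * cexp_tail k (toC t * h)).
have fd (x : R) : is_derive x 1
    (@imC R \o (fun s => cexp_tail k.+1 (toC s * h))) (df x).
  by have [] := is_cderive_tail k h x.
have [c c01] := @MVT_segment _ _ df 0 1 ler01 (fun x _ => fd x) (cont _ _ fd).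
rewrite /= E0 E1 im0 !subr0 mulr1 => ->.
exact: le_trans (im_le_cabs _) (bnd _ c01).
Qed.

End ComplexExponential.

(** * Complex differentiability, simple poles, and the poles of 1 / (1 - e^w) *)

Section SimplePoles.
Variable R : realType.
Notation C := (cplx R).

Lemma derivable_epsP (F : C -> C) (z : C) : derivable F z 1 <->
  exists d : C, forall eps : R, 0 < eps -> exists2 e : R, 0 < e &
    forall h, cabs h < e -> cabs (F (z + h) - F z - d * h) <= eps * cabs h.
Proof.
have quot d h : h != 0 -> h^-1 *: ((F \o shift z) (h *: 1) - F z) - d =
    h^-1 * (F (z + h) - F z - d * h).
  move=> h0; have -> : h *: (1 : C) = h by rewrite /GRing.scale /= mulr1.
  by rewrite /= [h + z]addrC mulrBr [d * h]mulrC mulKf.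
split.
  move=> /cvg_ex[d /cvg_cplxP hd]; exists d => eps /hd /cplx_dnear[e e0 he].
  exists e => // h hh; have [->|h0] := eqVneq h 0.
    by rewrite addr0 subrr mulr0 subr0 cabs0 mulr0.
  have := he h h0; rewrite subr0 => /(_ hh) /ltW.
  rewrite quot // cabsM cabsV ler_pdivrMl ?cabs_gt0 //.
  by rewrite [cabs h * eps]mulrC.
move=> [d hd]; apply/cvg_ex; exists d; apply/cvg_cplxP => eps eps0.
have [e e0 he] := hd _ (divr_gt0 eps0 (ltr0n R 2)).
apply/cplx_dnear; exists e => // h h0; rewrite subr0 => hh.
rewrite quot // cabsM cabsV ltr_pdivrMl ?cabs_gt0 //.
apply: (le_lt_trans (he _ hh)); rewrite mulrC ltr_pM2l ?cabs_gt0 //.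
by rewrite ltr_pdivrMr // ltr_pMr // ltr1n.
Qed.

Lemma derivable_quadratic (F : C -> C) (z d : C) (M e : R) : 0 < e ->
  (forall h, cabs h < e -> cabs (F (z + h) - F z - d * h) <= M * cabs h ^+ 2) ->
  derivable F z 1.
Proof.
move=> e0 hF; apply/derivable_epsP; exists d => eps eps0.
exists (Num.min e (eps / (`|M| + 1))).
  by rewrite lt_min e0 divr_gt0 // ltr_wpDl.
move=> h; rewrite lt_min => /andP[he hM].
apply: (le_trans (hF _ he)); rewrite expr2 mulrA ler_wpM2r ?cabs_ge0 //.
apply: (@le_trans _ _ ((`|M| + 1) * cabs h)).
  by rewrite ler_wpM2r ?cabs_ge0 // (le_trans (ler_norm M)) // lerDl.
by rewrite -ler_pdivlMl 1?mulrC ?ltW // ltr_wpDl.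
Qed.

Lemma derivable_comp_affine (G : C -> C) (al be z : C) :
  derivable G (al * z + be) 1 -> derivable (fun w => G (al * w + be)) z 1.
Proof.
move=> /derivable_epsP[d hd]; apply/derivable_epsP; exists (d * al) => eps eps0.
have al1 : 0 < cabs al + 1 by rewrite ltr_wpDl ?cabs_ge0.
have [e e0 he] := hd _ (divr_gt0 eps0 al1).
exists (e / (cabs al + 1)); first by rewrite divr_gt0.
move=> h; rewrite ltr_pdivlMr // => hh.
have hal : cabs (al * h) <= (cabs al + 1) * cabs h.
  by rewrite cabsM ler_wpM2r ?cabs_ge0 // lerDl.
have hh' : (cabs al + 1) * cabs h < e by rewrite mulrC.
have -> : al * (z + h) + be = al * z + be + al * h by ring.
have := he _ (le_lt_trans hal hh'); rewrite mulrA => /le_trans; apply.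
by rewrite -mulrA ler_wpM2l ?(ltW eps0) // ler_pdivrMl.
Qed.

Lemma cderivableD (F G : C -> C) z :
  derivable F z 1 -> derivable G z 1 -> derivable (fun w => F w + G w) z 1.
Proof. by move=> h1 h2; exact: (@derivableD _ _ _ F G z 1 h1 h2). Qed.

Lemma cderivableM (F G : C -> C) z :
  derivable F z 1 -> derivable G z 1 -> derivable (fun w => F w * G w) z 1.
Proof. by move=> h1 h2; exact: (@derivableM _ _ F G z 1 h1 h2). Qed.

Lemma cderivableV (F : C -> C) z :
  F z != 0 -> derivable F z 1 -> derivable (fun w => (F w)^-1) z 1.
Proof. by move=> h1 h2; exact: (@derivableV _ _ F z 1 h1 h2). Qed.

Lemma cderivable_cst (c z : C) : derivable (fun=> c) z 1.
Proof. exact: (@derivable_cst _ _ _ c z 1). Qed.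

Lemma cderivable_id (z : C) : derivable (fun w : C => w) z 1.
Proof. exact: (@derivable_id _ _ z 1). Qed.

Lemma cderivableX (m : nat) (z : C) : derivable (fun w : C => w ^+ m) z 1.
Proof.
elim: m => [|m IH]; first exact: cderivable_cst.
have -> : (fun w : C => w ^+ m.+1) = (fun w => w * w ^+ m).
  by apply/funext => w; rewrite exprS.
exact: (@cderivableM (fun w => w) (fun w => w ^+ m) z (@cderivable_id z) IH).
Qed.

Lemma near_affine (al be p : C) (P : set C) :
  (\forall z \near al * p + be, P z) -> \forall z \near p, P (al * z + be).
Proof.
move=> /cplx_near[e e0 he]; apply/cplx_near; exists (e / (cabs al + 1)).
  by rewrite divr_gt0 // ltr_wpDl ?cabs_ge0.
move=> z hz; apply: he.
rewrite opprD addrACA subrr addr0 -mulrBr cabsM.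
apply: (@le_lt_trans _ _ ((cabs al + 1) * cabs (z - p))).
  by rewrite ler_wpM2r ?cabs_ge0 // lerDl.
by rewrite -ltr_pdivlMl 1?mulrC // ltr_wpDl ?cabs_ge0.
Qed.

Lemma dnear_affine (al be p : C) (P : set C) : al != 0 ->
  (\forall z \near (al * p + be)^', P z) ->
  \forall z \near p^', P (al * z + be).
Proof.
move=> al0 hP; have := near_affine (P := fun z => z != al * p + be -> P z) hP.
move=> /cplx_near[e e0 he]; apply/cplx_dnear; exists e => // z zp hz.
apply: he => //; apply: contra zp => /eqP/addIr/(mulfI al0) ->.
by [].
Qed.

(** The residue [r] may be 0, so that regular points are included and the predicate is stable under
    sums. *)
Definition simple_pole (F : C -> C) (p r : C) : Prop :=
  exists2 G : C -> C, \forall z \near p, derivable G z 1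
    & \forall z \near p^', F z = r / (z - p) + G z.

Lemma simple_pole_regular (F : C -> C) (p : C) :
  (\forall z \near p, derivable F z 1) -> simple_pole F p 0.
Proof.
move=> dF; exists F => //; apply: nearW => z.
by rewrite mul0r add0r.
Qed.

Lemma simple_poleD (F F' : C -> C) p r r' :
  simple_pole F p r -> simple_pole F' p r' ->
  simple_pole (fun z => F z + F' z) p (r + r').
Proof.
move=> [G dG eG] [G' dG' eG']; exists (fun z => G z + G' z).
  by apply: filterS2 dG dG' => z h1 h2; exact: (@cderivableD G G' z h1 h2).
apply: filterS2 eG eG' => z -> ->.
by rewrite addrACA mulrDl.
Qed.

Lemma simple_poleZ (F : C -> C) p r c :
  simple_pole F p r -> simple_pole (fun z => c * F z) p (c * r).
Proof.
move=> [G dG eG]; exists (fun z => c * G z).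
  apply: filterS dG => z h.
  exact: (@cderivableM (fun=> c) G z (@cderivable_cst c z) h).
by apply: filterS eG => z ->; rewrite mulrDr mulrA.
Qed.

Lemma simple_pole_sum n (F : 'I_n -> C -> C) p (r : 'I_n -> C) :
  (forall i, simple_pole (F i) p (r i)) ->
  simple_pole (fun z => \sum_i F i z) p (\sum_i r i).
Proof.
elim: n F r => [|n IH] F r h.
  rewrite big_ord0; apply: simple_pole_regular; apply/cplx_near; exists 1 => // z _.
  have -> : (fun z => \sum_(i < 0) F i z) = fun=> 0.
    by apply/funext => w; rewrite big_ord0.
  exact: cderivable_cst.
rewrite big_ord_recl.
have -> : (fun z => \sum_(i < n.+1) F i z) =
    (fun z => F ord0 z + \sum_(i < n) F (lift ord0 i) z).
  by apply/funext => w; rewrite big_ord_recl.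
by apply: simple_poleD => //; apply: IH => i; exact: h.
Qed.

Lemma simple_pole_affine F al be p r : al != 0 ->
  simple_pole F (al * p + be) r ->
  simple_pole (fun z => F (al * z + be)) p (r / al).
Proof.
move=> al0 [G dG eG]; exists (fun z => G (al * z + be)).
  by apply: filterS (near_affine dG) => z; exact: derivable_comp_affine.
apply: filterS (dnear_affine al0 eG) => z ->.
by rewrite opprD addrACA subrr addr0 -mulrBr invfM mulrA.
Qed.

Lemma simple_pole_residue (F : C -> C) p r : simple_pole F p r -> is_residue F p r.
Proof.
move=> [G dG eG]; exists 0%N, (fun=> r), G; split => //.
by apply: filterS eG => z ->; rewrite big_ord1 expr1.
Qed.

(** A positive power of z cancels a simple pole; hence only tau_0 can be nonzero when all poles are
    simple. *)
Lemma simple_pole_residueX (F : C -> C) r k : simple_pole F 0 r ->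
  is_residue (fun z => z ^+ k * F z) 0 (if k is 0%N then r else 0).
Proof.
case: k => [|k] sF.
  apply: simple_pole_residue.
  have -> : (fun z => z ^+ 0 * F z) = F by apply/funext => z; rewrite mul1r.
  exact: sF.
apply: simple_pole_residue; have [G dG eG] := sF.
exists (fun z => r * z ^+ k + z ^+ k.+1 * G z).
  apply: filterS dG => z h.
  have h1 := @cderivableM (fun=> r) (fun z => z ^+ k) z
    (@cderivable_cst r z) (@cderivableX k z).
  have h2 := @cderivableM (fun z => z ^+ k.+1) G z (@cderivableX k.+1 z) h.
  exact: (@cderivableD (fun z => r * z ^+ k) (fun z => z ^+ k.+1 * G z) z h1 h2).
apply/cplx_dnear; have /cplx_dnear[e e0 he] := eG; exists e => // z z0 hz.
rewrite he // subr0 mul0r add0r mulrDr; congr (_ + _).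
by rewrite exprS; field.
Qed.

Lemma derivable_cexp z : derivable (@cexp R) z 1.
Proof.
have [M M0 hM] := cexp_tail_bound R 2.
apply: (@derivable_quadratic _ _ (cexp z) (cabs (cexp z) * M) 1) => // h h1.
have -> : cexp (z + h) - cexp z - cexp z * h = cexp z * cexp_tail 2 h.
  rewrite /cexp_tail !big_ord_recl big_ord0 /= cexpD !fact0 invr1 expr0 expr1.
  by rewrite !mul1r addr0; ring.
by rewrite cabsM -mulrA ler_wpM2l ?cabs_ge0 // hM // ltW.
Qed.

(** If [cexp p] and [cexp w] are both 1, the remainder of order 2 at [w - p] equals [-(w - p)],
    which contradicts its quadratic bound once [w] is close to [p]. If [cexp p] is not 1, continuity
    suffices. *)
Lemma near_cexp_neq1 p : \forall w \near p^', cexp w != 1 :> C.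
Proof.
apply/cplx_dnear; have [Ep|Ep] := eqVneq (cexp p) 1.
  have [M M0 hM] := cexp_tail_bound R 2.
  exists (Num.min 1 (M + 1)^-1) => [|w wp].
    by rewrite lt_min ltr01 invr_gt0 ltr_wpDl.
  rewrite lt_min => /andP[/ltW w1 wM]; apply/eqP => Ew.
  have wp0 : 0 < cabs (w - p) by rewrite cabs_gt0 subr_eq0.
  have E1 : cexp (w - p) = 1 by rewrite cexpD cexpN Ew Ep divr1.
  have := hM _ w1; rewrite /cexp_tail E1 !big_ord_recl big_ord0 /= fact0.
  rewrite invr1 expr0 expr1 !mul1r addr0 opprD addrA subrr add0r cabsN.
  rewrite expr2 mulrA ler_pMl // leNgt => /negP; apply.
  move: wM; rewrite -[(M + 1)^-1]mul1r ltr_pdivlMr ?ltr_wpDl //.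
  nra.
have : {for p, continuous (@cexp R)}.
  exact/differentiable_continuous/derivable1_diffP/derivable_cexp.
move=> /cvg_cplxP /(_ (cabs (cexp p - 1))).
rewrite cabs_gt0 subr_eq0 => /(_ Ep) /cplx_near[e e0 he].
exists e => // w _ /he hw; apply: contraTN hw => /eqP ->.
by rewrite -leNgt -cabsN opprB lexx.
Qed.

(** The value at 0 is the limit, so that the function is entire and e^h = 1 + h + h^2 [cexp_quot h]
    holds for every h. *)
Definition cexp_quot (h : C) : C :=
  if h == 0 then 2^-1 else (cexp h - 1 - h) / h ^+ 2.

Lemma derivable_cexp_quot z : derivable cexp_quot z 1.
Proof.
have [->|z0] := eqVneq z 0.
  have [M M0 hM] := cexp_tail_bound R 4.
  (* The slope 1/6 is the next Taylor coefficient; what remains is the tail of order 4 divided by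
     h^2, hence of order h^2. *)
  apply: (@derivable_quadratic _ _ (6^-1) M 1) => // h /ltW h1.
  rewrite add0r /cexp_quot eqxx; have [->|h0] := eqVneq h 0.
    by rewrite !(mulr0, subrr, cabs0, expr0n).
  have -> : (cexp h - 1 - h) / h ^+ 2 - 2^-1 - 6^-1 * h =
      cexp_tail 4 h / h ^+ 2.
    rewrite /cexp_tail !big_ord_recl big_ord0 /= /bump /= !add1n !factS fact0.
    by rewrite /= !mulr1n; field.
  rewrite cabsM cabsV cabsX ler_pdivrMr ?exprn_gt0 ?cabs_gt0 //.
  by rewrite -mulrA -exprD hM.
apply: (@near_eq_derivable _ _ _ (fun h => (cexp h - 1 - h) * (h ^+ 2)^-1)).
  apply/cplx_near; exists (cabs z); rewrite ?cabs_gt0 // => w hw.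
  rewrite /cexp_quot; case: eqP => // w0; move: hw.
  by rewrite w0 sub0r cabsN ltxx.
have h1 := @cderivableD (@cexp R) (fun=> - 1) z (@derivable_cexp z)
  (@cderivable_cst (-1) z).
have h2 := @cderivableD (fun h => cexp h - 1) (fun h => - h) z h1
  (@derivableN _ _ _ id z 1 (@cderivable_id z)).
have h3 : derivable (fun h : C => (h ^+ 2)^-1) z 1.
  exact: (@cderivableV (fun h => h ^+ 2) z (expf_neq0 2 z0) (@cderivableX 2 z)).
exact: (@cderivableM (fun h => cexp h - 1 - h) (fun h => (h ^+ 2)^-1) z h2 h3).
Qed.

(** Sum of the geometric series of ratio [cexp w] when [reC w < 0]; the formula is its meromorphic
    continuation. *)
Definition geom_fun (w : C) : C := (1 - cexp w)^-1.

Lemma derivable_geom_fun p : cexp p != 1 -> derivable geom_fun p 1.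
Proof.
move=> Ep; have h1 := @cderivableD (fun=> 1) (fun w => - cexp w) p
  (@cderivable_cst 1 p) (@derivableN _ _ _ (@cexp R) p 1 (@derivable_cexp p)).
have h0 : 1 - cexp p != 0 by rewrite subr_eq0 eq_sym.
exact: (@cderivableV (fun w => 1 - cexp w) p h0 h1).
Qed.

(** Periodicity moves [p] to 0. There, with q = [cexp_quot h], one has 1 - e^h = - h (1 + h q),
    hence 1 / (1 - e^h) = - 1/h + q / (1 + h q). *)
Lemma geom_fun_pole p : cexp p = 1 -> simple_pole geom_fun p (-1).
Proof.
move=> Ep.
suff sp0 : simple_pole geom_fun (1 * p + - p) (-1).
  rewrite -[-1]divr1.
  have -> : geom_fun = fun z => geom_fun (1 * z + - p).
    apply/funext => z; rewrite mul1r /geom_fun cexpD cexpN Ep.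
    by rewrite invr1 mulr1.
  by apply: simple_pole_affine; rewrite ?oner_neq0.
rewrite mul1r subrr.
have [M M0 hM] := cexp_tail_bound R 2.
have quot h : cexp h = 1 + h + h ^+ 2 * cexp_quot h.
  rewrite /cexp_quot; have [->|h0] := eqVneq h 0.
    by rewrite cexp0 expr0n mul0r !addr0.
  by field.
(* If 1 + h q vanished, then e^h = 1 and the remainder of order 2 at h would be -h, too large for
   its quadratic bound. *)
have den0 : \forall h \near (0 : C), 1 + h * cexp_quot h != 0.
  apply/cplx_near; exists (Num.min 1 (M + 1)^-1) => [|h].
    by rewrite lt_min ltr01 invr_gt0 ltr_wpDl.
  rewrite subr0 lt_min => /andP[/ltW h1 hM1].
  have [->|h0] := eqVneq h 0; first by rewrite mul0r addr0 oner_neq0.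
  apply/eqP => /eqP; rewrite addrC addr_eq0 => /eqP hq.
  have := hM _ h1; rewrite /cexp_tail quot expr2 -mulrA hq.
  rewrite !big_ord_recl big_ord0 /= fact0 invr1 expr0 expr1 !mul1r addr0.
  have -> : 1 + h + h * -1 - (1 + h) = - h by ring.
  have hp : 0 < cabs h by rewrite cabs_gt0.
  rewrite cabsN expr2 mulrA ler_pMl // leNgt => /negP; apply.
  move: hM1; rewrite -[(M + 1)^-1]mul1r ltr_pdivlMr ?ltr_wpDl //.
  nra.
exists (fun h => cexp_quot h * (1 + h * cexp_quot h)^-1).
  apply: filterS den0 => h h0; have dq := @derivable_cexp_quot h.
  have h1 := @cderivableM (fun h => h) cexp_quot h (@cderivable_id h) dq.
  have h2 := @cderivableD (fun=> 1) (fun h => h * cexp_quot h) h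
    (@cderivable_cst 1 h) h1.
  have h3 := @cderivableV (fun h => 1 + h * cexp_quot h) h h0 h2.
  exact: (@cderivableM cexp_quot (fun h => (1 + h * cexp_quot h)^-1) h dq h3).
move/cplx_near: den0 => [e e0 he]; apply/cplx_dnear; exists e => // h h0 hh.
have := he _ hh; rewrite subr0 /geom_fun quot => d0.
have -> : 1 - (1 + h + h ^+ 2 * cexp_quot h) =
    - (h * (1 + h * cexp_quot h)) by ring.
by move: (cexp_quot h) d0 => q d0; field; rewrite ?h0 ?d0.
Qed.

Lemma geom_fun_simple_pole p :
  simple_pole geom_fun p (if cexp p == 1 then -1 else 0).
Proof.
have [Ep|Ep] := eqVneq (cexp p) 1; first exact: geom_fun_pole.
apply: simple_pole_regular; have := near_cexp_neq1 p.
move=> /cplx_dnear[e e0 he]; apply/cplx_near; exists e => // w hw.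
apply: derivable_geom_fun; have [->//|wp] := eqVneq w p.
exact: he.
Qed.

End SimplePoles.

(** * Cauchy-Schwarz and the triangle inequality for a positive hermitian form, shared by C^n and
    l2 *)

Section InnerProducts.
Variables (R : realType) (V : lmodType (cplx R)).
Notation C := (cplx R).
Variables (ip : V -> V -> C) (q : V -> R).
Hypothesis ipP : forall (c : C) x y z, ip (c *: x + y) z = c * ip x z + ip y z.
Hypothesis ipJ : forall x y, ip y x = (ip x y)^*.
Hypothesis ipq : forall x, ip x x = toC (q x).
Hypothesis q_ge0 : forall x, 0 <= q x.

Lemma ip_quadratic (c : C) x y :
  q (c *: x + y) = cabs c ^+ 2 * q x + 2 * reC (c * ip x y) + q y.
Proof.
have E : ip (c *: x + y) (c *: x + y) =
    c * c^* * ip x x + c * ip x y + (c * ip x y)^* + ip y y.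
  rewrite ipP (ipJ (c *: x + y) x) (ipJ (c *: x + y) y) !ipP.
  rewrite (ipJ x y) !rmorphD !rmorphM /= conjCK.
  by rewrite -[(ip x x)^*]ipJ -[(ip y y)^*]ipJ; ring.
have := congr1 (@reC R) E; rewrite !ipq !reD re_toC => ->.
by rewrite mulCJ -toCM re_toC reJ re_toC; ring.
Qed.

Lemma ip_CauchySchwarz x y : cabs (ip x y) ^+ 2 <= q x * q y.
Proof.
have key (t : R) : 0 <= t ^+ 2 * cabs (ip x y) ^+ 2 * q x
    - 2 * t * cabs (ip x y) ^+ 2 + q y.
  have := q_ge0 ((- toC t * (ip x y)^*) *: x + y); rewrite ip_quadratic.
  have -> : - toC t * (ip x y)^* * ip x y = toC (- t * cabs (ip x y) ^+ 2).
    by rewrite toCM -mulCJ toCN; ring.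
  rewrite re_toC cabsM cabsN cabs_toC cabsJ exprMn real_normK ?num_real //.
  by congr (0 <= _); ring.
have [qx|] := ltP 0 (q x).
  have := key (q x)^-1.
  have -> : (q x)^-1 ^+ 2 * cabs (ip x y) ^+ 2 * q x -
      2 * (q x)^-1 * cabs (ip x y) ^+ 2 + q y =
      (q x * q y - cabs (ip x y) ^+ 2) / q x by field; rewrite gt_eqF.
  by rewrite pmulr_lge0 ?invr_gt0 // subr_ge0.
move=> qx; have {qx}qx0 : q x = 0 by apply/le_anti; rewrite qx q_ge0.
rewrite qx0 mul0r leNgt; apply/negP => i0.
(* When [q x] is 0 the bound [key] is affine in t, and this t makes it negative. *)
have := key ((q y + 1) / cabs (ip x y) ^+ 2).
rewrite qx0 mulr0 sub0r mulrA divfK ?gt_eqF //.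
by have := q_ge0 y; nra.
Qed.

Lemma ip_triangle x y :
  Num.sqrt (q (x + y)) <= Num.sqrt (q x) + Num.sqrt (q y).
Proof.
have sq0 z : 0 <= Num.sqrt (q z) := sqrtr_ge0 _.
rewrite -ler_sqr ?nnegrE ?addr_ge0 // sqr_sqrtr // sqrrD !sqr_sqrtr //.
have -> : q (x + y) = q x + 2 * reC (ip x y) + q y.
  by rewrite -[x]scale1r ip_quadratic cabs1 expr1n !mul1r scale1r.
rewrite lerD2r lerD2l -[leRHS]mulr_natl ler_pM2l //.
apply: (le_trans (ler_norm _)); apply: (le_trans (re_le_cabs _)).
rewrite -ler_sqr ?nnegrE ?cabs_ge0 ?mulr_ge0 // exprMn !(sqr_sqrtr (q_ge0 _)).
exact: ip_CauchySchwarz.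
Qed.

End InnerProducts.

(** * Cauchy filters in complex normed spaces *)

Section CauchyFilters.
Variables (R : realType) (V : normedModType (cplx R)).
Notation C := (cplx R).

Lemma cauchy_epsP (F : set_system V) (FF : ProperFilter F) : cauchy F ->
  forall e : R, 0 < e -> exists2 A : set V, F A &
    forall x y, A x -> A y -> `|x - y| <= toC e.
Proof.
move=> cF e e0; have e2 : 0 < toC e / 2 :> C by rewrite divr_gt0 // toC_gt0.
have [x0 Fx0] := (cauchyP F).1 cF _ e2.
exists (ball x0 (toC e / 2)) => // x y; rewrite -ball_normE /= => hx hy.
rewrite [toC e]splitr -[x](subrK x0) -addrA.
by rewrite (le_trans (ler_normD _ _)) // lerD // ltW // distrC.
Qed.

(** Reduces the completeness of the matrix algebra and of l2 to that of [R], one real coordinate at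
    a time. *)
Lemma cauchy_coord (F : set_system V) (FF : ProperFilter F) (phi : V -> R) :
  (forall x y, toC `|phi x - phi y| <= `|x - y|) -> cauchy F ->
  exists l : R, phi @ F --> l.
Proof.
move=> hphi cF; suff : cvg (phi @ F) by move=> h; exists (lim (phi @ F)).
apply: R_complete; apply/cauchyP => e e0.
have [A FA hA] := cauchy_epsP FF cF (divr_gt0 e0 (ltr0n R 2)).
have [x0 Ax0] := filter_ex FA.
exists (phi x0); suff : F [set x | ball (phi x0) e (phi x)] by [].
apply: filterS FA => x Ax; rewrite /= -ball_normE /=.
have := le_trans (hphi x0 x) (hA _ _ Ax0 Ax); rewrite toC_le => /le_lt_trans.
by apply; rewrite ltr_pdivrMr // ltr_pMr // ltr1n.
Qed.

Lemma cvg_normCP (F : set_system V) (FF : Filter F) (l : V) :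
  (forall e : R, 0 < e -> \forall x \near F, `|x - l| <= toC e) -> F --> l.
Proof.
move=> h; apply/cvgrPdist_le => e e0; have [-> e1] := posC e0.
by apply: filterS (h _ e1) => x; rewrite distrC.
Qed.

End CauchyFilters.

(** * Euclidean length on C^n, adjoint matrices and the operator norm *)

Section ColumnVectors.
Variables (R : realType).
Notation C := (cplx R).

Definition cdot n (v w : 'cV[C]_n) : C := \sum_i v i 0 * (w i 0)^*.
Definition csq n (v : 'cV[C]_n) : R := \sum_i cabs (v i 0) ^+ 2.
Definition adjmx n (a : 'M[C]_n) : 'M[C]_n := \matrix_(i, j) (a j i)^*.
Definition mxbound n (a : 'M[C]_n) : R := \sum_i \sum_j cabs (a i j).

Variable n : nat.
Implicit Types (v w : 'cV[C]_n) (a b : 'M[C]_n).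

Lemma cdotP (c : C) u v w : cdot (c *: u + v) w = c * cdot u w + cdot v w.
Proof.
rewrite /cdot mulr_sumr -big_split /=; apply: eq_bigr => i _.
by rewrite !mxE mulrDl mulrA.
Qed.

Lemma cdotJ v w : cdot w v = (cdot v w)^*.
Proof.
rewrite /cdot rmorph_sum; apply: eq_bigr => i _.
by rewrite rmorphM /= conjCK mulrC.
Qed.

Lemma cdotvv v : cdot v v = toC (csq v).
Proof. by rewrite /csq toC_sum; apply: eq_bigr => i _; rewrite mulCJ. Qed.

Lemma csq_ge0 v : 0 <= csq v.
Proof. by apply: sumr_ge0 => i _; rewrite sqr_ge0. Qed.

Lemma csq0 : csq (0 : 'cV[C]_n) = 0.
Proof. by rewrite /csq big1 // => i _; rewrite mxE cabs0 expr0n. Qed.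

Lemma csq_eq0 v : csq v = 0 -> v = 0.
Proof.
move=> v0; apply/colP => i; rewrite mxE; apply/eqP.
rewrite -cabs_eq0 -sqrf_eq0; apply/eqP/le_anti; rewrite sqr_ge0 andbT -v0.
by rewrite /csq (bigD1 i) //= lerDl sumr_ge0 // => j _; rewrite sqr_ge0.
Qed.

Lemma csqZ c v : csq (c *: v) = cabs c ^+ 2 * csq v.
Proof.
by rewrite /csq mulr_sumr; apply: eq_bigr => i _; rewrite mxE cabsM exprMn.
Qed.

Lemma csqN v : csq (- v) = csq v.
Proof. by rewrite -scaleN1r csqZ cabsN cabs1 expr1n mul1r. Qed.

Lemma csq_entry v i : cabs (v i 0) ^+ 2 <= csq v.
Proof.
by rewrite /csq (bigD1 i) //= lerDl sumr_ge0 // => j _; rewrite sqr_ge0.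
Qed.

Lemma csq_delta (i : 'I_n) : csq (delta_mx i 0) = 1.
Proof.
rewrite /csq (bigD1 i) //= mxE !eqxx cabs1 expr1n big1 ?addr0 // => j ji.
by rewrite mxE (negbTE ji) cabs0 expr0n.
Qed.

Lemma csqD_le v w : csq (v + w) <= 2 * csq v + 2 * csq w.
Proof.
rewrite /csq !mulr_sumr -big_split /=; apply: ler_sum => i _; rewrite mxE.
have h := cabsD (v i 0) (w i 0).
apply: (@le_trans _ _ ((cabs (v i 0) + cabs (w i 0)) ^+ 2)).
  by rewrite ler_sqr ?nnegrE ?addr_ge0 ?cabs_ge0.
rewrite -subr_ge0.
have -> : 2 * cabs (v i 0) ^+ 2 + 2 * cabs (w i 0) ^+ 2 -
  (cabs (v i 0) + cabs (w i 0)) ^+ 2 = (cabs (v i 0) - cabs (w i 0)) ^+ 2 by ring.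
exact: sqr_ge0.
Qed.

Lemma cdot_adj a v w : cdot (a *m v) w = cdot v (adjmx a *m w).
Proof.
rewrite /cdot.
under eq_bigr do rewrite mxE mulr_suml.
under [RHS]eq_bigr do rewrite mxE rmorph_sum mulr_sumr.
rewrite exchange_big; apply: eq_bigr => i _; apply: eq_bigr => j _.
by rewrite mxE rmorphM /= conjCK; ring.
Qed.

Definition vlen v : R := Num.sqrt (csq v).

Lemma vlen_ge0 v : 0 <= vlen v. Proof. exact: sqrtr_ge0. Qed.
Lemma vlen_sqr v : vlen v ^+ 2 = csq v.
Proof. by rewrite sqr_sqrtr ?csq_ge0. Qed.

Lemma vlenD v w : vlen (v + w) <= vlen v + vlen w.
Proof. exact: (ip_triangle cdotP cdotJ cdotvv csq_ge0). Qed.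

Lemma vlenZ c v : vlen (c *: v) = cabs c * vlen v.
Proof. by rewrite /vlen csqZ sqrtrM ?sqr_ge0 // sqrtr_sqr ger0_norm ?cabs_ge0. Qed.

Lemma vlen_entry v i : cabs (v i 0) <= vlen v.
Proof.
by rewrite -ler_sqr ?nnegrE ?cabs_ge0 ?vlen_ge0 // vlen_sqr csq_entry.
Qed.

Lemma vlen_le v : vlen v <= \sum_i cabs (v i 0).
Proof.
have s0 : 0 <= \sum_i cabs (v i 0) by apply: sumr_ge0 => i _; exact: cabs_ge0.
rewrite -ler_sqr ?nnegrE ?vlen_ge0 // vlen_sqr expr2 mulr_suml /csq.
apply: ler_sum => i _; rewrite expr2 ler_wpM2l ?cabs_ge0 //.
rewrite (bigD1 i) //= lerDl; apply: sumr_ge0 => j _; exact: cabs_ge0.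
Qed.

Lemma mxbound_ge0 a : 0 <= mxbound a.
Proof. by do 2![apply: sumr_ge0 => ? _]; exact: cabs_ge0. Qed.

Lemma vlen_mxbound a v : vlen (a *m v) <= mxbound a * vlen v.
Proof.
apply: (le_trans (vlen_le _)); rewrite /mxbound mulr_suml; apply: ler_sum => i _.
rewrite mxE mulr_suml; apply: (le_trans (cabs_sum _ _ _)).
by apply: ler_sum => j _; rewrite cabsM ler_wpM2l ?cabs_ge0 ?vlen_entry.
Qed.

Lemma csq_mxbound a v : csq (a *m v) <= mxbound a ^+ 2 * csq v.
Proof.
rewrite -!vlen_sqr -exprMn ler_sqr ?nnegrE ?mulr_ge0 ?mxbound_ge0 ?vlen_ge0 //.
exact: vlen_mxbound.
Qed.

Definition opnorm a : R := sup [set vlen (a *m v) | v in [set v | vlen v <= 1]].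

Lemma opnorm_has_sup a :
  has_sup [set vlen (a *m v) | v in [set v | vlen v <= 1]].
Proof.
split.
  by exists (vlen (a *m 0)), 0 => //=; rewrite /vlen csq0 sqrtr0.
exists (mxbound a) => _ [v /= v1 <-]; apply: (le_trans (vlen_mxbound _ _)).
by rewrite ler_piMr // mxbound_ge0.
Qed.

Lemma opnorm_ge0 a : 0 <= opnorm a.
Proof.
apply: (le_trans (vlen_ge0 (a *m 0))); apply: (sup_upper_bound (opnorm_has_sup a)).
by exists 0 => //=; rewrite /vlen csq0 sqrtr0.
Qed.

Lemma opnormP a v : vlen (a *m v) <= opnorm a * vlen v.
Proof.
have [v0|v0] := eqVneq (vlen v) 0.
  have -> : v = 0 by apply: csq_eq0; rewrite -vlen_sqr v0 expr0n.
  by rewrite mulmx0 /vlen csq0 sqrtr0 mulr0.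
have vp : 0 < vlen v by rewrite lt_def v0 vlen_ge0.
have vi : 0 <= (vlen v)^-1 by rewrite invr_ge0 vlen_ge0.
rewrite -ler_pdivrMr // mulrC.
have -> : (vlen v)^-1 * vlen (a *m v) = vlen (a *m (toC (vlen v)^-1 *: v)).
  by rewrite -scalemxAr vlenZ cabs_toC ger0_norm.
apply: (sup_upper_bound (opnorm_has_sup a)); exists (toC (vlen v)^-1 *: v) => //=.
by rewrite vlenZ cabs_toC ger0_norm // mulVf.
Qed.

Lemma opnorm_le a (M : R) : 0 <= M ->
  (forall v, vlen (a *m v) <= M * vlen v) -> opnorm a <= M.
Proof.
move=> M0 h; apply: ge_sup; first by have [] := opnorm_has_sup a.
by move=> _ [v /= v1 <-]; rewrite (le_trans (h v)) // ler_piMr.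
Qed.

Lemma opnorm_entry a i j : cabs (a i j) <= opnorm a.
Proof.
have := opnormP a (delta_mx j 0); rewrite {2}/vlen csq_delta sqrtr1 mulr1.
apply: le_trans; have := vlen_entry (a *m delta_mx j 0) i.
by rewrite -colE mxE.
Qed.

Lemma opnorm_mxbound a : opnorm a <= mxbound a.
Proof. by apply: opnorm_le; [exact: mxbound_ge0|exact: vlen_mxbound]. Qed.

Lemma opnormD a b : opnorm (a + b) <= opnorm a + opnorm b.
Proof.
apply: opnorm_le => [|v]; first by rewrite addr_ge0 ?opnorm_ge0.
by rewrite mulmxDl mulrDl (le_trans (vlenD _ _)) // lerD // opnormP.
Qed.

Lemma opnormM a b : opnorm (a *m b) <= opnorm a * opnorm b.
Proof.
apply: opnorm_le => [|v]; first by rewrite mulr_ge0 ?opnorm_ge0.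
rewrite -mulmxA -mulrA (le_trans (opnormP _ _)) //.
by rewrite ler_wpM2l ?opnorm_ge0 ?opnormP.
Qed.

Lemma opnormZ_le c a : opnorm (c *: a) <= cabs c * opnorm a.
Proof.
apply: opnorm_le => [|v]; first by rewrite mulr_ge0 ?opnorm_ge0 ?cabs_ge0.
by rewrite -scalemxAl vlenZ -mulrA ler_wpM2l ?cabs_ge0 ?opnormP.
Qed.

Lemma opnorm0_eq0 a : opnorm a = 0 -> a = 0.
Proof.
move=> a0; apply/matrixP => i j; rewrite mxE; apply/eqP.
by rewrite -cabs_eq0 eq_le cabs_ge0 andbT -a0 opnorm_entry.
Qed.

Lemma opnormZ c a : opnorm (c *: a) = cabs c * opnorm a.
Proof.
have [->|c0] := eqVneq c 0.
  rewrite scale0r cabs0 mul0r; apply/le_anti; rewrite opnorm_ge0 andbT.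
  by apply: opnorm_le => // v; rewrite mul0mx mul0r /vlen csq0 sqrtr0.
apply/le_anti; rewrite opnormZ_le /=.
rewrite -ler_pdivlMl ?cabs_gt0 // -cabsV.
by rewrite -{1}[a]scale1r -(mulVf c0) -scalerA opnormZ_le.
Qed.

Lemma adjmxK : involutive (@adjmx n).
Proof. by move=> a; apply/matrixP => i j; rewrite !mxE conjCK. Qed.

Lemma adjmxP c a b : adjmx (c *: a + b) = c^* *: adjmx a + adjmx b.
Proof. by apply/matrixP => i j; rewrite !mxE rmorphD rmorphM. Qed.

Lemma adjmxM a b : adjmx (a *m b) = adjmx b *m adjmx a.
Proof.
apply/matrixP => i j; rewrite !mxE rmorph_sum; apply: eq_bigr => k _.
by rewrite !mxE rmorphM /= mulrC.
Qed.

(** By Cauchy-Schwarz, |a v|^2 = (v, a^* a v) <= |v| |a^* a v|. *)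
Lemma opnorm_star_le a : opnorm a ^+ 2 <= opnorm (adjmx a *m a).
Proof.
have s0 := opnorm_ge0 (adjmx a *m a).
have : opnorm a <= Num.sqrt (opnorm (adjmx a *m a)).
  apply: opnorm_le => [|v]; first exact: sqrtr_ge0.
  rewrite -ler_sqr ?nnegrE ?mulr_ge0 ?vlen_ge0 ?sqrtr_ge0 //.
  rewrite exprMn vlen_sqr sqr_sqrtr //.
  have E : toC (csq (a *m v)) = cdot v (adjmx a *m a *m v).
    by rewrite -cdotvv cdot_adj mulmxA.
  have -> : csq (a *m v) = cabs (cdot v (adjmx a *m a *m v)).
    by rewrite -E cabs_toC ger0_norm // csq_ge0.
  have := ip_CauchySchwarz cdotP cdotJ cdotvv csq_ge0 v (adjmx a *m a *m v).
  rewrite -!vlen_sqr -exprMn ler_sqr ?nnegrE ?mulr_ge0 ?cabs_ge0 ?vlen_ge0 //.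
  move=> /le_trans; apply; rewrite mulrC expr2 mulrA ler_wpM2r ?vlen_ge0 //.
  exact: opnormP.
by rewrite -ler_sqr ?nnegrE ?sqrtr_ge0 ?opnorm_ge0 // sqr_sqrtr.
Qed.

(** From |a|^2 <= |a^* a| <= |a^*| |a| one divides by |a| unless it is 0. *)
Lemma opnorm_adj_le a : opnorm a <= opnorm (adjmx a).
Proof.
have := le_trans (opnorm_star_le a) (opnormM _ _); rewrite expr2.
have [->|a0] := eqVneq (opnorm a) 0; first by rewrite opnorm_ge0.
by rewrite ler_pM2r // lt_def a0 opnorm_ge0.
Qed.

Lemma opnorm_star a : opnorm (adjmx a *m a) = opnorm a ^+ 2.
Proof.
have h1 : opnorm (adjmx a) <= opnorm a.
  by rewrite -{2}[a]adjmxK opnorm_adj_le.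
have h2 : opnorm (adjmx a *m a) <= opnorm a ^+ 2.
  apply: (le_trans (opnormM _ _)); rewrite expr2.
  exact: ler_wpM2r (opnorm_ge0 a) _ _ h1.
by apply/le_anti; rewrite h2 opnorm_star_le.
Qed.

End ColumnVectors.

(** * The C^*-algebra of square complex matrices *)

(** The alias inherits only the vector space structure of matrices, which leaves the norm free to be
    the operator norm. *)
Definition opmx (R : realType) (n : nat) : Type := 'M[cplx R]_n.

HB.instance Definition _ R n :=
  GRing.Lmodule.copy (opmx R n) 'M[cplx R]_n.

Section OperatorAlgebra.
Variables (R : realType) (n : nat).
Notation C := (cplx R).
Notation A := (opmx R n).

Definition opmx_norm (a : A) : C := toC (opnorm (a : 'M[C]_n)).

Lemma opmx_normD (a b : A) : opmx_norm (a + b) <= opmx_norm a + opmx_norm b.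
Proof. by rewrite /opmx_norm -toCD toC_le opnormD. Qed.

Lemma opmx_normZ (c : C) (a : A) : opmx_norm (c *: a) = `|c| * opmx_norm a.
Proof. by rewrite /opmx_norm opnormZ toCM normCE. Qed.

Lemma opmx_norm0_eq0 (a : A) : opmx_norm a = 0 -> a = 0.
Proof. by move=> /toC_inj /opnorm0_eq0. Qed.

HB.instance Definition _ := Lmodule_isNormed.Build C A
  opmx_normD opmx_normZ opmx_norm0_eq0.

Lemma opmx_normE (a : A) : `|a| = toC (opnorm (a : 'M[C]_n)).
Proof. by []. Qed.

Lemma opmx_complete (F : set_system A) :
  ProperFilter F -> cauchy F -> cvg F.
Proof.
move=> FF cF.
have coord i j : exists l : C, (fun a : A => (a : 'M[C]_n) i j) @ F --> l.
  have [x hx] : exists l : R, (fun a : A => reC ((a : 'M[C]_n) i j)) @ F --> l.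
    apply: (cauchy_coord FF) cF => a b; rewrite opmx_normE toC_le -reB.
    apply: (le_trans (re_le_cabs _)); have := opnorm_entry (a - b : 'M[C]_n) i j.
    by rewrite !mxE.
  have [y hy] : exists l : R, (fun a : A => imC ((a : 'M[C]_n) i j)) @ F --> l.
    apply: (cauchy_coord FF) cF => a b; rewrite opmx_normE toC_le -imB.
    apply: (le_trans (im_le_cabs _)); have := opnorm_entry (a - b : 'M[C]_n) i j.
    by rewrite !mxE.
  by exists (mkC x y); apply: cvg_reim.
have [l0 hl0] := choice (fun ij : 'I_n * 'I_n => coord ij.1 ij.2).
pose l : A := \matrix_(i, j) l0 (i, j).
have hl i j : (fun a : A => (a : 'M[C]_n) i j) @ F --> (l : 'M[C]_n) i j.
  by rewrite mxE; exact: hl0 (i, j).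
apply/cvg_ex; exists l; apply: cvg_normCP => e e0.
(* The operator norm is at most the sum of the n^2 moduli of the entries; the successor keeps the
   denominator nonzero when n is 0. *)
have e1 : 0 < e / (n * n).+1%:R by rewrite divr_gt0.
suff : \forall a \near F, forall i j,
    cabs ((a : 'M[C]_n) i j - (l : 'M[C]_n) i j) < e / (n * n).+1%:R.
  apply: filterS => a ha; rewrite opmx_normE toC_le.
  apply: (le_trans (opnorm_mxbound ((a : 'M[C]_n) - (l : 'M[C]_n)))).
  apply: (@le_trans _ _ (\sum_(i < n) \sum_(j < n) e / (n * n).+1%:R)).
    apply: ler_sum => i _; apply: ler_sum => j _.
    by have := ltW (ha i j); rewrite !mxE.
  rewrite !sumr_const !card_ord -mulrnA -[leLHS]mulr_natl mulrCA ler_piMr ?(ltW e0) //.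
  by rewrite ler_pdivrMr // mul1r ler_nat.
apply: filter_forall => i; apply: filter_forall => j.
by have /cvg_cplxP := hl i j; apply.
Qed.

HB.instance Definition _ := Uniform_isComplete.Build A opmx_complete.

Definition opmx_mul (a b : A) : A := (a : 'M[C]_n) *m (b : 'M[C]_n).
Definition opmx_star (a : A) : A := adjmx (a : 'M[C]_n).

Lemma opmx_mulA : associative opmx_mul.
Proof. by move=> a b c; rewrite /opmx_mul mulmxA. Qed.
Lemma opmx_mul1l : left_id (1%:M : A) opmx_mul.
Proof. by move=> a; rewrite /opmx_mul mul1mx. Qed.
Lemma opmx_mul1r : right_id (1%:M : A) opmx_mul.
Proof. by move=> a; rewrite /opmx_mul mulmx1. Qed.
Lemma opmx_mulPl (c : C) (x y z : A) :
  opmx_mul (c *: x + y) z = c *: opmx_mul x z + opmx_mul y z.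
Proof. by rewrite /opmx_mul mulmxDl -scalemxAl. Qed.
Lemma opmx_mulPr (c : C) (x y z : A) :
  opmx_mul z (c *: x + y) = c *: opmx_mul z x + opmx_mul z y.
Proof. by rewrite /opmx_mul mulmxDr -scalemxAr. Qed.
Lemma opmx_starK : involutive opmx_star.
Proof. exact: adjmxK. Qed.
Lemma opmx_starP (c : C) (x y : A) :
  opmx_star (c *: x + y) = c^* *: opmx_star x + opmx_star y.
Proof. exact: adjmxP. Qed.
Lemma opmx_starM (x y : A) :
  opmx_star (opmx_mul x y) = opmx_mul (opmx_star y) (opmx_star x).
Proof. exact: adjmxM. Qed.
Lemma opmx_normM (x y : A) : `|opmx_mul x y| <= `|x| * `|y|.
Proof. by rewrite !opmx_normE -toCM toC_le opnormM. Qed.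
Lemma opmx_norm_star (x : A) : `|opmx_mul (opmx_star x) x| = `|x| ^+ 2.
Proof. by rewrite !opmx_normE -toCX opnorm_star. Qed.

HB.instance Definition _ := isCstar.Build R A opmx_mulA opmx_mul1l opmx_mul1r
  opmx_mulPl opmx_mulPr opmx_starK opmx_starP opmx_starM opmx_normM
  opmx_norm_star.

End OperatorAlgebra.

(** * Square summable sequences of vectors: vector space, inner product, completeness *)

Section SquareSummable.
Variables (R : realType) (d : nat).
Notation C := (cplx R).
Notation V := 'cV[C]_d.
Implicit Types f g : nat -> V.

Definition psum f (n : nat) : R := \sum_(k < n) csq (f k).
Definition sqsummable f : Prop := exists M : R, forall n, psum f n <= M.

Lemma psumS f n : psum f n.+1 = psum f n + csq (f n).
Proof. by rewrite /psum big_ord_recr. Qed.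

Lemma psum_ge0 f n : 0 <= psum f n.
Proof. by apply: sumr_ge0 => k _; exact: csq_ge0. Qed.

Lemma psum_homo f : {homo psum f : m n / (m <= n)%N >-> m <= n}.
Proof.
by apply: homo_leq => [//|m n p|n]; [exact: le_trans|rewrite psumS lerDl csq_ge0].
Qed.

Lemma csq_psum f n : csq (f n) <= psum f n.+1.
Proof. by rewrite psumS lerDr psum_ge0. Qed.

Lemma sqsummableP (c : C) f g : sqsummable f -> sqsummable g ->
  sqsummable (fun k => c *: f k + g k).
Proof.
move=> [M hM] [M' hM']; exists (2 * (cabs c ^+ 2 * M) + 2 * M') => n.
apply: (@le_trans _ _ (2 * (cabs c ^+ 2 * psum f n) + 2 * psum g n)).
  rewrite /psum !mulr_sumr -big_split /=; apply: ler_sum => k _.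
  by rewrite -csqZ csqD_le.
by rewrite lerD // ler_wpM2l // ler_wpM2l ?sqr_ge0.
Qed.

Lemma sqsummable0 : sqsummable (fun=> 0).
Proof. by exists 0 => n; rewrite /psum big1 // => k _; rewrite csq0. Qed.

Lemma sqsummable_le f (M : R) (u : nat -> R) :
  (forall n, \sum_(k < n) u k <= M) -> (forall k, csq (f k) <= u k) ->
  sqsummable f.
Proof.
move=> hM hu; exists M => n; apply: le_trans (hM n).
by apply: ler_sum => k _.
Qed.

Lemma cvg_sum_seq (T I : Type) (F : set_system T) (FF : Filter F) (s : seq I)
    (f : I -> T -> R) (l : I -> R) :
  (forall i, f i @ F --> l i) ->
  (fun t => \sum_(i <- s) f i t) @ F --> \sum_(i <- s) l i.
Proof.
move=> hf; elim: s => [|i s IH].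
  rewrite big_nil (_ : (fun t => _) = fun=> 0); first exact: cvg_cst.
  by apply/funext => t; rewrite big_nil.
rewrite big_cons (_ : (fun t => _) = fun t => f i t + \sum_(i <- s) f i t).
  by apply: cvgD => //; exact: hf.
by apply/funext => t; rewrite big_cons.
Qed.

Lemma csq_cvg (T : Type) (F : set_system T) (FF : Filter F) (f : T -> V) (g : V) :
  (forall i, (fun t => f t i 0) @ F --> g i 0) ->
  (fun t => csq (f t)) @ F --> csq g.
Proof.
move=> hf; apply: cvg_sum_seq => i.
rewrite cabs_sqr (_ : (fun t => cabs (f t i 0) ^+ 2) =
  (fun t => reC (f t i 0) ^+ 2 + imC (f t i 0) ^+ 2)); last first.
  by apply/funext => t; rewrite cabs_sqr.
have h := hf i; have hr := cvg_re FF h; have hi := cvg_im FF h.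
by apply: cvgD; apply: cvgM.
Qed.

Lemma psum_cvg (T : Type) (F : set_system T) (FF : Filter F)
    (f : T -> nat -> V) g n :
  (forall k i, (fun t => f t k i 0) @ F --> g k i 0) ->
  (fun t => psum (f t) n) @ F --> psum g n.
Proof.
move=> hf; apply: cvg_sum_seq => k.
exact: (@csq_cvg _ _ FF (fun t => f t k) (g k) (hf k)).
Qed.

Record l2 := L2 { l2f :> nat -> V ; l2P : sqsummable l2f }.

Lemma l2_eq (f g : l2) : (forall k, f k = g k) -> f = g.
Proof.
case: f g => [f hf] [g hg] /= /funext fg; subst g.
by congr L2; exact: Prop_irrelevance.
Qed.

HB.instance Definition _ := gen_eqMixin l2.
HB.instance Definition _ := gen_choiceMixin l2.

Definition l2_zero : l2 := L2 sqsummable0.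

(** Addition, opposite and scaling are all instances of one operation, so that square summability is
    checked only once. *)
Lemma l2_lin_subproof (c : C) (f g : l2) :
  sqsummable (fun k => c *: f k + g k).
Proof. exact: sqsummableP (l2P f) (l2P g). Qed.
Definition l2_lin (c : C) (f g : l2) : l2 := L2 (l2_lin_subproof c f g).
Definition l2_add (f g : l2) := l2_lin 1 f g.
Definition l2_opp (f : l2) := l2_lin (-1) f l2_zero.
Definition l2_scale (c : C) (f : l2) := l2_lin c f l2_zero.

Lemma l2_addA : associative l2_add.
Proof. by move=> f g h; apply: l2_eq => k; rewrite /= !scale1r addrA. Qed.
Lemma l2_addC : commutative l2_add.
Proof. by move=> f g; apply: l2_eq => k; rewrite /= !scale1r addrC. Qed.
Lemma l2_add0 : left_id l2_zero l2_add.
Proof. by move=> f; apply: l2_eq => k; rewrite /= scale1r add0r. Qed.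
Lemma l2_addN : left_inverse l2_zero l2_opp l2_add.
Proof.
by move=> f; apply: l2_eq => k; rewrite /= scale1r addr0 scaleN1r addNr.
Qed.
HB.instance Definition _ :=
  GRing.isZmodule.Build l2 l2_addA l2_addC l2_add0 l2_addN.

Lemma l2D (f g : l2) k : (f + g) k = f k + g k.
Proof. by rewrite /GRing.add /= scale1r. Qed.
Lemma l2N (f : l2) k : (- f) k = - f k.
Proof. by rewrite /GRing.opp /= addr0 scaleN1r. Qed.
Lemma l2B (f g : l2) k : (f - g) k = f k - g k.
Proof. by rewrite l2D l2N. Qed.
Lemma l20 k : (0 : l2) k = 0. Proof. by []. Qed.

Lemma l2_scaleE c (f : l2) k : l2_scale c f k = c *: f k.
Proof. by rewrite /= addr0. Qed.
Lemma l2_scaleA c c' (f : l2) :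
  l2_scale c (l2_scale c' f) = l2_scale (c * c') f.
Proof. by apply: l2_eq => k; rewrite !l2_scaleE scalerA. Qed.
Lemma l2_scale1 : left_id 1 l2_scale.
Proof. by move=> f; apply: l2_eq => k; rewrite l2_scaleE scale1r. Qed.
Lemma l2_scaleDr : right_distributive l2_scale +%R.
Proof.
by move=> c f g; apply: l2_eq => k; rewrite !(l2_scaleE, l2D) scalerDr.
Qed.
Lemma l2_scaleDl (f : l2) : {morph l2_scale^~ f : c c' / c + c'}.
Proof.
by move=> c c'; apply: l2_eq => k; rewrite !(l2_scaleE, l2D) scalerDl.
Qed.
HB.instance Definition _ := GRing.Zmodule_isLmodule.Build C l2
  l2_scaleA l2_scale1 l2_scaleDr l2_scaleDl.

Lemma l2Z c (f : l2) k : (c *: f) k = c *: f k.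
Proof. by rewrite /GRing.scale /= addr0. Qed.

Definition l2sq (f : l2) : R := sup (range (psum f)).

Lemma psum_has_ub (f : l2) : has_ubound (range (psum f)).
Proof. by have [M hM] := l2P f; exists M => _ [n _ <-]. Qed.

Lemma psum_l2sq (f : l2) : psum f @ \oo --> l2sq f.
Proof.
apply: nondecreasing_cvgn; last exact: psum_has_ub.
exact: psum_homo.
Qed.

Lemma psum_le_l2sq (f : l2) n : psum f n <= l2sq f.
Proof. by apply: ub_le_sup; [exact: psum_has_ub|exists n]. Qed.

Lemma l2sq_le (f : l2) (M : R) : (forall n, psum f n <= M) -> l2sq f <= M.
Proof.
move=> h; apply: ge_sup; first by exists (psum f 0), 0%N.
by move=> _ [n _ <-].
Qed.

Lemma l2sq_ge0 (f : l2) : 0 <= l2sq f.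
Proof. exact: le_trans (psum_ge0 f 0) (psum_le_l2sq f 0). Qed.

Definition psdot f g n : C := \sum_(k < n) cdot (f k) (g k).

(** By polarisation the real part is a difference of convergent sums of squares; the imaginary part
    of (f, g) is the real part of (-i f, g). *)
Lemma psdot_cvg (f g : l2) : exists l : C, psdot f g @ \oo --> l.
Proof.
have polar (f0 : l2) n : reC (psdot f0 g n) =
    4^-1 * (psum (f0 + g) n - psum (f0 - g) n).
  rewrite /psdot /psum re_sum -sumrB mulr_sumr; apply: eq_bigr => k _.
  rewrite l2D l2B.
  have ipq := ip_quadratic (@cdotP R d) (@cdotJ R d) (@cdotvv R d).
  have -> : csq (f0 k + g k) = csq (f0 k) + 2 * reC (cdot (f0 k) (g k)) + csq (g k).
    by rewrite -[f0 k]scale1r ipq cabs1 expr1n !mul1r !scale1r.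
  have -> : csq (f0 k - g k) = csq (f0 k) - 2 * reC (cdot (f0 k) (g k)) + csq (g k).
    rewrite -csqN opprB addrC -scaleN1r ipq cabsN cabs1 expr1n !mul1r mulN1r.
    by rewrite reN mulrN.
  by field.
have recvg (f0 : l2) : exists l : R, (@reC R \o psdot f0 g) @ \oo --> l.
  exists (4^-1 * (l2sq (f0 + g) - l2sq (f0 - g))).
  rewrite (_ : _ \o _ = fun n => 4^-1 * (psum (f0 + g) n - psum (f0 - g) n)).
    apply: cvgM; first exact: cvg_cst.
    by apply: cvgB; exact: psum_l2sq.
  by apply/funext => n; exact: polar.
have [h hE] : exists h : l2, forall k, h k = - mkC 0 1 *: f k.
  by exists (- mkC 0 1 *: f) => k; rewrite l2Z.
have [x hx] := recvg f; have [y hy] := recvg h.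
exists (mkC x y); apply: cvg_reim => //.
suff -> : @imC R \o psdot f g = @reC R \o psdot h g by [].
apply/funext => n; rewrite /= /psdot im_sum re_sum; apply: eq_bigr => k _.
rewrite hE -[_ *: f k]addr0 cdotP.
have -> : cdot 0 (g k) = 0 by rewrite /cdot big1 // => i _; rewrite mxE mul0r.
by rewrite addr0 !reimE; ring.
Qed.

Definition l2inner (f g : l2) : C := lim (psdot f g @ \oo).

Lemma l2inner_cvg (f g : l2) : psdot f g @ \oo --> l2inner f g.
Proof. by have [l hl] := psdot_cvg f g; apply: cvgP hl. Qed.

Lemma l2inner_lim (f g : l2) (l : C) : psdot f g @ \oo --> l -> l2inner f g = l.
Proof. by move=> h; apply: (cvg_lim _ h); exact: norm_hausdorff. Qed.

Lemma l2innerP (c : C) (x y z : l2) :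
  l2inner (c *: x + y) z = c * l2inner x z + l2inner y z.
Proof.
apply: l2inner_lim.
rewrite (_ : psdot _ _ = fun n => c * psdot x z n + psdot y z n).
  apply: cvgD; last exact: l2inner_cvg.
  by apply: cvgM; [exact: cvg_cst|exact: l2inner_cvg].
apply/funext => n; rewrite /psdot mulr_sumr -big_split; apply: eq_bigr => k _.
by rewrite l2D l2Z cdotP.
Qed.

Lemma l2inner_conj (x y : l2) : l2inner y x = (l2inner x y)^*.
Proof.
apply: l2inner_lim.
rewrite (_ : psdot y x = fun n => (psdot x y n)^*); last first.
  apply/funext => n; rewrite /psdot rmorph_sum; apply: eq_bigr => k _.
  exact: cdotJ.
apply/cvg_cplxP => e e0; have /cvg_cplxP := @l2inner_cvg x y.
by move=> /(_ _ e0); apply: filterS => n; rewrite -cabsJ rmorphB.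
Qed.

Lemma l2inner_sq (x : l2) : l2inner x x = toC (l2sq x).
Proof.
apply: l2inner_lim.
rewrite (_ : psdot x x = @toC R \o psum x).
  by apply: cvg_toC; exact: psum_l2sq.
apply/funext => n; rewrite /= toC_sum; apply: eq_bigr => k _.
exact: cdotvv.
Qed.

Definition l2_norm (f : l2) : C := toC (Num.sqrt (l2sq f)).

Lemma l2_normD (f g : l2) : l2_norm (f + g) <= l2_norm f + l2_norm g.
Proof.
rewrite /l2_norm -toCD toC_le.
exact: (ip_triangle l2innerP l2inner_conj l2inner_sq l2sq_ge0).
Qed.

Lemma l2sqZ (c : C) (f : l2) : l2sq (c *: f) = cabs c ^+ 2 * l2sq f.
Proof.
have i0 (x : l2) : l2inner 0 x = 0.
  apply: l2inner_lim; rewrite (_ : psdot (l2f (0 : l2)) x = cst 0); first exact: cvg_cst.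
  apply/funext => n; rewrite /psdot big1 // => k _.
  by rewrite /cdot big1 // => i _; rewrite l20 mxE mul0r.
have E1 y : l2inner (c *: f) y = c * l2inner f y.
  by rewrite -[c *: f]addr0 l2innerP i0 addr0.
apply: toC_inj; rewrite -l2inner_sq E1 (l2inner_conj (c *: f) f) E1.
by rewrite l2inner_sq rmorphM /= toCJ mulrA mulCJ -toCM.
Qed.

Lemma l2_normZ (c : C) (f : l2) : l2_norm (c *: f) = `|c| * l2_norm f.
Proof.
rewrite /l2_norm l2sqZ sqrtrM ?sqr_ge0 // sqrtr_sqr ger0_norm ?cabs_ge0 //.
by rewrite toCM normCE.
Qed.

Lemma l2sq_eq0 (f : l2) : l2sq f = 0 -> f = 0.
Proof.
move=> f0; apply: l2_eq => k; apply: csq_eq0; apply/le_anti.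
by rewrite csq_ge0 andbT -f0 (le_trans (csq_psum f k)) ?psum_le_l2sq.
Qed.

Lemma l2_norm0_eq0 (f : l2) : l2_norm f = 0 -> f = 0.
Proof.
move=> /toC_inj /eqP; rewrite sqrtr_eq0 => f0; apply: l2sq_eq0.
by apply/le_anti; rewrite f0 l2sq_ge0.
Qed.

HB.instance Definition _ := Lmodule_isNormed.Build C l2
  l2_normD l2_normZ l2_norm0_eq0.

Lemma l2_normE (f : l2) : `|f| = toC (Num.sqrt (l2sq f)).
Proof. by []. Qed.

Lemma l2_norm_sqr (f : l2) : `|f| ^+ 2 = toC (l2sq f).
Proof. by rewrite l2_normE -toCX sqr_sqrtr ?l2sq_ge0. Qed.

Lemma l2_norm_le (f : l2) (e : R) : 0 <= e ->
  (`|f| <= toC e) = (l2sq f <= e ^+ 2).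
Proof.
move=> e0; rewrite l2_normE toC_le -[LHS]ler_sqr ?nnegrE ?sqrtr_ge0 //.
by rewrite sqr_sqrtr ?l2sq_ge0.
Qed.

Lemma l2_entry_le (f : l2) k i : toC (cabs (f k i 0)) <= `|f|.
Proof.
rewrite l2_normE toC_le -ler_sqr ?nnegrE ?cabs_ge0 ?sqrtr_ge0 //.
rewrite (sqr_sqrtr (l2sq_ge0 f)) (le_trans (csq_entry _ _)) //.
by rewrite (le_trans (csq_psum f k)) ?psum_le_l2sq.
Qed.

Lemma l2_complete (F : set_system l2) : ProperFilter F -> cauchy F -> cvg F.
Proof.
move=> FF cF.
have coord k i : exists l : C, (fun f : l2 => f k i 0) @ F --> l.
  have [x hx] : exists l : R, (fun f : l2 => reC (f k i 0)) @ F --> l.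
    apply: (cauchy_coord FF) cF => f g; apply: le_trans (l2_entry_le _ k i).
    by rewrite toC_le l2B !mxE -reB re_le_cabs.
  have [y hy] : exists l : R, (fun f : l2 => imC (f k i 0)) @ F --> l.
    apply: (cauchy_coord FF) cF => f g; apply: le_trans (l2_entry_le _ k i).
    by rewrite toC_le l2B !mxE -imB im_le_cabs.
  by exists (mkC x y); apply: cvg_reim.
have [l0 hl0] := choice (fun ki : nat * 'I_d => coord ki.1 ki.2).
have [g hg] : exists g : nat -> V, forall k i,
    (fun f : l2 => f k i 0) @ F --> g k i 0.
  exists (fun k => \col_i l0 (k, i)) => k i.
  by rewrite mxE; exact: hl0 (k, i).
(* In a small Cauchy set every partial sum of squares of f - f' is at most e^2. Letting f' tend to g
   coordinatewise keeps the bound for each n, hence for the whole sum. *)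
have near_g (e : R) : 0 < e ->
    F [set f : l2 | forall n, psum (fun k => f k - g k) n <= e ^+ 2].
  move=> e0; have [A FA hA] := cauchy_epsP FF cF e0.
  apply: filterS (FA) => f Af n.
  have lim_f : (fun f' : l2 => psum (l2f (f - f')) n) @ F -->
      psum (fun k => f k - g k) n.
    apply: psum_cvg => k i.
    rewrite (_ : (fun f' : l2 => _) = fun f' : l2 => f k i 0 - f' k i 0).
      rewrite !mxE; have h1 := @ccvg_cst _ _ _ FF (f k i 0).
      exact: (ccvgB FF h1 (hg k i)).
    by apply/funext => f'; rewrite l2B !mxE.
  apply: (cvgr_to_le lim_f).
  apply: filterS FA => f' Af'.
  apply: (le_trans (psum_le_l2sq _ _)); rewrite -l2_norm_le ?(ltW e0) //.
  exact: hA.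
have g2 : sqsummable g.
  have [f hf] := filter_ex (near_g _ ltr01).
  have h : sqsummable (fun k => f k - g k) by exists (1 ^+ 2).
  have := sqsummableP (-1) h (l2P f).
  suff -> : (fun k => -1 *: (f k - g k) + f k) = g by [].
  by apply/funext => k; rewrite scaleN1r opprB subrK.
apply/cvg_ex; exists (L2 g2); apply: cvg_normCP => e e0.
apply: filterS (near_g _ e0) => f hf; rewrite l2_norm_le ?(ltW e0) //.
apply: l2sq_le => n; have := hf n; congr (_ <= _).
by apply: eq_bigr => k _; rewrite l2B.
Qed.

HB.instance Definition _ := Uniform_isComplete.Build l2 l2_complete.

End SquareSummable.

(** * l2 as a separable Hilbert space, and a compactness criterion *)

Section SquareSummableHilbert.
Variables (R : realType) (d : nat).
Notation C := (cplx R).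
Notation V := 'cV[C]_d.
Notation H := (l2 R d).

Lemma normC_near (U : normedModType C) (p : U) (P : set U) : nbhs p P ->
  exists2 e : R, 0 < e & forall z, `|z - p| < toC e -> P z.
Proof.
move=> /nbhs_ballP[e /= e0 he]; have [ee e0'] := posC e0.
exists (reC e) => // z hz; apply: he.
by rewrite -ball_normE /= distrC ee.
Qed.

Lemma l2_norm_lt (f : H) (e : R) : 0 <= e -> l2sq f < e ^+ 2 -> `|f| < toC e.
Proof.
move=> e0 h; rewrite l2_normE toC_lt -ltr_sqr ?nnegrE ?sqrtr_ge0 //.
by rewrite (sqr_sqrtr (l2sq_ge0 f)).
Qed.

Lemma l2sqD_le (f g : H) : l2sq (f + g) <= 2 * l2sq f + 2 * l2sq g.
Proof.
apply: l2sq_le => n; apply: (@le_trans _ _ (2 * psum f n + 2 * psum g n)).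
  rewrite /psum !mulr_sumr -big_split; apply: ler_sum => k _.
  by rewrite l2D csqD_le.
by rewrite lerD // ler_wpM2l ?psum_le_l2sq.
Qed.

Lemma trunc_subproof (N : nat) (f : nat -> V) :
  sqsummable (fun k => if (k < N)%N then f k else 0).
Proof.
exists (psum f N) => n; apply: (@le_trans _ _ (psum f (minn n N))).
  elim: n => [|n IH]; first by rewrite min0n /psum !big_ord0.
  rewrite psumS; case: ltnP => nN.
    rewrite (minn_idPl nN) psumS lerD2r.
    by move: IH; rewrite (minn_idPl (ltnW nN)).
  by rewrite csq0 addr0 (le_trans IH) //; apply: psum_homo; lia.
by rewrite psum_homo // geq_minr.
Qed.
Definition l2_trunc N (f : nat -> V) : H := L2 (trunc_subproof N f).

Lemma l2_tail (f : H) N : l2sq (f - l2_trunc N f) <= l2sq f - psum f N.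
Proof.
have split n : psum (f - l2_trunc N f : H) (N + n) = psum f (N + n) - psum f N.
  elim: n => [|n IH].
    rewrite addn0 subrr /psum big1 // => k _.
    by rewrite l2B /= ltn_ord subrr csq0.
  rewrite addnS !psumS IH l2B /= ltnNge leq_addr /= subr0; ring.
apply: l2sq_le => n.
apply: (@le_trans _ _ (psum (f - l2_trunc N f : H) (N + n))).
  by rewrite psum_homo // leq_addl.
by rewrite split lerD2r psum_le_l2sq.
Qed.

Lemma l2_tail_small (f : H) (e : R) : 0 < e ->
  exists N, l2sq (f - l2_trunc N f) < e.
Proof.
move=> e0; have /cvgrPdist_lt /(_ _ e0) [N _ hN] := @psum_l2sq _ _ f.
exists N; apply: (le_lt_trans (l2_tail f N)).
exact: le_lt_trans (ler_norm _) (hN N (leqnn N)).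
Qed.

Definition ratC (q : rat * rat) : C := mkC (ratr q.1) (ratr q.2).

Lemma ratC_dense (z : C) (e : R) : 0 < e -> exists q, cabs (z - ratC q) <= e.
Proof.
move=> e0; have e2 : 0 < e / 2 by rewrite divr_gt0.
have ap (x : R) : exists q : rat, `|x - ratr q| <= e / 2.
  have [|q] := @rat_in_itvoo R (x - e / 2) (x + e / 2); first lra.
  rewrite in_itv /= => /andP[h1 h2]; exists q; rewrite ler_norml; lra.
have [q1 h1] := ap (reC z); have [q2 h2] := ap (imC z).
exists (q1, q2); apply: (le_trans (cabs_le_reim _)).
by rewrite reB imB /=; lra.
Qed.

Definition rat_seq (s : seq (seq (rat * rat))) (k : nat) : V :=
  \col_i ratC (nth (0, 0) (nth [::] s k) i).

Lemma rat_seq_subproof s : sqsummable (rat_seq s).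
Proof.
have -> : rat_seq s = fun k => if (k < size s)%N then rat_seq s k else 0.
  apply/funext => k; case: ltnP => // sk; apply/colP => i.
  by rewrite !mxE (nth_default _ sk) nth_nil /ratC /= rmorph0.
exact: trunc_subproof.
Qed.
Definition l2_rat s : H := L2 (rat_seq_subproof s).

Lemma l2_separable : exists S : set H, countable S /\ dense S.
Proof.
exists (range l2_rat); split.
  exact: sub_countable (card_image_le _ _) (countableP _).
move=> O [f Of] oO; have /normC_near[e e0 he] : nbhs f O by exact: open_nbhs_nbhs.
(* [l2sqD_le] doubles each of the two errors, the truncation and the rational approximation; e^2 / 4
   is the share of each. *)
have e1 : 0 < e ^+ 2 / 4 by rewrite divr_gt0 ?exprn_gt0.
have [N hN] := l2_tail_small f e1.
(* At most N * d entries are approximated to within eta. As eta <= 1, each square is at most eta,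
   and the squares sum to at most e^2 / 4. *)
pose eta : R := Num.min 1 (e ^+ 2 / 4 / (N * d).+1%:R).
have eta0 : 0 < eta by rewrite lt_min ltr01 divr_gt0.
have [q hq] := choice (fun ki : nat * 'I_d => ratC_dense (f ki.1 ki.2 0) eta0).
pose s := [seq [seq q (k, i) | i <- enum 'I_d] | k <- iota 0 N].
exists (l2_rat s); split; last by exists s.
have sk k i : (k < N)%N -> rat_seq s k i 0 = ratC (q (k, i)).
  move=> kN; rewrite mxE (nth_map 0%N) ?size_iota // nth_iota // add0n.
  by rewrite (nth_map i) ?size_enum_ord ?ltn_ord // nth_ord_enum.
have sk0 k : (N <= k)%N -> rat_seq s k = 0.
  move=> Nk; have sN : (size s <= k)%N by rewrite size_map size_iota.
  apply/colP => i; rewrite !mxE (nth_default _ sN).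
  by rewrite nth_nil /ratC /= rmorph0.
apply: he; apply: (l2_norm_lt (ltW e0)).
rewrite -(subrK (l2_trunc N f) (l2_rat s)) -addrA.
apply: (le_lt_trans (l2sqD_le _ _)).
have h1 : l2sq (l2_trunc N f - f) < e ^+ 2 / 4.
  by rewrite -opprB -scaleN1r l2sqZ cabsN cabs1 expr1n mul1r.
have [h [-> hE]] : exists h : H, l2_rat s - l2_trunc N f = h /\
    forall k, h k = rat_seq s k - (if (k < N)%N then f k else 0).
  by exists (l2_rat s - l2_trunc N f); split=> // k; rewrite l2B.
have h2 : l2sq h <= e ^+ 2 / 4.
  apply: l2sq_le => n; apply: (@le_trans _ _ ((N * d)%:R * eta)).
    apply: (@le_trans _ _ (psum h (n + N))).
      by rewrite psum_homo // leq_addr.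
    rewrite addnC /psum big_split_ord /= [X in _ + X]big1 ?addr0 => [|k _].
      apply: (@le_trans _ _ (\sum_(k < N) \sum_(i < d) eta)).
        apply: ler_sum => k _; apply: ler_sum => i _.
        rewrite hE ltn_ord mxE sk // mxE -cabsN opprB.
        apply: (@le_trans _ _ (eta ^+ 2)).
          by rewrite ler_sqr ?nnegrE ?cabs_ge0 ?(ltW eta0) //; exact: hq (_, _).
        by rewrite expr2 ler_piMl ?(ltW eta0) // ge_min lexx.
      by rewrite !sumr_const !card_ord -mulrnA -[leLHS]mulr_natl mulnC.
    by rewrite hE sk0 ?leq_addr // ltnNge leq_addr /= subrr csq0.
  apply: (@le_trans _ _ ((N * d)%:R * (e ^+ 2 / 4 / (N * d).+1%:R))).
    by rewrite ler_wpM2l ?ler0n // ge_min lexx orbT.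
  rewrite mulrCA ler_piMr ?(ltW e1) // ler_pdivrMr // mul1r.
  by rewrite ler_nat.
lra.
Qed.

HB.instance Definition _ := isHilbert.Build R H (@l2innerP R d)
  (@l2inner_conj R d) (fun x => etrans (l2inner_sq x) (esym (l2_norm_sqr x)))
  l2_separable.

Lemma l2_innerE (f g : H) : inner f g = l2inner f g. Proof. by []. Qed.

Lemma single_subproof (n : nat) (v : V) :
  sqsummable (fun k => if k == n then v else 0).
Proof.
have -> : (fun k => if k == n then v else 0) =
    fun k => if (k < n.+1)%N then (if k == n then v else 0) else 0.
  by apply/funext => k; case: eqP => [->|_]; rewrite ?ltnSn // if_same.
exact: trunc_subproof.
Qed.
Definition l2_single n v : H := L2 (single_subproof n v).

Lemma l2_singleE n v k : l2_single n v k = if k == n then v else 0.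
Proof. by []. Qed.

Lemma inner_single (f : H) n v : inner f (l2_single n v) = cdot (f n) v.
Proof.
apply: l2inner_lim; apply: (@cvg_near_cst _ _ _ _ _).
exists n.+1 => // m /= nm; apply/eqP; rewrite /psdot.
rewrite (bigD1 (Ordinal nm)) //= eqxx big1 ?addr0 // => k kn.
have -> : (k == n :> nat) = false by apply/negbTE.
by rewrite /cdot big1 // => i _; rewrite mxE rmorph0 mulr0.
Qed.

Lemma l2sq_single n v : l2sq (l2_single n v) = csq v.
Proof.
apply: toC_inj; rewrite -l2inner_sq -l2_innerE inner_single l2_singleE eqxx.
exact: cdotvv.
Qed.

Lemma cdot_delta (v : V) i : cdot v (delta_mx i 0) = v i 0.
Proof.
rewrite /cdot (bigD1 i) //= mxE !eqxx rmorph1 mulr1 big1 ?addr0 // => j ji.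
by rewrite mxE (negbTE ji) rmorph0 mulr0.
Qed.

Definition wsum (w : nat -> R) (f : nat -> V) n : R :=
  \sum_(k < n) w k * csq (f k).

(** Along an ultrafilter the bounded coordinates converge, and the limit satisfies the same weighted
    bound. Since the weights tend to infinity, the tails are uniformly small on the set, so
    coordinatewise convergence becomes convergence in norm. *)
Lemma wsum_compact (w : nat -> R) (M : R) :
  (forall k, 1 <= w k) ->
  (forall B : R, exists N, forall k, (N <= k)%N -> B <= w k) ->
  compact [set f : H | forall n, wsum w f n <= M].
Proof.
move=> w1 winf; rewrite compact_ultra => F FU FA.
have PF : ProperFilter F := @ultra_proper _ _ FU.
have wpos k : 0 <= w k by apply: le_trans (w1 k).
have wsum_ge (f : H) n : psum f n <= wsum w f n.
  by apply: ler_sum => k _; rewrite ler_peMl ?csq_ge0.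
have ultra_cvg (phi : H -> R) (B : R) :
    F [set f | `|phi f| <= B] -> exists l : R, phi @ F --> l.
  move=> hB; have [p [_ hp]] : `[- B, B] `&` cluster (phi @ F) !=set0.
    apply: segment_compact; suff : F (phi @^-1` `[- B, B]) by [].
    by apply: filterS hB => f /= hf; rewrite in_itv /= -ler_norml.
  exists p => U nU; have [//|FnU] := in_ultra_setVsetC (phi @^-1` U) FU.
  by have [x [nx ux]] := hp (~` U) U FnU nU.
have entry (f : H) k i : (forall n, wsum w f n <= M) ->
    cabs (f k i 0) <= Num.sqrt M.
  move=> hf; have h : cabs (f k i 0) ^+ 2 <= M.
    rewrite (le_trans (csq_entry _ _)) // (le_trans (csq_psum f k)) //.
    exact: le_trans (wsum_ge _ _) (hf _).
  have M0 : 0 <= M by apply: le_trans h; exact: sqr_ge0.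
  by rewrite -ler_sqr ?nnegrE ?cabs_ge0 ?sqrtr_ge0 // (sqr_sqrtr M0).
have coord k i : exists l : C, (fun f : H => f k i 0) @ F --> l.
  have [x hx] : exists l : R, (fun f : H => reC (f k i 0)) @ F --> l.
    apply: (ultra_cvg _ (Num.sqrt M)); apply: filterS FA => f hf /=.
    exact: le_trans (re_le_cabs _) (entry f k i hf).
  have [y hy] : exists l : R, (fun f : H => imC (f k i 0)) @ F --> l.
    apply: (ultra_cvg _ (Num.sqrt M)); apply: filterS FA => f hf /=.
    exact: le_trans (im_le_cabs _) (entry f k i hf).
  by exists (mkC x y); apply: cvg_reim.
have [g hg] : exists g : nat -> V, forall k i,
    (fun f : H => f k i 0) @ F --> g k i 0.
  have [l0 hl0] := choice (fun ki : nat * 'I_d => coord ki.1 ki.2).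
  exists (fun k => \col_i l0 (k, i)) => k i.
  by rewrite mxE; exact: hl0 (k, i).
have gM n : wsum w g n <= M.
  have lim_n : (fun f : H => wsum w f n) @ F --> wsum w g n.
    apply: cvg_sum_seq => k; apply: cvgM; first exact: cvg_cst.
    exact: (@csq_cvg _ _ _ _ _ (fun f : H => f k) (g k) (hg k)).
  by apply: (cvgr_to_le lim_n); apply: filterS FA => f; apply.
have g2 : sqsummable g.
  apply: (@sqsummable_le _ _ _ M (fun k => w k * csq (g k))) => // k.
  by rewrite ler_peMl ?csq_ge0.
exists (L2 g2); split => //; apply: cvg_normCP => e e0.
have M0 : 0 <= M by apply: le_trans (gM 0%N); rewrite /wsum big_ord0.
have e1 : 0 < e ^+ 2 / 2 by rewrite divr_gt0 ?exprn_gt0.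
(* Beyond N the weight exceeds this threshold, so each of f and g has tail at most e^2 / 8;
   [csqD_le] then bounds the tail of f - g by e^2 / 2. *)
have [N hN] := winf (4 * M / (e ^+ 2 / 2)).
have lim_N : (fun f : H => psum (l2f (f - L2 g2)) N) @ F --> (0 : R).
  have -> : 0 = psum (fun=> 0 : V) N.
    by rewrite /psum big1 // => k _; rewrite csq0.
  apply: psum_cvg => k i.
  rewrite (_ : (fun f : H => _) = fun f : H => f k i 0 - g k i 0).
    rewrite mxE -(subrr (g k i 0)).
    exact: (ccvgB PF (hg k i) (@ccvg_cst _ _ _ PF (g k i 0))).
  by apply/funext => f; rewrite l2B !mxE.
move/cvgrPdist_le: lim_N => /(_ _ e1) nearN.
apply: filterS (filterI FA nearN) => f [hf fN0].
have fN : psum (l2f (f - L2 g2)) N <= e ^+ 2 / 2.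
  by apply: le_trans fN0; rewrite sub0r normrN ler_norm.
rewrite l2_norm_le ?(ltW e0) //.
have [h [h0 hE]] : exists h : H, f - L2 g2 = h /\
    forall k, h k = f k - g k.
  by exists (f - L2 g2); split=> // k; rewrite l2B.
rewrite h0 in fN *; apply: l2sq_le => n.
apply: (@le_trans _ _ (psum h (N + n))).
  by rewrite psum_homo // leq_addl.
rewrite /psum big_split_ord /= [leRHS]splitr lerD //.
(* When M is 0 the threshold is 0 and cannot be cancelled, but then every element of the set is
   0. *)
have [M0'|M_gt0] := leP M 0.
  have z (u : nat -> V) k : (forall m, wsum w u m <= M) -> csq (u k) = 0.
    move=> hh; apply/le_anti; rewrite csq_ge0 andbT.
    have := hh k.+1; rewrite /wsum big_ord_recr /= => /le_trans/(_ M0') hk.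
    apply: le_trans hk; rewrite -[leLHS]add0r lerD ?ler_peMl ?csq_ge0 //.
    by apply: sumr_ge0 => j _; rewrite mulr_ge0 ?csq_ge0.
  rewrite big1 ?(ltW e1) // => k _; apply/le_anti; rewrite csq_ge0 andbT hE.
  apply: (le_trans (csqD_le _ _)); rewrite csqN (z f _ hf) (z g _ gM).
  by rewrite !mulr0 addr0.
have W0 : 0 < 4 * M / (e ^+ 2 / 2) by rewrite divr_gt0 // mulr_gt0.
have tail (u : nat -> V) : (forall m, wsum w u m <= M) ->
    \sum_(k < n) csq (u (N + k)%N) <= e ^+ 2 / 2 / 4.
  move=> hh; rewrite -(ler_pM2l W0).
  have -> : 4 * M / (e ^+ 2 / 2) * (e ^+ 2 / 2 / 4) = M.
    by field; rewrite ?gt_eqF ?exprn_gt0.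
  apply: le_trans (hh (N + n)%N); rewrite /wsum big_split_ord /= mulr_sumr.
  rewrite -[leLHS]add0r lerD //.
    by apply: sumr_ge0 => j _; rewrite mulr_ge0 ?csq_ge0.
  by apply: ler_sum => k _; rewrite ler_wpM2r ?csq_ge0 // hN ?leq_addr.
apply: (@le_trans _ _ (\sum_(k < n) (2 * csq (f (N + k)%N) + 2 * csq (g (N + k)%N)))).
  by apply: ler_sum => k _; rewrite hE (le_trans (csqD_le _ _)) // csqN.
rewrite big_split /= -!mulr_sumr.
have := tail f hf; have := tail g gM; lra.
Qed.

End SquareSummableHilbert.

(** * Operators on l2 acting fibre by fibre *)

Section BlockOperators.
Variables (R : realType) (d : nat).
Notation C := (cplx R).
Notation V := 'cV[C]_d.
Notation H := (l2 R d).
Implicit Types (b c : nat -> 'M[C]_d) (f g : H).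

(** The default 0 is met only outside the domain of a block operator, where its value is
    irrelevant. *)
Definition l2_mk (u : nat -> V) : H :=
  if pselect (sqsummable u) is left h then L2 h else 0.

Lemma l2_mkE u k : sqsummable u -> l2_mk u k = u k.
Proof. by rewrite /l2_mk; case: pselect. Qed.

(* Locking keeps unification from comparing families of matrices by unfolding. *)
Fact block_key : unit. Proof. exact: tt. Qed.
Definition bdom b : set H :=
  locked_with block_key (fun b => [set f : H | sqsummable (fun n => b n *m f n)]) b.
Definition bop b (f : H) : H :=
  locked_with block_key (fun b f => l2_mk (fun n => b n *m (f : H) n)) b f.
Definition block_uop b : uop H := Uop (bdom b) (bop b).

Lemma bdomE b f : bdom b f = sqsummable (fun n => b n *m f n).
Proof. by rewrite /bdom locked_withE. Qed.

Lemma bopE b f n : bdom b f -> bop b f n = b n *m f n.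
Proof. by rewrite bdomE /bop locked_withE => h; rewrite l2_mkE. Qed.

Definition finsupp f : Prop := exists N, forall k, (N <= k)%N -> f k = 0.

Lemma sqsummable_fin (u : nat -> V) N :
  (forall k, (N <= k)%N -> u k = 0) -> sqsummable u.
Proof.
move=> u0; have -> : u = fun k => if (k < N)%N then u k else 0.
  by apply/funext => k; case: ltnP => // /u0.
exact: trunc_subproof.
Qed.

Lemma bdom_finsupp b f : finsupp f -> bdom b f.
Proof.
by move=> [N fN]; rewrite bdomE; apply: (@sqsummable_fin _ N) => k /fN ->; rewrite mulmx0.
Qed.

Lemma bop_finsupp b f : finsupp f -> finsupp (bop b f).
Proof.
move=> ff; have [N fN] := ff; exists N => k /fN fk.
by rewrite bopE ?fk ?mulmx0 //; exact: bdom_finsupp.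
Qed.

Lemma finsupp_single n v : finsupp (l2_single n v).
Proof. by exists n.+1 => k nk; rewrite l2_singleE gtn_eqF. Qed.

Lemma dense_finsupp (S : set H) : (forall f, finsupp f -> S f) -> dense S.
Proof.
move=> hS O [f Of] oO; have /normC_near[e e0 he] : nbhs f O by exact: open_nbhs_nbhs.
have [N hN] := l2_tail_small f (exprn_gt0 2 e0).
exists (l2_trunc N f); split.
  apply: he; apply: (l2_norm_lt (ltW e0)).
  by rewrite -opprB -scaleN1r l2sqZ cabsN cabs1 expr1n mul1r.
by apply: hS; exists N => k Nk; rewrite /= ltnNge Nk.
Qed.

Lemma dense_approx (S : set H) f (e : R) : dense S -> 0 < e ->
  exists2 g, S g & `|f - g| < toC e.
Proof.
move=> dS e0; have e1 : 0 < toC e by rewrite toC_gt0.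
have [g [Bg Sg]] : ball f (toC e) `&` S !=set0.
  by apply: dS; [exists f; exact: ballxx|exact: ball_open].
by exists g => //; move: Bg; rewrite -ball_normE.
Qed.

Lemma bdom_lin b (z : C) f g : bdom b f -> bdom b g -> bdom b (z *: f + g).
Proof.
rewrite !bdomE => hf hg.
have -> : (fun n => b n *m (z *: f + g : H) n) =
    fun n => z *: (b n *m f n) + b n *m g n.
  by apply/funext => n; rewrite l2D l2Z mulmxDr -scalemxAr.
exact: sqsummableP.
Qed.

Lemma bop_lin b (z : C) f g : bdom b f -> bdom b g ->
  bop b (z *: f + g) = z *: bop b f + bop b g.
Proof.
move=> hf hg; apply: l2_eq => n; rewrite l2D l2Z !bopE //; last exact: bdom_lin.
by rewrite l2D l2Z mulmxDr -scalemxAr.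
Qed.

Lemma inner_ext (x y x' y' : H) :
  (forall n, cdot (x n) (y n) = cdot (x' n) (y' n)) ->
  inner x y = inner x' y'.
Proof.
move=> h; apply: l2inner_lim; rewrite (_ : psdot x y = psdot x' y').
  exact: l2inner_cvg.
by apply/funext => n; apply: eq_bigr => k _.
Qed.

Lemma inner_single_l n v f : inner (l2_single n v) f = cdot v (f n).
Proof. by rewrite inner_conj inner_single [RHS]cdotJ. Qed.

Lemma block_self_adjoint b : (forall n, adjmx (b n) = b n) ->
  self_adjoint (block_uop b).
Proof.
move=> hb; split.
- split=> [|z f g hf hg] /=.
    by apply: bdom_finsupp; exists 0%N.
  by split; [exact: bdom_lin|exact: bop_lin].
- by apply: dense_finsupp => f; exact: bdom_finsupp.
move=> y z; split => [[hy <-] x hx|h] /=.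
  by apply: inner_ext => n; rewrite /= !bopE // cdot_adj hb.
(* Testing the adjoint relation on vectors supported at one index determines z block by block; as z
   is square summable, y then lies in the domain. *)
have bz n : b n *m y n = z n.
  apply/colP => i.
  have := h (l2_single n (delta_mx i 0)) (bdom_finsupp _ (finsupp_single _ _)).
  have -> : block_uop b (l2_single n (delta_mx i 0)) =
      l2_single n (b n *m delta_mx i 0).
    apply: l2_eq => k; rewrite /= bopE; last first.
      exact: bdom_finsupp (finsupp_single _ _).
    by rewrite !l2_singleE; case: eqP => [->|_] //; exact: mulmx0.
  rewrite !inner_single_l cdot_adj hb cdotJ [RHS]cdotJ.
  by move=> /(can_inj (@conjCK _)); rewrite !cdot_delta.
have hy : bdom b y.
  rewrite bdomE (_ : (fun n => b n *m y n) = l2f z); first exact: l2P.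
  exact/funext.
by split => //; apply: l2_eq => n; rewrite bopE.
Qed.

Definition bnd b (M : R) := 0 <= M /\ forall n v, csq (b n *m v) <= M ^+ 2 * csq v.

Lemma bnd_summable b M f : bnd b M -> forall n,
  psum (fun k => b k *m f k) n <= M ^+ 2 * l2sq f.
Proof.
move=> [M0 hM] n; apply: (@le_trans _ _ (M ^+ 2 * psum f n)).
  by rewrite /psum mulr_sumr; apply: ler_sum => k _; exact: hM.
by rewrite ler_wpM2l ?sqr_ge0 ?psum_le_l2sq.
Qed.

Lemma bnd_dom b M f : bnd b M -> bdom b f.
Proof.
by move=> hb; rewrite bdomE; exists (M ^+ 2 * l2sq f); exact: bnd_summable.
Qed.

Lemma bounded_bop b M : bnd b M -> bounded_op (bop b).
Proof.
move=> hb; have [M0 _] := hb; split.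
  by move=> z f g; rewrite bop_lin //; exact: bnd_dom hb.
exists (toC M) => f; rewrite l2_normE -[`|f|]/(toC _) -toCM toC_le.
rewrite -[X in X * _](ger0_norm M0) -sqrtr_sqr -sqrtrM ?sqr_ge0 //.
apply: ler_wsqrtr; apply: l2sq_le => n.
apply: le_trans (bnd_summable f hb n); rewrite le_eqVlt; apply/orP; left.
apply/eqP; apply: eq_bigr => k _; rewrite bopE //; exact: bnd_dom hb.
Qed.

Lemma bnd_mxbound b M : (forall n, mxbound (b n) <= M) -> bnd b M.
Proof.
move=> hM; have M0 : 0 <= M := le_trans (mxbound_ge0 (b 0%N)) (hM 0%N).
split=> // n v; apply: (le_trans (csq_mxbound _ _)).
by rewrite ler_wpM2r ?csq_ge0 // ler_sqr ?nnegrE ?mxbound_ge0.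
Qed.

Lemma bop_comp b c M f : bnd c M -> bdom b (bop c f) ->
  bop b (bop c f) = bop (fun n => b n *m c n) f.
Proof.
move=> hc hb; have dc g : bdom c g := bnd_dom g hc.
have hbc : bdom (fun n => b n *m c n) f.
  move: hb; rewrite !bdomE (_ : (fun n => b n *m bop c f n) =
    fun n => b n *m c n *m f n) //.
  by apply/funext => k; rewrite bopE ?mulmxA.
by apply: l2_eq => n; rewrite (bopE n hb) (bopE n hbc) (bopE n (dc f)) mulmxA.
Qed.

Lemma bndM b c M M' : bnd b M -> bnd c M' -> bnd (fun n => b n *m c n) (M * M').
Proof.
move=> [M0 hM] [M0' hM']; split=> [|n v]; first exact: mulr_ge0.
rewrite -mulmxA; apply: (le_trans (hM _ _)); rewrite exprMn -[leRHS]mulrA.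
exact: ler_wpM2l (sqr_ge0 _) _ _ (hM' _ _).
Qed.

Lemma bnd_scalar (s : nat -> C) (M : R) : (forall n, cabs (s n) <= M) ->
  bnd (fun n => (s n)%:M) M.
Proof.
move=> h; have M0 : 0 <= M := le_trans (cabs_ge0 (s 0%N)) (h 0%N).
split=> // n v; rewrite mul_scalar_mx csqZ ler_wpM2r ?csq_ge0 //.
by rewrite ler_sqr ?nnegrE ?cabs_ge0.
Qed.

(** This identifies every operator given by [is_Dcomm] or [is_delta_iter] with the explicit block
    operator computed for it. *)
Lemma bounded_extension_unique (T : uop H) (B B' : H -> H) :
  bounded_extension T B -> bounded_extension T B' -> B = B'.
Proof.
move=> [dT [linB [M hM]] TB] [_ [linB' [M' hM']] TB']; apply/funext => x.
have BB (E : H -> H) : linear E -> forall y z, E (y - z) = E y - E z.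
  move=> linE y z; have := linE (-1) z y.
  by rewrite !scaleN1r => Eyz; rewrite addrC Eyz addrC.
apply/eqP; rewrite -subr_eq0 -normr_eq0; apply/eqP.
have [// |n0] := eqVneq `|B x - B' x| 0; exfalso.
have npos : 0 < `|B x - B' x| by rewrite lt_def n0 normr_ge0.
(* A domain point within e / m of x, where e = |B x - B' x|, would give e <= (m - 1) e / m < e. *)
pose m := cabs M + cabs M' + 1.
have m0 : 0 < m by rewrite /m ltr_wpDl // addr_ge0 ?cabs_ge0.
have [ee epos] := posC npos; set e := reC _ in ee epos.
have [y Ty hy] := dense_approx x dT (divr_gt0 epos m0).
(* The constant in [bounded_op] is a complex number; its modulus serves as a real bound. *)
have bd (E : H -> H) N : (forall z, `|E z| <= N * `|z|) ->
    forall z, `|E z| <= toC (cabs N) * `|z|.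
  move=> hN z; have := hN z; rewrite !l2_normE lecE => /andP[_ h].
  rewrite -toCM toC_le; apply: (le_trans h).
  rewrite -[complex.Re _]/(reC _) reM im_toC re_toC mulr0 subr0.
  by rewrite ler_wpM2r ?sqrtr_ge0 // (le_trans (ler_norm _)) // re_le_cabs.
have : `|B x - B' x| <= toC (cabs M + cabs M') * `|x - y|.
  have -> : B x - B' x = B (x - y) - B' (x - y).
    by rewrite (BB B linB) (BB B' linB') -(TB y Ty) -(TB' y Ty) opprB addrA subrK.
  rewrite toCD mulrDl (le_trans (ler_normB _ _)) // lerD //.
    exact: bd hM _.
  exact: bd hM' _.
rewrite ee => h1; suff h : toC (cabs M + cabs M') * `|x - y| < toC e.
  by have := le_lt_trans h1 h; rewrite ltxx.
have mm0 : 0 <= cabs M + cabs M' by rewrite addr_ge0 ?cabs_ge0.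
apply: (@le_lt_trans _ _ (toC (cabs M + cabs M') * toC (e / m))).
  by rewrite ler_wpM2l ?toC_ge0 // ltW.
rewrite -toCM toC_lt mulrCA gtr_pMr // ltr_pdivrMr // mul1r /m.
by rewrite ltrDl.
Qed.

Lemma comm_dom b c f : finsupp f ->
  dom (ucomm (block_uop b) (everywhere (bop c))) f.
Proof.
move=> ff; split; split => //=.
  exact/bdom_finsupp/bop_finsupp.
exact: bdom_finsupp.
Qed.

Lemma block_commutator b c beta M M' : bnd c M -> bnd beta M' ->
  (forall n, b n *m c n - c n *m b n = beta n) ->
  bounded_extension (ucomm (block_uop b) (everywhere (bop c))) (bop beta).
Proof.
move=> hc hbeta E; split.
- by apply: dense_finsupp => f; exact: comm_dom.
- exact: bounded_bop hbeta.
move=> f [[_ /= h1] [/= h2 _]]; apply: l2_eq => n.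
have hd g : bdom c g by exact: bnd_dom hc.
rewrite l2B !bopE //; last exact: bnd_dom hbeta.
by rewrite -E mulmxBl !mulmxA.
Qed.

(** * Blocks with scalar square: compact resolvent, absolute value and complex powers *)

Section CompactResolvent.
Variables (b : nat -> 'M[C]_d) (mu : nat -> R).
Hypothesis b_adj : forall n, adjmx (b n) = b n.
Hypothesis b_sqr : forall n, b n *m b n = (toC (mu n ^+ 2))%:M.
Hypothesis mu_ge1 : forall n, 1 <= mu n.
Hypothesis mu_infty : forall B : R, exists N, forall k, (N <= k)%N -> B <= mu k.

Let mu_gt0 n : 0 < mu n. Proof. exact: lt_le_trans ltr01 (mu_ge1 n). Qed.

Lemma csq_block n v : csq (b n *m v) = mu n ^+ 2 * csq v.
Proof.
apply: toC_inj; rewrite -cdotvv cdot_adj b_adj mulmxA b_sqr mul_scalar_mx.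
rewrite cdotJ -[_ *: v]addr0 cdotP.
have -> : cdot (0 : V) v = 0 by rewrite /cdot big1 // => i _; rewrite mxE mul0r.
by rewrite addr0 cdotvv -toCM toCJ.
Qed.

(** As b^2 = mu^2, the product (b - z) (b + z) is the scalar mu^2 - z^2, which gives the inverse of
    b - z. *)
Definition resolvent (z : C) n : 'M[C]_d :=
  (toC (mu n ^+ 2) - z ^+ 2)^-1 *: (b n + z%:M).

Lemma resolvent_den (z : C) n : imC z != 0 -> toC (mu n ^+ 2) - z ^+ 2 != 0.
Proof.
move=> z0; rewrite toCX subr_sqr mulf_neq0 //.
  apply: contra z0 => /eqP/(congr1 (@imC R)).
  by rewrite !reimE sub0r => /eqP; rewrite oppr_eq0.
by apply: contra z0 => /eqP/(congr1 (@imC R)); rewrite !reimE add0r => /eqP.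
Qed.

Lemma resolventK (z : C) n : imC z != 0 ->
  resolvent z n *m b n - z *: resolvent z n = 1%:M /\
  b n *m resolvent z n - z *: resolvent z n = 1%:M.
Proof.
move=> z0; have D0 := resolvent_den n z0; rewrite /resolvent.
set e := (_ - _)^-1.
have E : e *: ((b n + z%:M) *m b n) - z *: (e *: (b n + z%:M)) = 1%:M.
  rewrite mulmxDl b_sqr mul_scalar_mx scalerA [z * e]mulrC -scalerA -scalerBr.
  rewrite [z *: (b n + _)]scalerDr opprD addrA addrK scale_scalar_mx -expr2.
  by rewrite -raddfB /= scale_scalar_mx mulVf.
split; first by rewrite -scalemxAl.
rewrite -scalemxAr -[RHS]E; congr (_ *: _ - _).
by rewrite mulmxDl mulmxDr scalar_mxC.
Qed.

(** For u = (b - z)^-1 v, self-adjointness of b gives Im (v, u) = - Im z |u|^2, hence |u| <= |v| /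
    |Im z|. Then mu^2 |u|^2 = |b u|^2 = |v + z u|^2 is bounded as well; the gain of mu^2 is what
    yields compactness. *)
Lemma resolvent_bound (z : C) n v : imC z != 0 ->
  mu n ^+ 2 * csq (resolvent z n *m v) <=
  (2 + 2 * (cabs z ^+ 2 / imC z ^+ 2)) * csq v.
Proof.
move=> z0; set u := resolvent z n *m v.
have [_ K2] := resolventK n z0.
have vE : b n *m u = v + z *: u.
  apply/eqP; rewrite -subr_eq; apply/eqP.
  by rewrite /u mulmxA scalemxAl -mulmxBl K2 mul1mx.
have i2 : 0 < imC z ^+ 2 by rewrite exprn_even_gt0.
have ubound : csq u <= csq v / imC z ^+ 2.
  have [u0|u0] := eqVneq (csq u) 0.
    by rewrite u0 divr_ge0 ?csq_ge0 ?(ltW i2).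
  have up : 0 < csq u by rewrite lt_def u0 csq_ge0.
  rewrite ler_pdivlMr // mulrC.
  have imvu : imC (cdot v u) = - imC z * csq u.
    have -> : v = (- z) *: u + b n *m u by rewrite vE scaleNr addrC addrK.
    rewrite cdotP cdotvv imD.
    have -> : imC (cdot (b n *m u) u) = 0.
      have := cdot_adj (b n) u u; rewrite b_adj [in RHS]cdotJ => h.
      have := congr1 (@imC R) h; rewrite imJ => /eqP.
      by rewrite -addr_eq0 -mulr2n mulrn_eq0 /= => /eqP.
    by rewrite imM imN im_toC re_toC mulr0 addr0 add0r.
  have := ip_CauchySchwarz (@cdotP R d) (@cdotJ R d) (@cdotvv R d)
    (@csq_ge0 R d) v u.
  rewrite cabs_sqr imvu => h.
  have : (imC z ^+ 2 * csq u) * csq u <= csq v * csq u.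
    apply: le_trans h; rewrite exprMn sqrrN [csq u ^+ 2]expr2 mulrA.
    by rewrite lerDr sqr_ge0.
  by rewrite ler_pM2r.
rewrite -csq_block vE; apply: (le_trans (csqD_le _ _)).
rewrite [leRHS]mulrDl lerD2l csqZ.
rewrite -mulrA ler_pM2l // -mulrA.
by rewrite (ler_wpM2l (sqr_ge0 _)) // [leRHS]mulrC.
Qed.

Lemma resolvent_bnd (z : C) : imC z != 0 ->
  exists M, bnd (resolvent z) M.
Proof.
move=> z0; pose m := 2 + 2 * (cabs z ^+ 2 / imC z ^+ 2).
have m0 : 0 <= m.
  by rewrite addr_ge0 // mulr_ge0 // divr_ge0 ?sqr_ge0.
exists (Num.sqrt m); split=> [|n v]; first exact: sqrtr_ge0.
rewrite (sqr_sqrtr m0); apply: le_trans (resolvent_bound n v z0).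
by rewrite ler_peMl ?csq_ge0 // expr_ge1 // ltW.
Qed.

Lemma block_compact_resolvent : compact_resolvent (block_uop b).
Proof.
move=> z z0; have [M hM] := resolvent_bnd z0.
have domr f : bdom (resolvent z) f by exact: bnd_dom hM.
exists (bop (resolvent z)); split.
- split; first exact: bounded_bop hM.
  set m := 2 + 2 * (cabs z ^+ 2 / imC z ^+ 2).
  (* By [resolvent_bound] the image of the unit ball lies in a ball weighted by mu^2, which is
     compact by [wsum_compact]. *)
  exists [set f : H | forall n, wsum (fun k => mu k ^+ 2) f n <= m].
    move=> _ [f /= f1 <-] n; apply: (@le_trans _ _ (m * psum f n)).
      rewrite /wsum /psum mulr_sumr; apply: ler_sum => k _.
      by rewrite bopE // resolvent_bound.
    rewrite ler_piMr //.
      by rewrite addr_ge0 // mulr_ge0 // divr_ge0 ?sqr_ge0.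
    apply: (le_trans (psum_le_l2sq _ _)).
    by move: f1; rewrite -toC1 l2_norm_le // expr1n.
  have cpt : compact [set f : H | forall n, wsum (fun k => mu k ^+ 2) f n <= m].
    apply: wsum_compact => [k|B]; first by rewrite expr_ge1 // ltW.
    have [N hN] := mu_infty B; exists N => k /hN /le_trans; apply.
    by rewrite expr2 ler_peMl // ltW.
  by split=> //; apply: compact_closed => //; exact: norm_hausdorff.
- move=> f; have E n : b n *m (resolvent z n *m f n) =
      f n + z *: (resolvent z n *m f n).
    have [_ K2] := resolventK n z0; apply/eqP; rewrite -subr_eq; apply/eqP.
    by rewrite mulmxA scalemxAl -mulmxBl K2 mul1mx.
  have hd : bdom b (bop (resolvent z) f).
    rewrite bdomE (_ : (fun n => _) = (z *: bop (resolvent z) f + f : H)).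
      exact: l2P.
    by apply/funext => n; rewrite l2D l2Z bopE // E addrC.
  split=> //; apply: l2_eq => n.
  by rewrite l2B l2Z /= bopE // bopE // E addrK.
move=> f /= hf; apply: l2_eq => n; rewrite bopE // l2B l2Z bopE //.
have [K1 _] := resolventK n z0.
by rewrite mulmxBr mulmxA -scalemxAr scalemxAl -mulmxBl K1 mul1mx.
Qed.

Notation P := (block_uop (fun n => (toC (mu n))%:M)).
Notation D := (block_uop b).

Lemma csq_mu n (v : V) : csq ((toC (mu n))%:M *m v) = mu n ^+ 2 * csq v.
Proof.
by rewrite mul_scalar_mx csqZ cabs_toC real_normK ?num_real.
Qed.

Lemma psum_eq (u u' : nat -> V) : (forall k, csq (u k) = csq (u' k)) ->
  sqsummable u -> sqsummable u'.
Proof.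
move=> h [M hM]; exists M => n; apply: le_trans (hM n).
by apply: ler_sum => k _; rewrite h.
Qed.

Lemma block_is_abs : is_abs D P.
Proof.
split.
- apply: block_self_adjoint => n; apply/matrixP => i j; rewrite !mxE.
  by rewrite eq_sym rmorphMn /= toCJ.
- move=> x /= hx.
  have h : psdot (bop (fun n => (toC (mu n))%:M) x) x =
      @toC R \o (fun n => \sum_(k < n) mu k * csq (x k)).
    apply/funext => n; rewrite /= toC_sum; apply: eq_bigr => k _.
    rewrite bopE // mul_scalar_mx -[_ *: x k]addr0 cdotP cdotvv toCM.
    rewrite (_ : cdot 0 (x k) = 0) ?addr0 //.
    by rewrite /cdot big1 // => i _; rewrite mxE mul0r.
  have := @l2inner_cvg _ _ (bop (fun n => (toC (mu n))%:M) x) x.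
  rewrite h l2_innerE; move: (l2inner _ _) => l hl.
  have FF : Filter (\oo : set_system nat) by exact: filter_filter.
  have hi := cvg_im FF hl; rewrite (_ : _ \o _ = fun=> 0) // in hi.
  have hr := cvg_re FF hl.
  have l0 : imC l = 0.
    apply/le_anti/andP; split.
      by apply: (cvgr_to_le hi); apply: nearW => n; rewrite lexx.
    by apply: (cvgr_to_ge hi); apply: nearW => n; rewrite lexx.
  have l1 : 0 <= reC l.
    apply: (cvgr_to_ge hr); apply: nearW => n /=.
    by apply: sumr_ge0 => k _; rewrite mulr_ge0 ?csq_ge0 // ltW.
  have -> : l = toC (reC l) by apply: cplx_eq; rewrite ?l0.
  by rewrite toC_ge0.
(* On each fibre b n and the scalar mu n stretch vectors equally, so the two operators, and then
   their squares, have the same domain. *)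
have dd : bdom (fun n => (toC (mu n))%:M) = bdom b.
  by apply/seteqP; split=> f; rewrite !bdomE; apply: psum_eq => k;
    rewrite csq_mu csq_block.
have dd2 f : bdom b f ->
    bdom b (bop (fun n => (toC (mu n))%:M) f) = bdom b (bop b f).
  move=> hf; have hf' : bdom (fun n => (toC (mu n))%:M) f by rewrite dd.
  apply/propext; rewrite !bdomE.
  by split; apply: psum_eq => k; rewrite (bopE _ hf) (bopE _ hf') !csq_block csq_mu.
split.
  apply/seteqP; split=> f [/= hf h2]; split=> /=.
  - by rewrite -dd.
  - have hf' : bdom b f by rewrite -dd.
    by rewrite -(dd2 f hf') -dd.
  - by rewrite dd.
  - by rewrite dd (dd2 f hf).
move=> x [/= hx h2]; apply: l2_eq => n.
have hx' := hx; rewrite dd in hx'.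
have h3 : bdom b (bop b x) by rewrite -(dd2 x hx') -dd.
rewrite (bopE _ h2) (bopE _ hx) (bopE _ h3) (bopE _ hx').
by rewrite !mulmxA b_sqr -scalar_mxM -toCM -expr2.
Qed.

Lemma block_uker x : uker D x -> x = 0.
Proof.
move=> [/= hx Dx]; apply: l2_eq => n; apply: csq_eq0.
have := csq_block n (x n); rewrite -bopE // Dx csq0 => /esym/eqP.
by rewrite mulf_eq0 expf_eq0 /= gt_eqF // => /eqP.
Qed.

Lemma block_abs_inv : is_abs_inv D (bop (fun n => (toC (mu n)^-1)%:M)).
Proof.
have hb : bnd (fun n => (toC (mu n)^-1)%:M : 'M[C]_d) 1.
  apply: bnd_scalar => n; rewrite cabs_toC ger0_norm ?invr_ge0 ?(ltW (mu_gt0 n)) //.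
  by rewrite invf_le1.
have inv n (v : V) : (toC (mu n))%:M *m ((toC (mu n)^-1)%:M *m v) = v.
  by rewrite mulmxA -scalar_mxM -toCM divff ?gt_eqF // toC1 mul1mx.
exists P; split.
- exact: block_is_abs.
- exact: bounded_bop hb.
- move=> x /block_uker ->; apply: l2_eq => n.
  by rewrite bopE ?mulmx0 //; exact: bnd_dom hb.
move=> x _; have dx : bdom (fun n => (toC (mu n))%:M)
    (bop (fun n => (toC (mu n)^-1)%:M) x).
  rewrite bdomE (_ : (fun n => _) = l2f x); first exact: l2P.
  apply/funext => n.
  by rewrite bopE ?inv //; exact: bnd_dom hb.
split => //.
  apply: l2_eq => n; rewrite bopE // bopE ?inv //; exact: bnd_dom hb.
move=> v /block_uker ->; apply: l2inner_lim.
rewrite (_ : psdot _ _ = fun=> 0); first exact: ccvg_cst.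
apply/funext => n; rewrite /psdot big1 // => k _.
by rewrite /cdot big1 // => i _; rewrite l20 mxE rmorph0 mulr0.
Qed.

Lemma cpow_bnd (w : C) : reC w <= 0 ->
  bnd (fun n => (cpow (mu n) w)%:M : 'M[C]_d) 1.
Proof.
move=> w0; apply: bnd_scalar => n; rewrite cpowE cabs_cexp.
rewrite !reimE mul0r subr0 expR_le1.
by rewrite mulr_ge0_le0 // ln_ge0.
Qed.

Lemma block_abs_power (w : C) : reC w <= 0 ->
  is_abs_power D w (bop (fun n => (cpow (mu n) w)%:M)).
Proof.
move=> w0; have hb := cpow_bnd w0; exists P; split.
- exact: block_is_abs.
- exact: bounded_bop hb.
- move=> x /block_uker ->; apply: l2_eq => n.
  by rewrite bopE ?mulmx0 //; exact: bnd_dom hb.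
move=> m x m0 /= hx Px; apply: l2_eq => n.
rewrite bopE; last exact: bnd_dom hb.
rewrite l2Z mul_scalar_mx.
have : bop (fun n => (toC (mu n))%:M) x n = l2f (toC m *: x) n by rewrite -Px.
rewrite (bopE _ hx) mul_scalar_mx l2Z.
(* An eigenvector of |D| for m vanishes at every index n with [mu n != m]. *)
have [->|mn] := eqVneq (mu n) m; first by [].
move=> /eqP; rewrite -subr_eq0 -scalerBl -toCB scaler_eq0 toC_eq0 subr_eq0.
by rewrite (negbTE mn) /= => /eqP ->; rewrite !scaler0.
Qed.

End CompactResolvent.

End BlockOperators.

(** * The eigenvalues mu_n and the sums of their complex powers *)

Section GeometricSpectrum.
Variable R : realType.
Notation C := (cplx R).

(* Each level j is attained 7 * 8^j times, so that [mu n] ~ n^(1/3). *)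
Definition lev (n : nat) : nat := trunc_log 8 n.+1.
Definition mu (n : nat) : R := 2 ^+ lev n.
Definition ln2 : C := toC (ln 2).

Lemma lev_leq m n : (m <= n)%N -> (lev m <= lev n)%N.
Proof. by move=> mn; apply: leq_trunc_log. Qed.

Lemma lev_infty m : exists N, forall n, (N <= n)%N -> (m <= lev n)%N.
Proof.
exists (8 ^ m)%N => n /(leq_trans _) h; rewrite -{1}(@trunc_expnK 8 m) //.
by apply: leq_trunc_log; exact: leq_trans (h _ (leqnn _)) _.
Qed.

Lemma mu_ge1 n : 1 <= mu n.
Proof. by rewrite /mu exprn_ege1 // ler1n. Qed.

Lemma mu_gt0 n : 0 < mu n.
Proof. exact: lt_le_trans ltr01 (mu_ge1 n). Qed.

Lemma mu_infty (B : R) : exists N, forall k, (N <= k)%N -> B <= mu k.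
Proof.
have [m Bm] : exists m : nat, B <= m%:R.
  by exists (Num.bound `|B|); rewrite (le_trans (ler_norm _)) // ltW // archi_boundP.
have [N hN] := lev_infty m; exists N => k /hN mk.
rewrite (le_trans Bm) // /mu -natrX ler_nat (leq_trans mk) //.
exact: ltnW (ltn_expl _ _).
Qed.

Lemma cexpMn (z : C) n : cexp (n%:R * z) = cexp z ^+ n.
Proof.
elim: n => [|n IH]; first by rewrite mul0r cexp0.
by rewrite -natr1 mulrDl mul1r cexpD IH exprSr.
Qed.

Lemma cpow_mu n (v : C) : cpow (mu n) v = cexp (ln2 * v) ^+ lev n.
Proof.
rewrite cpowE /mu lnXn // -cexpMn; congr cexp.
by rewrite -[ln 2 *+ _]mulr_natl toCM toC_nat mulrA.
Qed.

Lemma cpowD n (v w : C) : cpow (mu n) (v + w) = cpow (mu n) v * cpow (mu n) w.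
Proof. by rewrite !cpowE mulrDr cexpD. Qed.

Lemma cpow_muN n m : cpow (mu n) (- m%:R) = toC (mu n)^-1 ^+ m.
Proof.
rewrite cpowE mulrN cexpN mulrC cexpMn toCV exprVn; congr (_ ^+ _)^-1.
rewrite /cexp re_toC im_toC cos0 sin0 mulr1 lnK ?posrE ?mu_gt0 //.
Qed.

(** Levels below [lev N] are complete and form a geometric series of ratio 8 q; N + 1 - 8^(lev N)
    counts the indices below N that are already at the level of N. *)
Lemma lev_sum (q : C) N : 8 * q != 1 ->
  \sum_(n < N) q ^+ lev n = 7 * (1 - (8 * q) ^+ lev N) / (1 - 8 * q)
    + (N.+1%:R - 8 ^+ lev N) * q ^+ lev N.
Proof.
move=> q1; have d0 : 1 - 8 * q != 0 by rewrite subr_eq0 eq_sym.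
elim: N => [|N IH].
  by rewrite big_ord0 /lev trunc_log1 !expr0; ring.
rewrite big_ord_recr /= IH.
have [levE|levE] : lev N.+1 = lev N \/
    (lev N.+1 = (lev N).+1 /\ N.+2 = 8 ^ (lev N).+1)%N.
  have /andP[h1 h2] := @trunc_log_bounds 8 N.+1 isT isT.
  have [h|h] := ltnP N.+2 (8 ^ (lev N).+1).
    left; apply: trunc_log_eq => //; rewrite h andbT.
    exact: leq_trans h1 (leqnSn _).
  right; have e : (N.+2 = 8 ^ (lev N).+1)%N by apply/eqP; rewrite eqn_leq h h2.
  by split=> //; rewrite /lev e trunc_expnK.
  by rewrite levE -natr1; ring.
have [e1 e2] := levE; rewrite e1 -[N.+2%:R]/(N.+2%:R : C) e2 natrX subrr mul0r addr0.
have -> : N.+1%:R = 8 ^+ (lev N).+1 - 1 :> C.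
  by rewrite -natrX -e2 -[N.+2%:R]natr1 addrK.
rewrite !exprS exprMn.
by move: (8 ^+ _) (q ^+ _) => u w; field.
Qed.

Lemma geometric_lev (r : R) : 0 <= r < 1 -> (fun n => r ^+ lev n) @ \oo --> 0.
Proof.
move=> /andP[r0 r1]; have hr : `|r| < 1 by rewrite ger0_norm.
apply/cvgrPdist_lt => e e0.
have /cvgrPdist_lt /(_ _ e0) [m _ hm] := cvg_expr hr.
have [N hN] := lev_infty m; exists N => // n /= Nn.
exact: hm (hN n Nn).
Qed.

Lemma exp3ln2 : cexp (ln2 * 3) = 8.
Proof.
rewrite mulrC cexpMn /cexp re_toC im_toC cos0 sin0 lnK ?posrE //.
have -> : mkC 1 0 = 1 :> C by [].
by rewrite mulr1 toC_nat -natrX.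
Qed.

Lemma cabs_cexp_ln2 (v : C) : cabs (cexp (ln2 * v)) = expR (ln 2 * reC v).
Proof. by rewrite cabs_cexp !reimE mul0r subr0. Qed.

Lemma ln2_gt0 : 0 < ln 2 :> R. Proof. by rewrite ln_gt0 // ltr1n. Qed.

(** With q = 2^v the ratio 8 q = 2^(3 + v) has modulus r < 1. The incomplete last level has at most
    7 * 8^(lev N) elements, so its contribution is at most 7 r^(lev N) and tends to 0. *)
Lemma cpow_sum (v : C) : reC v < -3 ->
  (fun N => \sum_(n < N) cpow (mu n) v) @ \oo -->
    7 * geom_fun (ln2 * (3 + v)).
Proof.
move=> hv; pose q := cexp (ln2 * v); pose r := cabs (8 * q).
have E8 : 8 * q = cexp (ln2 * (3 + v)) by rewrite mulrDr cexpD exp3ln2.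
have r1 : r < 1.
  rewrite /r E8 cabs_cexp_ln2 expR_lt1 pmulr_rlt0 ?ln2_gt0 //.
  have -> : reC (3 + v) = 3 + reC v by rewrite reD -[3]toC_nat re_toC.
  lra.
have q1 : 8 * q != 1.
  by apply/eqP => h; move: r1; rewrite /r h cabs1 ltxx.
have d0 : 0 < cabs (1 - 8 * q) by rewrite cabs_gt0 subr_eq0 eq_sym.
(* The first term comes from the remainder of the geometric series, the second from the incomplete
   level. *)
pose K := 7 / cabs (1 - 8 * q) + 7.
have K0 : 0 < K by rewrite /K addr_gt0 // divr_gt0.
have rr : 0 <= r < 1 by rewrite cabs_ge0.
apply/cvg_cplxP => e e0.
have /cvgrPdist_lt /(_ _ (divr_gt0 e0 K0)) := geometric_lev rr.
apply: filterS => N; rewrite sub0r normrN ger0_norm ?exprn_ge0 ?cabs_ge0 // => hN.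
under eq_bigr do rewrite cpow_mu.
rewrite -/q lev_sum // /geom_fun -E8.
have alg (u x w i : C) : 7 * (1 - u) * i + x * w - 7 * i = - (7 * u * i) + x * w.
  by ring.
rewrite alg.
have c7 : cabs (7 : C) = 7 by rewrite -toC_nat cabs_toC ger0_norm.
have algc (u x w i : C) n :
    cabs (- (7 * u ^+ n * i^-1) + x * w ^+ n) <=
    7 * cabs u ^+ n / cabs i + cabs x * cabs w ^+ n.
  apply: (le_trans (cabsD _ _)); rewrite cabsN (cabsM (7 * _)) (cabsM 7) c7.
  by rewrite (cabsM x) cabsV !cabsX.
apply: (le_lt_trans (algc _ _ _ _ _)).
rewrite -[cabs (8 * q)]/r.
have c8 : cabs (8 : C) = 8 by rewrite -toC_nat cabs_toC ger0_norm.
have rE : r ^+ lev N = 8 ^+ lev N * cabs q ^+ lev N.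
  by rewrite /r (cabsM 8 q) c8 exprMn.
have bnd1 : cabs (N.+1%:R - 8 ^+ lev N : C) <= 7 * 8 ^+ lev N.
  have -> : (N.+1%:R - 8 ^+ lev N : C) = toC (N.+1%:R - 8 ^+ lev N).
    by rewrite toCB toCX !toC_nat.
  have /andP[h1 h2] := @trunc_log_bounds 8 N.+1 isT isT.
  have h3 : (N.+1%:R : R) <= 8 * 8 ^+ lev N by rewrite -exprS -natrX ler_nat ltnW.
  rewrite cabs_toC ger0_norm; last by rewrite subr_ge0 -natrX ler_nat.
  by rewrite lerBlDr; apply: (le_trans h3); lra.
have bnd2 : cabs (N.+1%:R - 8 ^+ lev N : C) * cabs q ^+ lev N <= 7 * r ^+ lev N.
  rewrite rE [leRHS]mulrA.
  exact: ler_wpM2r (exprn_ge0 _ (cabs_ge0 _)) _ _ bnd1.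
apply: (@le_lt_trans _ _ (K * r ^+ lev N)).
  rewrite (_ : K * r ^+ lev N = 7 * r ^+ lev N / cabs (1 - 8 * q) + 7 * r ^+ lev N).
    exact: lerD (lexx _) bnd2.
  by rewrite /K; move: (cabs _) (r ^+ _) => u w; ring.
by rewrite -ltr_pdivlMl // [K^-1 * e]mulrC.
Qed.

Lemma cabs_cpow n (w : C) : cabs (cpow (mu n) w) = reC (cpow (mu n) (toC (reC w))).
Proof.
rewrite !cpowE cabs_cexp -toCM /cexp !re_toC im_toC cos0 sin0 !reimE.
by rewrite !mul0r !subr0 mulr1.
Qed.

Lemma cpow_sum_bound (w : C) : reC w < -3 ->
  exists U : R, forall N, \sum_(n < N) cabs (cpow (mu n) w) <= U.
Proof.
move=> hw; have FF : Filter (\oo : set_system nat) by exact: filter_filter.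
have hw' : reC (toC (reC w)) < -3 by [].
have := cvg_re FF (cpow_sum hw'); set l := reC _.
rewrite (_ : _ \o _ = fun N => \sum_(n < N) cabs (cpow (mu n) w)); last first.
  by apply/funext => N; rewrite /= re_sum; apply: eq_bigr => n _; rewrite cabs_cpow.
set u := (fun N => _) => hu; have iu : nondecreasing_seq u.
  apply/nondecreasing_seqP => n.
  by rewrite /u big_ord_recr /= lerDl cabs_ge0.
by exists (limn u) => N; apply: nondecreasing_cvgn_le => //; apply: cvgP hu.
Qed.

Lemma ccvg_sum_ord (T : Type) (F : set_system T) (FF : Filter F)
    (f : nat -> T -> C) (l : nat -> C) k :
  (forall m, f m @ F --> l m) ->
  (fun t => \sum_(m < k) f m t) @ F --> \sum_(m < k) l m.
Proof.
move=> hf; elim: k => [|k IH].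
  have -> : (fun t => \sum_(m < 0) f m t) = fun=> 0.
    by apply/funext => t; rewrite big_ord0.
  by rewrite big_ord0; exact: ccvg_cst.
have -> : (fun t => \sum_(m < k.+1) f m t) =
    fun t => \sum_(m < k) f m t + f k t.
  by apply/funext => t; rewrite big_ord_recr.
by rewrite big_ord_recr; exact: (ccvgD FF IH (hf k)).
Qed.

Definition zeta_fun (p : {poly C}) (w : C) : C :=
  \sum_(m < size p) p`_m * (7 * geom_fun (ln2 * (3 - m%:R + w))).

Lemma zeta_sum (p : {poly C}) (w : C) : reC w < -3 ->
  (fun N => \sum_(n < N) p.[toC (mu n)^-1] * cpow (mu n) w) @ \oo -->
    zeta_fun p w.
Proof.
move=> hw; have FF : Filter (\oo : set_system nat) by exact: filter_filter.
have E N : \sum_(n < N) p.[toC (mu n)^-1] * cpow (mu n) w =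
    \sum_(m < size p) p`_m * \sum_(n < N) cpow (mu n) (- m%:R + w).
  under eq_bigr do rewrite horner_coef mulr_suml.
  rewrite exchange_big; apply: eq_bigr => m _; rewrite mulr_sumr.
  by apply: eq_bigr => n _; rewrite cpowD cpow_muN -[LHS]mulrA.
have term m : (fun N => p`_m * \sum_(n < N) cpow (mu n) (- m%:R + w)) @ \oo -->
    p`_m * (7 * geom_fun (ln2 * (3 - m%:R + w))).
  rewrite -addrA; have hm : reC (- m%:R + w) < -3.
    by rewrite reD reN -toC_nat re_toC; have := ler0n R m; lra.
  exact: (ccvgM FF (@ccvg_cst _ _ _ FF p`_m) (cpow_sum hm)).
have := @ccvg_sum_ord _ _ FF _ _ (size p) term.
suff -> : (fun N => \sum_(n < N) p.[toC (mu n)^-1] * cpow (mu n) w) =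
    fun N => \sum_(m < size p) p`_m * \sum_(n < N) cpow (mu n) (- m%:R + w) by [].
exact/funext.
Qed.

End GeometricSpectrum.

(** * Hilbert-Schmidt operators and traces of block operators *)

Section BlockTraces.
Variables (R : realType) (d : nat).
Hypothesis d_gt0 : (0 < d)%N.
Notation C := (cplx R).
Notation H := (l2 R d).

Definition pos (k : nat) : 'I_d := Ordinal (ltn_pmod k d_gt0).
Definition l2_basis (k : nat) : H := l2_single (k %/ d) (delta_mx (pos k) 0).

Lemma div_pos n (i : 'I_d) : ((n * d + i) %/ d = n)%N /\ pos (n * d + i) = i.
Proof.
split; first by rewrite divnMDl // divn_small ?addn0.
by apply: val_inj; rewrite /= modnMDl modn_small.
Qed.

Lemma l2_basis_orthonormal : orthonormal_basis l2_basis.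
Proof.
split=> [j k jk|k|x hx].
- rewrite inner_single cdot_delta l2_singleE.
  have [kj|_] := eqVneq (k %/ d)%N (j %/ d)%N; last by rewrite mxE.
  rewrite mxE eqxx andbT; have [e|//] := eqVneq (pos k) (pos j).
  case/eqP: jk; rewrite (divn_eq j d) (divn_eq k d) kj.
  by have /(congr1 val) /= -> := e.
- by right; rewrite l2_normE l2sq_single csq_delta sqrtr1.
apply: l2_eq => n; apply/colP => i; rewrite l20 mxE.
have := hx (n * d + i)%N; have [h1 h2] := div_pos n i.
by rewrite inner_single h1 h2 cdot_delta.
Qed.

Lemma sum_pos (W : nmodType) (F : nat -> 'I_d -> W) N :
  \sum_(k < N * d) F (k %/ d)%N (pos k) = \sum_(n < N) \sum_(i < d) F n i.
Proof.
elim: N => [|N IH]; first by rewrite mul0n !big_ord0.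
rewrite mulSnr big_split_ord big_ord_recr /= IH; congr (_ + _).
by apply: eq_bigr => i _; have [-> ->] := div_pos N i.
Qed.

Lemma bop_basis_sq b (k : nat) :
  l2sq (bop b (l2_basis k)) = csq (b (k %/ d)%N *m delta_mx (pos k) 0).
Proof.
rewrite -(l2sq_single (k %/ d)); congr l2sq; apply: l2_eq => n.
rewrite bopE; last exact: bdom_finsupp (finsupp_single _ _).
by rewrite !l2_singleE; case: eqP => [->|_] //; exact: mulmx0.
Qed.

Lemma block_hilbert_schmidt (b : nat -> 'M[C]_d) (u : nat -> R) (U : R) :
  (forall n, 0 <= u n) -> (forall n v, csq (b n *m v) <= u n * csq v) ->
  (forall N, \sum_(n < N) u n <= U) -> hilbert_schmidt (bop b).
Proof.
move=> u0 bu uU; have uU1 n : u n <= U.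
  apply: le_trans (uU n.+1); rewrite big_ord_recr /= lerDr.
  exact: sumr_ge0.
have U0 : 0 <= U := le_trans (u0 0%N) (uU1 0%N).
split.
  apply: (@bounded_bop _ _ b (Num.sqrt U)); split=> [|n v]; first exact: sqrtr_ge0.
  rewrite (sqr_sqrtr U0); apply: (le_trans (bu n v)).
  by rewrite ler_wpM2r ?csq_ge0.
exists l2_basis; split; first exact: l2_basis_orthonormal.
pose g k : R := csq (b (k %/ d)%N *m delta_mx (pos k) 0).
have gsum K : \sum_(k < K) g k <= d%:R * U.
  (* Lengthening the range from K to K * d makes it a union of whole fibres. *)
  apply: (@le_trans _ _ (\sum_(k < K * d) u (k %/ d)%N)).
    apply: (@le_trans _ _ (\sum_(k < K) u (k %/ d)%N)).
      by apply: ler_sum => k _; rewrite (le_trans (bu _ _)) // csq_delta mulr1.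
    have -> : (K * d = K + (K * d - K))%N.
      by rewrite subnKC // leq_pmulr.
    by rewrite big_split_ord /= lerDl; apply: sumr_ge0.
  rewrite (sum_pos (fun n _ => u n)).
  under eq_bigr do rewrite sumr_const card_ord -[_ *+ d]mulr_natl.
  by rewrite -mulr_sumr ler_wpM2l.
have -> : series (fun k => `|bop b (l2_basis k)| ^+ 2) =
    @toC R \o (fun K => \sum_(k < K) g k).
  apply/funext => K; rewrite /series /= big_mkord toC_sum.
  by apply: eq_bigr => k _; rewrite l2_norm_sqr bop_basis_sq.
have cvg_g : cvgn (fun K => \sum_(k < K) g k).
  apply: nondecreasing_is_cvgn.
    by apply/nondecreasing_seqP => n; rewrite big_ord_recr /= lerDl csq_ge0.
  by exists (d%:R * U) => _ [K _ <-].
have FF : Filter (\oo : set_system nat) by exact: filter_filter.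
apply: cvgP; exact: cvg_toC cvg_g.
Qed.

(** The partial sums of the series differ from those grouped by fibre only by an incomplete fibre of
    fewer than d terms, each bounded by a quantity that tends to 0. *)
Lemma regroup_cvg (F : nat -> 'I_d -> C) (v : nat -> R) (t : C) :
  (forall n i, cabs (F n i) <= v n) -> v @ \oo --> 0 ->
  (fun N => \sum_(n < N) \sum_(i < d) F n i) @ \oo --> t ->
  series (fun k => F (k %/ d)%N (pos k)) @ \oo --> t.
Proof.
move=> hv v0 /cvg_cplxP ht; apply/cvg_cplxP => e e0.
have e2 : 0 < e / 2 by rewrite divr_gt0.
have [N1 _ h1] := ht _ e2.
have ed : 0 < e / 2 / d%:R by rewrite divr_gt0 // ltr0n.
have /cvgrPdist_lt /(_ _ ed) [N2 _ h2] := v0.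
exists (maxn N1 N2 * d)%N => // K /= hK.
have := leq_div2r d hK; rewrite mulnK // geq_max => /andP[k1 k2].
rewrite /series /= big_mkord.
have -> : \sum_(k < K) F (k %/ d)%N (pos k) =
    \sum_(k < K %/ d * d + K %% d) F (k %/ d)%N (pos k) by rewrite -divn_eq.
rewrite big_split_ord /= sum_pos.
rewrite addrAC; apply: (le_lt_trans (cabsD _ _)).
rewrite [ltRHS]splitr; apply: ltr_leD; first exact: h1.
apply: (le_trans (cabs_sum _ _ _)).
apply: (@le_trans _ _ (\sum_(i < K %% d) v (K %/ d)%N)).
  apply: ler_sum => i _.
  have -> : ((K %/ d * d + i) %/ d = K %/ d)%N.
    rewrite divnMDl // [(i %/ d)%N]divn_small ?addn0 //.
    exact: ltn_trans (ltn_ord i) (ltn_pmod K d_gt0).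
  exact: hv.
rewrite sumr_const card_ord -[_ *+ _]mulr_natl.
have := h2 _ k2; rewrite /= sub0r normrN => /(le_lt_trans (ler_norm _))/ltW h3.
have v_ge0 : 0 <= v (K %/ d)%N.
  exact: le_trans (cabs_ge0 _) (hv _ (pos 0)).
apply: (@le_trans _ _ (d%:R * v (K %/ d)%N)).
  by rewrite ler_wpM2r // ler_nat ltnW // ltn_pmod.
by rewrite mulrC -ler_pdivlMr // ltr0n.
Qed.

(** * Meromorphic continuation of the zeta functions and their residues *)

Section Zeta.
Variable D : nat -> 'M[C]_d.
Hypothesis D_adj : forall n, adjmx (D n) = D n.
Hypothesis D_sqr : forall n, D n *m D n = (toC (mu R n ^+ 2))%:M.

(** The operator need not be everywhere defined: those built from [nabla] have a proper domain,
    which contains the finitely supported vectors. *)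
Definition traced_by (T : uop H) (b : nat -> 'M[C]_d) (p : {poly C}) : Prop :=
  [/\ forall f, finsupp f -> dom T f, forall f, dom T f -> T f = bop b f,
      exists M, bnd b M & forall n, \tr (b n) = p.[toC (mu R n)^-1]].

Lemma cpow_half n (w : C) :
  cabs (cpow (mu R n) (w / 2)) ^+ 2 = cabs (cpow (mu R n) w).
Proof. by rewrite {2}(splitr w) cpowD cabsM expr2. Qed.

(** |D|^w is split into two factors |D|^(w/2), each Hilbert-Schmidt because the moduli of mu_n^w are
    summable for Re w < -3. The bounded blocks are absorbed in the first factor. *)
Lemma block_trace T b p (w : C) : traced_by T b p -> reC w < -3 ->
  is_trace (ucomp T (everywhere (bop (fun n => (cpow (mu R n) w)%:M))))
    (zeta_fun p w).
Proof.
move=> [domT Tb [M bM] trb] hw.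
have w0 : reC w <= 0 by lra.
have w20 : reC (w / 2) <= 0.
  have -> : reC (w / 2) = reC w / 2.
    by rewrite -[2]toC_nat -toCV reM re_toC im_toC mulr0 subr0.
  lra.
pose c n : 'M[C]_d := (cpow (mu R n) w)%:M.
pose c2 n : 'M[C]_d := (cpow (mu R n) (w / 2))%:M.
have cb : bnd c 1 by exact: (cpow_bnd _ (@mu_ge1 R) w0).
have c2b : bnd c2 1 by exact: (cpow_bnd _ (@mu_ge1 R) w20).
have [M0 hM] := bM; have [U hU] := cpow_sum_bound hw.
exists (bop (fun n => b n *m c n)), l2_basis; split.
- split.
  + apply: dense_finsupp => f ff; split => //=.
    exact/domT/bop_finsupp.
  + exact: bounded_bop (bndM bM cb).
  move=> f [_ /= hf]; rewrite Tb // (bop_comp cb) //; exact: bnd_dom bM.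
- exists (bop (fun n => b n *m c2 n)), (bop c2); split.
  + apply: (@block_hilbert_schmidt _ (fun n => M ^+ 2 * cabs (cpow (mu R n) w))
      (M ^+ 2 * U)) => [n|n v|N].
    * by rewrite mulr_ge0 ?sqr_ge0 ?cabs_ge0.
    * rewrite -mulmxA; apply: (le_trans (hM _ _)).
      by rewrite /c2 mul_scalar_mx csqZ cpow_half mulrA.
    * by rewrite -mulr_sumr ler_wpM2l ?sqr_ge0.
  + apply: (@block_hilbert_schmidt _ (fun n => cabs (cpow (mu R n) w)) U)
      => // [n|n v]; first exact: cabs_ge0.
    by rewrite /c2 mul_scalar_mx csqZ cpow_half.
  apply/funext => f /=; rewrite (bop_comp c2b); last exact: bnd_dom (bndM bM c2b).
  congr (bop _ f); apply/funext => n.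
  by rewrite -mulmxA /c2 -scalar_mxM -cpowD -splitr.
- exact: l2_basis_orthonormal.
pose F n (i : 'I_d) : C := b n i i * cpow (mu R n) w.
have -> : (fun k => inner (bop (fun n => b n *m c n) (l2_basis k)) (l2_basis k)) =
    fun k => F (k %/ d)%N (pos k).
  apply/funext => k; rewrite inner_single cdot_delta.
  rewrite bopE; last exact: bdom_finsupp (finsupp_single _ _).
  rewrite l2_singleE eqxx -mulmxA mul_scalar_mx -scalemxAr mxE -colE mxE.
  by rewrite /F mulrC.
have bii n i : cabs (b n i i) <= M.
  rewrite -ler_sqr ?nnegrE ?cabs_ge0 //.
  have := hM n (delta_mx i 0); rewrite csq_delta mulr1; apply: le_trans.
  by have := csq_entry (b n *m delta_mx i 0) i; rewrite -colE mxE.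
pose rho := cabs (cexp (ln2 R * w)).
apply: (@regroup_cvg F (fun n => M * rho ^+ lev n)).
- by move=> n i; rewrite /F cabsM cpow_mu cabsX ler_wpM2r ?exprn_ge0 ?cabs_ge0.
- have -> : 0 = M * 0 :> R by rewrite mulr0.
  apply: cvgM; first exact: cvg_cst.
  apply: geometric_lev; rewrite cabs_ge0 /rho cabs_cexp_ln2 expR_lt1.
  by rewrite pmulr_rlt0 ?ln2_gt0 //; lra.
have := @zeta_sum _ p _ hw.
suff -> : (fun N => \sum_(n < N) p.[toC (mu R n)^-1] * cpow (mu R n) w) =
    fun N => \sum_(n < N) \sum_(i < d) F n i by [].
apply/funext => N; apply: eq_bigr => n _.
by rewrite -trb /mxtrace mulr_suml.
Qed.

(** Allowing every integer [m] makes one set serve all polynomials and all integer shifts y, as the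
    dimension spectrum requires. *)
Definition lattice : set C :=
  [set z : C | exists m : int, cexp (ln2 R * (m%:~R - 2 * z)) = 1].

Lemma cexp_ln2_int (m : int) (z : C) :
  cexp (ln2 R * (m%:~R - 2 * z)) = 1 -> 2 * reC z = m%:~R.
Proof.
move=> /(congr1 (@cabs R)); rewrite cabs1 cabs_cexp_ln2 -[RHS]expR0 => /expR_inj.
move=> /eqP; rewrite mulf_eq0 gt_eqF ?ln2_gt0 //= => /eqP.
have -> : (m%:~R : C) = toC m%:~R.
  by case: m => n; rewrite ?NegzE ?mulrNz ?toCN ?toC_nat // -!pmulrn toC_nat.
have -> : reC (toC m%:~R - 2 * z) = m%:~R - 2 * reC z.
  by rewrite reB re_toC -[2]toC_nat reM re_toC im_toC mul0r subr0.
by move=> /subr0_eq ->.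
Qed.

Lemma affineE (c z : C) : ln2 R * (c - 2 * z) = - (2 * ln2 R) * z + ln2 R * c.
Proof. by ring. Qed.

Lemma ln2_neq0 : - (2 * ln2 R) != 0.
Proof. by rewrite oppr_eq0 mulf_neq0 ?pnatr_eq0 // toC_eq0 gt_eqF ?ln2_gt0. Qed.

(** A lattice point w with integer m has 2 Re w = m. Within 1/4 of z there is thus none unless 2 Re
    z is within 1/2 of some integer M, and then m can only be M, so that [near_cexp_neq1] applies to
    a single exponential. *)
Lemma lattice_discrete : discrete_in_C lattice.
Proof.
move=> z.
have [[M hM]|noM] :=
    pselect (exists M : int, `|2 * reC z - M%:~R| < (2^-1 : R)).
  have := near_cexp_neq1 (ln2 R * (M%:~R - 2 * z)).
  rewrite affineE => /(dnear_affine ln2_neq0) /cplx_dnear[e e0 he].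
  apply/cplx_dnear; exists (Num.min e 4^-1); first by rewrite lt_min e0 /=.
  move=> w wz; rewrite lt_min => /andP[we w4] [m hm].
  have := he w wz we; rewrite -affineE; suff -> : M = m by rewrite hm eqxx.
  have := cexp_ln2_int hm => rm.
  have h1 : `|reC w - reC z| < 4^-1.
    by rewrite -reB; apply: le_lt_trans (re_le_cabs _) w4.
  have : `|(m - M)%:~R| < 1 :> R.
    rewrite intrB -rm; move: hM h1; rewrite !ltr_norml => /andP[a1 a2] /andP[a3 a4].
    by apply/andP; split; lra.
  rewrite -intr_norm ltrz1 => mM; apply/eqP; rewrite eq_sym -subr_eq0.
  by rewrite -normr_eq0; move: mM; case: `|m - M| (normr_ge0 (m - M)) => [[|k]|k].
apply/cplx_dnear; exists 4^-1 => // w wz w4 [m hm]; apply: noM; exists m.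
rewrite -(cexp_ln2_int hm) -mulrBr normrM ger0_norm //.
have : `|reC w - reC z| < 4^-1.
  by rewrite -reB; apply: le_lt_trans (re_le_cabs _) w4.
by rewrite distrC; lra.
Qed.

Definition zeta_residue (p : {poly C}) (y : int) : C :=
  \sum_(m < size p) p`_m * (7 *
    ((if cexp (ln2 R * (3 - m%:R + y%:~R)) == 1 then -1 else 0) / - (2 * ln2 R))).

Lemma zeta_term (m : nat) (y : int) (z : C) :
  ln2 R * (3 - m%:R + (y%:~R - 2 * z)) =
  - (2 * ln2 R) * z + ln2 R * (3 - m%:R + y%:~R).
Proof. by ring. Qed.

Lemma zeta_simple_pole (p : {poly C}) (y : int) (z : C) :
  exists r, simple_pole (fun z => zeta_fun p (y%:~R - 2 * z)) z r /\
    (z = 0 -> r = zeta_residue p y).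
Proof.
exists (\sum_(m < size p) p`_m * (7 * ((if cexp (- (2 * ln2 R) * z +
  ln2 R * (3 - m%:R + y%:~R)) == 1 then -1 else 0) / - (2 * ln2 R)))).
split; last by move=> ->; apply: eq_bigr => m _; rewrite mulr0 add0r.
apply: (@simple_pole_sum _ _ (fun (m : 'I_(size p)) z => p`_m *
  (7 * geom_fun (ln2 R * (3 - m%:R + (y%:~R - 2 * z)))))) => m.
apply: simple_poleZ; apply: simple_poleZ.
have -> : (fun z => geom_fun (ln2 R * (3 - m%:R + (y%:~R - 2 * z)))) =
    fun z => geom_fun (- (2 * ln2 R) * z + ln2 R * (3 - m%:R + y%:~R)).
  by apply/funext => u; rewrite zeta_term.
by apply: (simple_pole_affine ln2_neq0); exact: geom_fun_simple_pole.
Qed.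

Lemma zeta_meromorphic (p : {poly C}) (y : int) :
  meromorphic_off lattice (fun z : C => zeta_fun p (y%:~R - 2 * z)).
Proof.
split; first exact: lattice_discrete.
  move=> z hz; rewrite /zeta_fun.
  have term m : derivable (fun z : C => p`_m *
      (7 * geom_fun (ln2 R * (3 - m%:R + (y%:~R - 2 * z))))) z 1.
    have h : derivable (fun z : C =>
        geom_fun (ln2 R * (3 - m%:R + (y%:~R - 2 * z)))) z 1.
      have -> : (fun z : C => geom_fun (ln2 R * (3 - m%:R + (y%:~R - 2 * z)))) =
          fun z : C => geom_fun (- (2 * ln2 R) * z + ln2 R * (3 - m%:R + y%:~R)).
        by apply/funext => u; rewrite zeta_term.
      apply: derivable_comp_affine; apply: derivable_geom_fun.
      apply/eqP => h; apply: hz; exists (3 - m%:Z + y).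
      by rewrite affineE intrD intrB.
    have h7 := @cderivableM _ (fun=> 7) _ z (@cderivable_cst _ 7 z) h.
    exact: (@cderivableM _ (fun=> p`_m) _ z (@cderivable_cst _ p`_m z) h7).
  elim: (size p) => [|k IH].
    have -> : (fun z : C => \sum_(m < 0) p`_m *
        (7 * geom_fun (ln2 R * (3 - m%:R + (y%:~R - 2 * z))))) = fun=> 0.
      by apply/funext => u; rewrite big_ord0.
    exact: cderivable_cst.
  have -> : (fun z : C => \sum_(m < k.+1) p`_m *
        (7 * geom_fun (ln2 R * (3 - m%:R + (y%:~R - 2 * z))))) =
      fun z : C => \sum_(m < k) p`_m *
        (7 * geom_fun (ln2 R * (3 - m%:R + (y%:~R - 2 * z)))) +
        p`_k * (7 * geom_fun (ln2 R * (3 - k%:R + (y%:~R - 2 * z)))).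
    by apply/funext => u; rewrite big_ord_recr.
  exact: (@cderivableD _ _ _ z IH (term k)).
move=> z; have [r [hr _]] := zeta_simple_pole p y z.
by exists r; exact: simple_pole_residue.
Qed.

Lemma block_is_zeta T b p (y : int) : traced_by T b p ->
  is_zeta (block_uop D) T y%:~R lattice (fun z => zeta_fun p (y%:~R - 2 * z)).
Proof.
move=> Tbp; split; first exact: zeta_meromorphic.
exists (`|y%:~R| + 3) => z hz.
have hre : reC (y%:~R - 2 * z) < -3.
  have -> : (y%:~R : C) = toC y%:~R.
    by case: y hz => n _; rewrite ?NegzE ?mulrNz ?toCN ?toC_nat // -!pmulrn toC_nat.
  rewrite reB re_toC -[2]toC_nat reM re_toC im_toC mul0r subr0.
  have := ler_norm (y%:~R : R); have := normr_ge0 (y%:~R : R); lra.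
exists (bop (fun n => (cpow (mu R n) (y%:~R - 2 * z))%:M)); split.
  apply: (block_abs_power D_adj D_sqr (@mu_ge1 R)).
  exact: ltW (lt_trans hre _).
exact: block_trace Tbp hre.
Qed.

Lemma block_is_tau T b p (y : int) k : traced_by T b p ->
  is_tau (block_uop D) k T y%:~R (if k is 0%N then zeta_residue p y else 0).
Proof.
move=> Tbp; exists lattice, (fun z => zeta_fun p (y%:~R - 2 * z)).
split; first exact: block_is_zeta Tbp.
have [r [hr r0]] := zeta_simple_pole p y 0.
by rewrite -r0 //; exact: simple_pole_residueX.
Qed.

Lemma zeta_residueE (p : {poly C}) (j : nat) :
  zeta_residue p (j%:Z - 3) = p`_j * (7 / (2 * ln2 R)).
Proof.
(* At z = 0 the exponential has modulus 2^(j - m), so a pole requires m = j. *)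
have pole (m : nat) : (cexp (ln2 R * (3 - m%:R + (j%:Z - 3)%:~R)) == 1) = (m == j).
  have -> : 3 - m%:R + (j%:Z - 3)%:~R = (j%:Z - m%:Z)%:~R - 2 * 0 :> C.
    by rewrite !intrB; ring.
  apply/eqP/eqP => [/cexp_ln2_int|->].
    rewrite mulr0 => /esym/eqP; rewrite intr_eq0 subr_eq0 => /eqP.
    by move=> [->].
  by rewrite subrr mulr0 subrr mulr0 cexp0.
have term (m : nat) : p`_m * (7 *
    ((if cexp (ln2 R * (3 - m%:R + (j%:Z - 3)%:~R)) == 1 then -1 else 0)
     / - (2 * ln2 R))) = if m == j then p`_j * (7 / (2 * ln2 R)) else 0.
  rewrite pole; case: eqP => [->|_]; last by rewrite mul0r !mulr0.
  by rewrite invrN mulrNN mul1r.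
rewrite /zeta_residue.
under eq_bigr do rewrite term.
have [jp|jp] := ltnP j (size p).
  rewrite (bigD1 (Ordinal jp)) //= eqxx big1 ?addr0 // => m mj.
  by rewrite ifN.
rewrite big1 => [|m _]; first by rewrite nth_default // mul0r.
by rewrite ifN // neq_ltn (leq_trans (ltn_ord m) jp).
Qed.

End Zeta.

End BlockTraces.

(** * Two by two matrices *)

Section TwoByTwo.
Variable W : comPzRingType.
Implicit Types (a b c d : W) (A : 'M[W]_2).

Definition mx2 a b c d : 'M[W]_2 :=
  \matrix_(i, j) (if i == 0 then (if j == 0 then a else b)
                  else (if j == 0 then c else d)).

Lemma ord2P (i : 'I_2) : i = 0 \/ i = 1.
Proof. by case: i => [[|[|//]] h]; [left|right]; apply: val_inj. Qed.

Lemma mx2E A : A = mx2 (A 0 0) (A 0 1) (A 1 0) (A 1 1).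
Proof.
apply/matrixP => i j; rewrite mxE.
by case: (ord2P i) => ->; case: (ord2P j) => ->.
Qed.

Lemma mx2P (A B : 'M[W]_2) : A 0 0 = B 0 0 -> A 0 1 = B 0 1 ->
  A 1 0 = B 1 0 -> A 1 1 = B 1 1 -> A = B.
Proof. by rewrite {5}[A]mx2E {5}[B]mx2E => -> -> -> ->. Qed.

Lemma sum2 (F : 'I_2 -> W) : \sum_i F i = F 0 + F 1.
Proof.
rewrite big_ord_recl big_ord1; congr (_ + F _).
exact: val_inj.
Qed.

Lemma mul_mx2 (A B : 'M[W]_2) i j : (A *m B) i j = A i 0 * B 0 j + A i 1 * B 1 j.
Proof. by rewrite mxE sum2. Qed.

Definition mx2_entries := (mul_mx2, mxE).

Lemma trace_mx2 A : \tr A = A 0 0 + A 1 1.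
Proof. by rewrite /mxtrace sum2. Qed.

End TwoByTwo.

(** * The spectral triple of parameter [th] over M_2(C) *)

Section Triple.
Variables (R : realType) (th : R).
Hypothesis th01 : 0 <= th <= 1.
Notation C := (cplx R).
Notation A := (opmx R 2).
Notation H := (l2 R (2 + 2)).
Notation M4 := 'M[C]_(2 + 2).

Definition tau n : R := th * (mu R n)^-1 ^+ 2.
Definition sig_poly : {poly C} := toC (2 * th) *: 'X - toC (th ^+ 2) *: 'X^4.
Definition sig n : R := Num.sqrt (2 * th * (mu R n)^-1 - th ^+ 2 * (mu R n)^-1 ^+ 4).
Definition xmu n : C := toC (mu R n)^-1.

Lemma invmu01 n : 0 < (mu R n)^-1 <= 1.
Proof. by rewrite invr_gt0 mu_gt0 invf_le1 ?mu_gt0 // mu_ge1. Qed.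

Lemma sig_arg_ge0 n : 0 <= 2 * th * (mu R n)^-1 - th ^+ 2 * (mu R n)^-1 ^+ 4.
Proof.
have /andP[x0 x1] := invmu01 n; have /andP[t0 t1] := th01.
move: (_^-1) x0 x1 => x x0 x1.
have -> : 2 * th * x - th ^+ 2 * x ^+ 4 = th * x * (2 - th * x ^+ 3) by ring.
have h : th * x ^+ 3 <= 1.
  by rewrite mulr_ile1 ?exprn_ge0 ?exprn_ile1 // ltW.
by rewrite mulr_ge0 ?mulr_ge0 ?(ltW x0) //; lra.
Qed.

Lemma sig_sqr n : sig n ^+ 2 = 2 * th * (mu R n)^-1 - th ^+ 2 * (mu R n)^-1 ^+ 4.
Proof. by rewrite (sqr_sqrtr (sig_arg_ge0 n)). Qed.

Lemma sig_polyE n : sig_poly.[xmu n] = toC (sig n ^+ 2).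
Proof.
rewrite sig_sqr /sig_poly hornerD hornerN !hornerZ hornerX hornerXn /xmu.
by rewrite -toCX -!toCM -toCB.
Qed.

Lemma sig_le2 n : `|sig n| <= 2.
Proof.
rewrite ger0_norm ?sqrtr_ge0 // -ler_sqr ?nnegrE ?sqrtr_ge0 // sig_sqr.
have /andP[x0 x1] := invmu01 n; have /andP[t0 t1] := th01.
move: (_^-1) x0 x1 => x x0 x1.
have h : th * x <= 1 by rewrite mulr_ile1 // ltW.
have : 0 <= th ^+ 2 * x ^+ 4 by rewrite mulr_ge0 ?sqr_ge0 ?exprn_ge0 // ltW.
lra.
Qed.

(* On the fibre C^2 (x) C^2 this is mu_n times a symmetry: the commuting symmetry
   diag(1, -1) (x) 1, with the plane spanned by e_2 (x) e_1 and e_1 (x) e_2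
   turned by a small angle; [tau] and [sig] are mu_n times 1 - cos and sin. *)
Definition Dblock n : M4 :=
  block_mx (mx2 (toC (mu R n)) 0 0 (toC (mu R n - tau n)))
           (mx2 0 0 (toC (sig n)) 0)
           (mx2 0 (toC (sig n)) 0 0)
           (mx2 (toC (tau n - mu R n)) 0 0 (toC (- mu R n))).

Lemma adjmx_block (P Q S T : 'M[C]_2) :
  adjmx (block_mx P Q S T : M4) =
  block_mx (adjmx P) (adjmx S) (adjmx Q) (adjmx T).
Proof.
have adjE n (B : 'M[C]_n) : adjmx B = map_mx (@Num.conj C) B^T.
  by apply/matrixP => i j; rewrite !mxE.
by rewrite !adjE tr_block_mx map_block_mx.
Qed.

Lemma Dblock_adj n : adjmx (Dblock n) = Dblock n.
Proof.
rewrite /Dblock adjmx_block; congr block_mx;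
  by apply: mx2P; rewrite !mxE /= ?toCJ ?rmorph0.
Qed.

Lemma Dblock_sqr n : Dblock n *m Dblock n = (toC (mu R n ^+ 2))%:M.
Proof.
(* This is cos^2 + sin^2 = 1 multiplied by mu_n^2, that is (mu - tau)^2 + sig^2 = mu^2. *)
have mt : 2 * (mu R n * tau n) = tau n ^+ 2 + sig n ^+ 2.
  rewrite sig_sqr /tau; have := mu_gt0 R n; move: (mu R n) => m m0.
  by field; rewrite gt_eqF.
have mtC : 2 * toC (mu R n) * toC (tau n) = toC (tau n) ^+ 2 + toC (sig n) ^+ 2.
  by rewrite -!toCX -toCD -mt (toCM 2) toCM toC_nat mulrA.
rewrite /Dblock mulmx_block [RHS]scalar_mx_block !toCB !toCN toCX.
move: (toC (mu R n)) (toC (tau n)) (toC (sig n)) mtC => m t s E.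
have E' : s ^+ 2 = 2 * m * t - t ^+ 2 by rewrite E; ring.
by congr block_mx; apply: mx2P;
  rewrite !mx2_entries /= ?mulr1n ?mulr0n; ring: E'.
Qed.

Notation D := (block_uop Dblock).

Definition rep_mx (a : A) : M4 := block_mx (a : 'M[C]_2) 0 0 (a : 'M[C]_2).
Definition rep (a : A) : H -> H := bop (fun=> rep_mx a).

(** Up to scalars each diagonal block of D is [tau n] times diag(1, 0), and the off-diagonal blocks
    are [sig n] times a matrix unit; [comm_diag], [comm_ur] and [comm_dl] are the commutators of
    these three matrices with [a]. *)
Definition comm_diag (a : A) : 'M[C]_2 :=
  mx2 0 ((a : 'M[C]_2) 0 1) (- (a : 'M[C]_2) 1 0) 0.
Definition comm_ur (a : A) : 'M[C]_2 :=
  mx2 (- (a : 'M[C]_2) 0 1) 0 ((a : 'M[C]_2) 0 0 - (a : 'M[C]_2) 1 1)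
      ((a : 'M[C]_2) 0 1).
Definition comm_dl (a : A) : 'M[C]_2 :=
  mx2 ((a : 'M[C]_2) 1 0) ((a : 'M[C]_2) 1 1 - (a : 'M[C]_2) 0 0) 0
      (- (a : 'M[C]_2) 1 0).
Definition comm_block (a : A) n : M4 :=
  block_mx (toC (tau n) *: comm_diag a) (toC (sig n) *: comm_ur a)
           (toC (sig n) *: comm_dl a) (toC (tau n) *: comm_diag a).

Lemma comm_blockE (a : A) n :
  Dblock n *m rep_mx a - rep_mx a *m Dblock n = comm_block a n.
Proof.
rewrite /Dblock /rep_mx /comm_block !mulmx_block opp_block_mx add_block_mx.
rewrite !mulmx0 !mul0mx !addr0 !add0r !toCB !toCN.
by congr block_mx; apply: mx2P; rewrite !mx2_entries /=; ring.
Qed.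

(* Operators whose blocks depend polynomially on 1/mu_n, apart from a factor
   [sig n] on the off-diagonal blocks, which disappears from traces. *)
Definition ev (x : C) (P : 'M[{poly C}]_2) : 'M[C]_2 := map_mx (horner_eval x) P.
Definition poly_block (P Q S T : 'M[{poly C}]_2) n : M4 :=
  block_mx (ev (xmu n) P) (toC (sig n) *: ev (xmu n) Q)
           (toC (sig n) *: ev (xmu n) S) (ev (xmu n) T).

Lemma evD x P Q : ev x (P + Q) = ev x P + ev x Q.
Proof. exact: map_mxD. Qed.
Lemma ev0 x : ev x 0 = 0.
Proof. exact: map_mx0. Qed.
Lemma evM x P Q : ev x (P *m Q) = ev x P *m ev x Q.
Proof. exact: map_mxM. Qed.
Lemma evZ x (p : {poly C}) P : ev x (p *: P) = p.[x] *: ev x P.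
Proof. exact: map_mxZ. Qed.
Lemma ev_const x (a : 'M[C]_2) : ev x (map_mx polyC a) = a.
Proof. by apply/matrixP => i j; rewrite !mxE /horner_eval hornerC. Qed.

Lemma poly_blockP (c : C) P Q S T P' Q' S' T' n :
  c *: poly_block P Q S T n + poly_block P' Q' S' T' n =
  poly_block (c%:P *: P + P') (c%:P *: Q + Q') (c%:P *: S + S')
    (c%:P *: T + T') n.
Proof.
rewrite /poly_block scale_block_mx add_block_mx !evD !evZ !hornerC.
by rewrite !scalerDr !scalerA ![c * _]mulrC.
Qed.

Lemma mulmx_block_scaled (s : C) (P Q S T P' Q' S' T' : 'M[C]_2) :
  block_mx P (s *: Q) (s *: S) T *m block_mx P' (s *: Q') (s *: S') T' =
  block_mx (P *m P' + s ^+ 2 *: (Q *m S')) (s *: (P *m Q' + Q *m T'))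
    (s *: (S *m P' + T *m S')) (s ^+ 2 *: (S *m Q') + T *m T').
Proof.
rewrite mulmx_block; congr block_mx.
- by rewrite -scalemxAl -scalemxAr scalerA.
- by rewrite -scalemxAl -scalemxAr scalerDr.
- by rewrite -scalemxAl -scalemxAr scalerDr.
- by rewrite -scalemxAl -scalemxAr scalerA.
Qed.

(** Two off-diagonal blocks multiply into a diagonal one with the factor [sig n ^+ 2], which is a
    polynomial in 1/mu_n; hence these families are closed under products. *)
Lemma poly_blockM P Q S T P' Q' S' T' n :
  poly_block P Q S T n *m poly_block P' Q' S' T' n =
  poly_block (P *m P' + sig_poly *: (Q *m S')) (P *m Q' + Q *m T')
    (S *m P' + T *m S') (sig_poly *: (S *m Q') + T *m T') n.
Proof.
rewrite /poly_block mulmx_block_scaled -toCX -sig_polyE -!evM -!evZ -!evD.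
by [].
Qed.

Lemma poly_block_trace P Q S T n :
  \tr (poly_block P Q S T n) = (\tr P + \tr T).[xmu n].
Proof. by rewrite mxtrace_block !trace_map_mx hornerD. Qed.

Lemma cabs_xmu n : cabs (xmu n) <= 1.
Proof.
have /andP[x0 x1] := invmu01 n.
by rewrite /xmu cabs_toC ger0_norm // ltW.
Qed.

Lemma poly_bound (p : {poly C}) :
  exists M : R, forall n, cabs p.[xmu n] <= M.
Proof.
exists (\sum_(i < size p) cabs p`_i) => n; rewrite horner_coef.
apply: (le_trans (cabs_sum _ _ _)); apply: ler_sum => i _.
by rewrite cabsM cabsX ler_piMr ?cabs_ge0 // exprn_ile1 ?cabs_ge0 ?cabs_xmu.
Qed.

Lemma ev_bound P : exists M : R, forall n, mxbound (ev (xmu n) P) <= M.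
Proof.
have [m hm] := choice (fun ij : 'I_2 * 'I_2 => poly_bound (P ij.1 ij.2)).
exists (\sum_i \sum_j m (i, j)) => n.
apply: ler_sum => i _; apply: ler_sum => j _.
by rewrite mxE; exact: hm (i, j) n.
Qed.

Lemma mxbound_block (P Q S T : 'M[C]_2) :
  mxbound (block_mx P Q S T : M4) =
  mxbound P + mxbound Q + (mxbound S + mxbound T).
Proof.
rewrite /mxbound big_split_ord /=; congr (_ + _); rewrite -big_split /=;
  apply: eq_bigr => i _; rewrite big_split_ord /=; congr (_ + _);
  apply: eq_bigr => j _.
- by rewrite block_mxEul.
- by rewrite block_mxEur.
- by rewrite block_mxEdl.
- by rewrite block_mxEdr.
Qed.

Lemma mxboundZ (c : C) (P : 'M[C]_2) : mxbound (c *: P) = cabs c * mxbound P.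
Proof.
rewrite /mxbound mulr_sumr; apply: eq_bigr => i _; rewrite mulr_sumr.
by apply: eq_bigr => j _; rewrite mxE cabsM.
Qed.

Lemma poly_block_bnd P Q S T : exists M, bnd (poly_block P Q S T) M.
Proof.
have [MP hP] := ev_bound P; have [MQ hQ] := ev_bound Q.
have [MS hS] := ev_bound S; have [MT hT] := ev_bound T.
exists (MP + 2 * MQ + (2 * MS + MT)); apply: bnd_mxbound => n.
rewrite mxbound_block !mxboundZ cabs_toC.
have h (B : 'M[C]_2) (m : R) : mxbound B <= m -> `|sig n| * mxbound B <= 2 * m.
  by move=> hB; apply: ler_pM => //; [exact: mxbound_ge0|exact: sig_le2].
by rewrite !lerD // h.
Qed.

Definition poly_fam (b : nat -> M4) : Prop :=
  exists P Q S T, b = poly_block P Q S T.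

(** The trace polynomial of such a family has constant coefficient 0, which is the coefficient that
    the residue at y = -3 reads. *)
Definition null_fam (b : nat -> M4) : Prop :=
  exists P Q S T, [/\ b = poly_block P Q S T, ev 0 P = 0 & ev 0 T = 0].

Lemma poly_fam_bnd b : poly_fam b -> exists M, bnd b M.
Proof. by move=> [P [Q [S [T ->]]]]; exact: poly_block_bnd. Qed.

Lemma null_poly_fam b : null_fam b -> poly_fam b.
Proof. by move=> [P [Q [S [T [-> _ _]]]]]; exists P, Q, S, T. Qed.

Lemma poly_famP (c : C) b b' : poly_fam b -> poly_fam b' ->
  poly_fam (fun n => c *: b n + b' n).
Proof.
move=> [P [Q [S [T ->]]]] [P' [Q' [S' [T' ->]]]].
exists (c%:P *: P + P'), (c%:P *: Q + Q'), (c%:P *: S + S'), (c%:P *: T + T').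
by apply/funext => n; rewrite poly_blockP.
Qed.

Lemma poly_famM b b' : poly_fam b -> poly_fam b' ->
  poly_fam (fun n => b n *m b' n).
Proof.
move=> [P [Q [S [T ->]]]] [P' [Q' [S' [T' ->]]]].
exists (P *m P' + sig_poly *: (Q *m S')), (P *m Q' + Q *m T'),
  (S *m P' + T *m S'), (sig_poly *: (S *m Q') + T *m T').
by apply/funext => n; rewrite poly_blockM.
Qed.

Lemma sig_poly0 : sig_poly.[0] = 0.
Proof.
by rewrite /sig_poly hornerD hornerN !hornerZ hornerX hornerXn expr0n !mulr0 subrr.
Qed.

(** Off-diagonal blocks reach the diagonal only with the factor [sig_poly], which vanishes at 0; so
    any polynomial family may multiply on the left. *)
Lemma null_famM b b' : poly_fam b -> null_fam b' ->
  null_fam (fun n => b n *m b' n).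
Proof.
move=> [P [Q [S [T ->]]]] [P' [Q' [S' [T' [-> P0 T0]]]]].
exists (P *m P' + sig_poly *: (Q *m S')), (P *m Q' + Q *m T'),
  (S *m P' + T *m S'), (sig_poly *: (S *m Q') + T *m T'); split.
- by apply/funext => n; rewrite poly_blockM.
- by rewrite evD evM evZ sig_poly0 P0 mulmx0 scale0r addr0.
- by rewrite evD evM evZ sig_poly0 T0 mulmx0 scale0r addr0.
Qed.

Lemma rep_fam (a : A) : poly_fam (fun=> rep_mx a).
Proof.
exists (map_mx polyC (a : 'M[C]_2)), 0, 0, (map_mx polyC (a : 'M[C]_2)).
apply/funext => n; rewrite /poly_block !ev_const.
by rewrite !ev0 !scaler0.
Qed.

Lemma comm_fam (a : A) : null_fam (comm_block a).
Proof.
pose t : {poly C} := toC th *: 'X^2.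
exists (t *: map_mx polyC (comm_diag a)), (map_mx polyC (comm_ur a)),
  (map_mx polyC (comm_dl a)), (t *: map_mx polyC (comm_diag a)).
have tE n : t.[xmu n] = toC (tau n) by rewrite /t hornerZ hornerXn /xmu -toCX -toCM.
split.
- by apply/funext => n; rewrite /poly_block !evZ !ev_const tE.
- by rewrite evZ /t hornerZ hornerXn expr0n mulr0 scale0r.
- by rewrite evZ /t hornerZ hornerXn expr0n mulr0 scale0r.
Qed.

Lemma rep_mxP (c : C) (a b : A) : rep_mx (c *: a + b) = c *: rep_mx a + rep_mx b.
Proof.
by rewrite /rep_mx scale_block_mx add_block_mx !scaler0 !addr0.
Qed.

Lemma rep_mxM (a b : A) : rep_mx (a ** b) = rep_mx a *m rep_mx b.
Proof.
by rewrite /rep_mx mulmx_block !mulmx0 !mul0mx !addr0 !add0r.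
Qed.

Lemma rep_dom (a : A) f : bdom (fun=> rep_mx a) f.
Proof. by have [M hM] := poly_fam_bnd (rep_fam a); exact: bnd_dom hM. Qed.

Lemma repE (a : A) (f : H) n : rep a f n = rep_mx a *m f n.
Proof. by rewrite bopE //; exact: rep_dom. Qed.

Lemma pre_cstar_full : pre_cstar (setT : set A).
Proof.
split => //; first by move=> O [x Ox] _; exists x.
Qed.

Lemma rep_bounded (a : A) : bounded_op (rep a).
Proof. by have [M hM] := poly_fam_bnd (rep_fam a); exact: bounded_bop hM. Qed.

Lemma rep1 x : rep cone x = x.
Proof.
apply: l2_eq => n; rewrite repE (_ : rep_mx cone = 1%:M) ?mul1mx //.
by rewrite [RHS]scalar_mx_block.
Qed.

Lemma repP (c : C) a b x : rep (c *: a + b) x = c *: rep a x + rep b x.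
Proof.
by apply: l2_eq => n; rewrite l2D l2Z !repE rep_mxP mulmxDl -scalemxAl.
Qed.

Lemma repM a b x : rep (a ** b) x = rep a (rep b x).
Proof. by apply: l2_eq => n; rewrite !repE rep_mxM mulmxA. Qed.

Lemma rep_star a x y : inner (rep a x) y = inner x (rep (star a) y).
Proof.
apply: inner_ext => n; rewrite !repE cdot_adj; congr (cdot _ (_ *m _)).
rewrite /rep_mx adjmx_block; congr block_mx;
  by apply/matrixP => i j; rewrite !mxE rmorph0.
Qed.

Lemma rep_faithful a b : rep a = rep b -> a = b.
Proof.
move=> ab; have : rep_mx a = rep_mx b.
  apply/matrixP => i j.
  have := congr1 (fun F : H -> H => l2f (F (l2_single 0 (delta_mx j 0))) 0%N) ab.
  rewrite !repE l2_singleE eqxx -!colE => /colP /(_ i).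
  by rewrite !mxE.
by move=> /eq_block_mx[].
Qed.

(** D a x = a D x + [D, a] x, and both terms on the right are square summable. *)
Lemma D_comm_dom (a : A) x : dom D x -> dom D (rep a x).
Proof.
rewrite /= !bdomE => hx; have [M hM] := poly_fam_bnd (null_poly_fam (comm_fam a)).
have h1 := l2P (bop (comm_block a) x); have := rep_dom a (L2 hx).
rewrite bdomE => h2; have := sqsummableP 1 h2 h1.
congr sqsummable; apply/funext => n; rewrite scale1r repE.
rewrite bopE; last exact: bnd_dom hM.
by rewrite -comm_blockE mulmxBl !mulmxA addrC subrK.
Qed.

Lemma D_comm (a : A) : bounded_extension (ucomm D (everywhere (rep a)))
  (bop (comm_block a)).
Proof.
have [M hM] := poly_fam_bnd (rep_fam a).
have [M' hM'] := poly_fam_bnd (null_poly_fam (comm_fam a)).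
by apply: (block_commutator hM hM') => n; exact: comm_blockE.
Qed.

Definition triple : spectral_triple A := @SpectralTriple R A setT H rep D
  pre_cstar_full (fun a _ => rep_bounded a) rep1 (fun c a b x _ _ => repP c a b x)
  (fun a b x _ _ => repM a b x) (fun a x y _ => rep_star a x y)
  (fun a b _ _ => @rep_faithful a b) (block_self_adjoint Dblock_adj)
  (block_compact_resolvent Dblock_adj Dblock_sqr (@mu_ge1 R) (@mu_infty R))
  (fun a x _ => @D_comm_dom a x)
  (fun a _ => ex_intro _ _ (D_comm a)).

End Triple.

(** * Regularity, dimension spectrum and dimension; the values of phi_3 and phi_1 *)

Section Conditions.
Variables (R : realType) (th : R).
Hypothesis th01 : 0 <= th <= 1.
Notation C := (cplx R).
Notation A := (opmx R 2).
Notation H := (l2 R (2 + 2)).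
Notation M4 := 'M[C]_(2 + 2).
Notation T := (triple th01).
Notation Db := (@Dblock R th).
Notation P := (block_uop (fun n => (toC (mu R n))%:M : M4)).

Let four_gt0 : (0 < 2 + 2)%N := isT.

Lemma triple_abs : is_abs (st_D T) P.
Proof.
exact: block_is_abs (Dblock_adj th) (Dblock_sqr th01) (@mu_ge1 R).
Qed.

Lemma poly_fam0 : poly_fam th (fun=> 0).
Proof.
exists 0, 0, 0, 0; apply/funext => n.
by rewrite /poly_block !ev0 !scaler0 block_mx0.
Qed.

Lemma generated_fam (G : set (H -> H)) :
  (forall B, G B -> exists2 b, poly_fam th b & B = bop b) ->
  forall B, generated_algebra G B -> exists2 b, poly_fam th b & B = bop b.
Proof.
move=> hG B; elim=> {B} [B /hG //|c B E _ [b hb ->] _ [b' hb' ->]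
  |B E _ [b hb ->] _ [b' hb' ->]].
  exists (fun n => c *: b n + b' n); first exact: poly_famP.
  have [M hM] := poly_fam_bnd th01 hb; have [M' hM'] := poly_fam_bnd th01 hb'.
  have [M'' hM''] := poly_fam_bnd th01 (poly_famP c hb hb').
  apply/funext => f; apply: l2_eq => n; rewrite l2D l2Z.
  rewrite (bopE _ (bnd_dom _ hM)) (bopE _ (bnd_dom _ hM')) (bopE _ (bnd_dom _ hM'')).
  by rewrite mulmxDl -scalemxAl.
exists (fun n => b n *m b' n); first exact: poly_famM th01 _ _ hb hb'.
have [M hM] := poly_fam_bnd th01 hb; have [M' hM'] := poly_fam_bnd th01 hb'.
by apply/funext => f /=; rewrite (bop_comp hM') //; exact: bnd_dom hM.
Qed.

Lemma Dcomm_block (a : A) B : is_Dcomm (T := T) a B -> B = bop (comm_block th a).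
Proof. by move=> h; exact: bounded_extension_unique h (D_comm th01 a). Qed.

Lemma first_order_fam B : @first_order_generators _ _ T B ->
  exists2 b, poly_fam th b & B = bop b.
Proof.
move=> [a _ [->|/Dcomm_block ->]].
  by exists (fun=> rep_mx a) => //; exact: rep_fam.
by exists (comm_block th a) => //; exact: null_poly_fam (comm_fam th a).
Qed.

Lemma delta_block b : poly_fam th b ->
  bounded_extension (ucomm P (everywhere (bop b))) (bop (fun=> 0)).
Proof.
move=> hb; have [M hM] := poly_fam_bnd th01 hb.
have [M' hM'] := poly_fam_bnd th01 poly_fam0.
by apply: (block_commutator hM hM') => n; rewrite scalar_mxC subrr.
Qed.

Lemma delta_iter_fam k b E : poly_fam th b -> is_delta_iter P k (bop b) E ->
  exists2 b', poly_fam th b' & E = bop b'.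
Proof.
move=> hb; elim: k E => [|k IH] E /=; first by move=> [_ ->]; exists b.
move=> [E' [/IH [b' hb' ->] h]]; exists (fun=> 0); first exact: poly_fam0.
exact: bounded_extension_unique h (delta_block hb').
Qed.

Lemma delta_iter_exists k b : poly_fam th b ->
  exists2 b', poly_fam th b' & is_delta_iter P k (bop b) (bop b').
Proof.
move=> hb; have [M hM] := poly_fam_bnd th01 hb.
elim: k => [|k [b' hb' IH]]; first by exists b => //; split=> //; exact: bounded_bop hM.
exists (fun=> 0); first exact: poly_fam0.
by exists (bop b'); split=> //; exact: delta_block.
Qed.

Lemma triple_regularity : regularity_condition T.
Proof.
exists P; split; first exact: triple_abs.
move=> B /(generated_fam first_order_fam) [b hb ->] k.
by have [b' _ h] := delta_iter_exists k hb; exists (bop b').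
Qed.

Lemma poly_fam_traced b : poly_fam th b -> exists p,
  traced_by (everywhere (bop b)) b p.
Proof.
move=> hb; have [P0 [Q0 [S0 [T0 bE]]]] := hb; exists (\tr P0 + \tr T0).
split=> //; first exact: poly_fam_bnd hb.
by move=> n; rewrite bE poly_block_trace.
Qed.

Lemma triple_dimension_spectrum : dimension_spectrum_condition T.
Proof.
exists P, (@lattice R); split; first exact: triple_abs.
move=> B hB; have [b hb ->] : exists2 b, poly_fam th b & B = bop b.
  apply: generated_fam hB => E [k [B0 /first_order_fam [b hb ->]]].
  exact: delta_iter_fam.
have [p hp] := poly_fam_traced hb.
exists (fun z => zeta_fun p (0%:~R - 2 * z)).
exact: (block_is_zeta four_gt0 (Dblock_adj th) (Dblock_sqr th01) 0 hp).
Qed.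

Lemma decay_order3 : decay_order (fun k => (mu R (k %/ (2 + 2)))^-1) 3.
Proof.
(* The k-th basis vector lies in the fibre n = k / 4, so k + 1 <= 4 (n + 1) <= 8^(lev n + 2), whose
   cube root is 4 mu_n. *)
exists 4 => k; rewrite powRN; set n := (k %/ (2 + 2))%N.
have /andP[h1 h2] := @trunc_log_bounds 8 n.+1 isT isT.
have kn : (k.+1 <= 8 ^ (lev n).+2)%N.
  have h3 : (k < n.+1 * 4)%N by rewrite -ltn_divLR.
  apply: (leq_trans h3); rewrite expnS mulnC.
  by apply: leq_mul => //; exact: ltnW h2.
have up : (k.+1%:R : R) `^ 3^-1 <= 2 ^+ (lev n).+2.
  have -> : (2 ^+ (lev n).+2 : R) = (8 ^ (lev n).+2)%:R `^ 3^-1.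
    rewrite natrX (_ : 8 = 2 ^+ 3 :> R); last by rewrite -natrX.
    rewrite -exprM mulnC exprM -[_ ^+ 3]powR_mulrn ?exprn_ge0 //.
    by rewrite -powRrM divff // powRr1 ?exprn_ge0.
  by apply: ge0_ler_powR; rewrite ?nnegrE ?ler0n ?invr_ge0 ?ler_nat.
have kp : 0 < (k.+1%:R : R) `^ 3^-1 by rewrite powR_gt0.
rewrite -[leLHS]mul1r ler_pdivrMr ?mu_gt0 // mulrAC ler_pdivlMr // mul1r.
apply: (le_trans up); rewrite /mu !exprS mulrA.
by rewrite (_ : 2 * 2 = 4 :> R) // -natrM.
Qed.

Lemma decay_order_ge3 m : (0 < m)%N ->
  decay_order (fun k => (mu R (k %/ (2 + 2)))^-1) m -> (3 <= m)%N.
Proof.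
move=> m0 [M hM]; rewrite leqNgt; apply/negP => m3.
have M2 i : 2 ^+ i <= M.
  (* The first basis vector at level 2 i, where mu_n = 4^i. For m <= 2 one has (k + 1)^(1/m) >= 8^i,
     so M would have to be at least 8^i / 4^i = 2^i for every i; the even level makes the square
     root exact. *)
  pose k := ((2 + 2) * (8 ^ (2 * i)).-1)%N.
  have p8 : (0 < 8 ^ (2 * i))%N by rewrite expn_gt0.
  have kE : lev (k %/ (2 + 2)) = (2 * i)%N.
    by rewrite /k mulKn // /lev prednK // trunc_expnK.
  have := hM k; rewrite /mu kE powRN.
  have k8 : (8 ^ (2 * i) <= k.+1)%N by rewrite /k; move: p8; lia.
  have low : 8 ^+ i <= (k.+1%:R : R) `^ m%:R^-1.
    have -> : 8 ^+ i = ((8 ^ (2 * i))%:R : R) `^ 2^-1.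
      rewrite natrX mulnC exprM -[_ ^+ 2]powR_mulrn ?exprn_ge0 //.
      by rewrite -powRrM divff // powRr1 ?exprn_ge0.
    apply: (@le_trans _ _ ((k.+1%:R : R) `^ 2^-1)).
      by apply: ge0_ler_powR; rewrite ?nnegrE ?ler0n ?invr_ge0 ?ler_nat.
    apply: ler_powR; first by rewrite ler1n.
    by rewrite lef_pV2 ?posrE ?ltr0n // ler_nat -ltnS.
  have low0 : 0 < (k.+1%:R : R) `^ m%:R^-1 by apply: lt_le_trans low; rewrite exprn_gt0.
  rewrite ler_pdivlMr // mulrC ler_pdivrMr ?exprn_gt0 // => h.
  have := le_trans low h; rewrite exprM.
  have -> : 8 ^+ i = (2 ^+ 2) ^+ i * 2 ^+ i :> R.
    have e8 : 8 = 2 ^+ 3 :> R by rewrite -natrX.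
    by rewrite e8 -exprMn -exprSr.
  by rewrite [M * _]mulrC ler_pM2l // !exprn_gt0.
have [n hn] : exists n : nat, M < n%:R.
  by exists (Num.bound `|M|); rewrite (le_lt_trans (ler_norm _)) // archi_boundP.
have := le_lt_trans (M2 n) hn; rewrite -natrX ltr_nat ltnNge.
by rewrite ltnW // ltn_expl.
Qed.

Lemma triple_dimension : has_dimension (st_D T) 3.
Proof.
exists (bop (fun n => (toC (mu R n)^-1)%:M)),
  (fun k => (mu R (k %/ (2 + 2)))^-1); split => //.
- exact: block_abs_inv (Dblock_adj th) (Dblock_sqr th01) (@mu_ge1 R).
- exists (l2_basis R four_gt0).
  have [ortho nrm tot] := l2_basis_orthonormal R four_gt0; split.
  + move=> k; rewrite invr_ge0 (ltW (mu_gt0 _ _)) lef_pV2 ?posrE ?mu_gt0 //.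
    apply: ler_weXn2l; first by rewrite ler1n.
    by apply: lev_leq; apply: leq_div2r.
  + move=> j k _ _; have [->|jk] := eqVneq j k; last exact: ortho.
    rewrite l2_innerE l2inner_sq l2sq_single csq_delta; exact: toC1.
  + move=> k _; apply: l2_eq => n; rewrite l2Z bopE; last first.
      exact: bdom_finsupp (finsupp_single _ _).
    rewrite mul_scalar_mx l2_singleE; case: eqP => [->|_] //.
    by rewrite !scaler0.
  + move=> x hx; have -> : x = 0.
      by apply: tot => k; apply: hx; rewrite invr_gt0 mu_gt0.
    apply: l2_eq => n; rewrite bopE ?mulmx0 //.
    by apply: bdom_finsupp; exists 0%N.
- exact: decay_order3.
- exact: decay_order_ge3.
Qed.

(** D^2 is scalar on each fibre, so it commutes with every block operator; but [nabla] is defined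
    only where D^2 can be applied, whence the separate statements about its domain and its
    values. *)
Lemma nabla_null (b : nat -> M4) M : bnd b M ->
  let N := nabla (st_D T) (everywhere (bop b)) in
  (forall f, finsupp f -> dom N f) /\ (forall f, dom N f -> N f = 0).
Proof.
move=> hb N; split=> f.
  move=> ff; have fin2 g : finsupp g -> bdom Db g /\ bdom Db (bop Db g).
    move=> fg; split; first exact: bdom_finsupp.
    exact/bdom_finsupp/bop_finsupp.
  split; split => //=.
    by apply: fin2; exact: bop_finsupp.
  exact: fin2.
move=> [[_ /= [h1 h2]] [[/= h3 h4] _]]; apply: l2_eq => n.
have hd g : bdom b g := bnd_dom g hb.
rewrite l2B (bopE _ h2) (bopE _ h1) (bopE _ (hd f)) (bopE _ (hd _)).
rewrite (bopE _ h4) (bopE _ h3) !mulmxA -[b n *m Db n *m Db n]mulmxA.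
by rewrite !(Dblock_sqr th01) scalar_mxC subrr.
Qed.

Lemma nabla_of_null (N : uop H) :
  (forall f, finsupp f -> dom N f) /\ (forall f, dom N f -> N f = 0) ->
  (forall f, finsupp f -> dom (nabla (st_D T) N) f) /\
  (forall f, dom (nabla (st_D T) N) f -> nabla (st_D T) N f = 0).
Proof.
move=> [Nd N0]; have z0 : finsupp (0 : H) by exists 0%N.
have D0 : bop Db 0 = 0 by apply: l2_eq => n; rewrite (bopE _ (bdom_finsupp _ z0)) mulmx0.
split=> f.
  move=> ff; have fD := bop_finsupp Db ff.
  split; split => /=; rewrite ?N0 ?D0 //; try exact: Nd.
  - by split; rewrite /= ?D0; exact: bdom_finsupp.
  - by split; exact: bdom_finsupp.
  - exact/Nd/bop_finsupp.
move=> [[/= h1 h2] [[/= h3 h4] h5]].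
by rewrite (N0 _ h1) D0 (N0 _ h5) D0 subrr.
Qed.

Lemma null_tau (N : uop H) (a : A) (y : int) k :
  (forall f, finsupp f -> dom N f) /\ (forall f, dom N f -> N f = 0) ->
  is_tau (st_D T) k (ucomp (everywhere (rep a)) N) y%:~R 0.
Proof.
move=> [Nd N0]; have tr0 : traced_by (ucomp (everywhere (rep a)) N) (fun=> 0) 0.
  have [M hM] := poly_fam_bnd th01 poly_fam0.
  split=> [f /Nd //|f [hf _]||n] /=.
  - rewrite N0 //; apply: l2_eq => n.
    by rewrite (repE th01) (bopE _ (bnd_dom _ hM)) mul0mx mulmx0.
  - by exists M.
  - by rewrite mxtrace0 horner0.
have := block_is_tau four_gt0 (Dblock_adj th) (Dblock_sqr th01) y k tr0.
have -> : zeta_residue (0 : {poly C}) y = 0 by rewrite /zeta_residue size_poly0 big_ord0.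
by case: k.
Qed.

Lemma phi3_value (a0 a1 a2 a3 : A) : is_phi3 T (a0, [:: a1; a2; a3]) 0.
Proof.
exists a0, a1, a2, a3, (bop (comm_block th a1)), (bop (comm_block th a2)),
  (bop (comm_block th a3)), 0, 0 => X.
have f1 := null_poly_fam (comm_fam th a1); have f2 := null_poly_fam (comm_fam th a2).
have f3 := comm_fam th a3; have f23 := null_famM th01 f2 f3.
have f123 := null_famM th01 f1 f23.
have f0123 := null_famM th01 (rep_fam th a0) f123.
have [P0 [Q0 [S0 [T0 [bE P00 T00]]]]] := f0123.
have bnd_of b : poly_fam th b -> exists M, bnd b M by exact: poly_fam_bnd.
have [M3 h3] := bnd_of _ (null_poly_fam f3).
have [M2 h2] := bnd_of _ f2; have [M1 h1] := bnd_of _ f1.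
have [M23 h23] := bnd_of _ (null_poly_fam f23).
have [M123 h123] := bnd_of _ (null_poly_fam f123).
have [M0 h0] := bnd_of _ (rep_fam th a0).
have trX : traced_by X (fun n => rep_mx a0 *m (comm_block th a1 n *m
    (comm_block th a2 n *m comm_block th a3 n))) (\tr P0 + \tr T0).
  split=> [//|f _||n].
  - rewrite /= (bop_comp h3 (bnd_dom _ h2)) (bop_comp h23 (bnd_dom _ h1)).
    by rewrite /rep (bop_comp h123 (bnd_dom _ h0)).
  - exact: bnd_of (null_poly_fam f0123).
  - have := congr1 (fun b => \tr (b n)) bE => /= ->.
    exact: poly_block_trace.
have y3 : (0%:Z - 3)%:~R = - 3 :> C by rewrite sub0r mulrNz.
(* At y = -3 the residue reads the constant coefficient, that is the value at 0 of the trace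
   polynomial, and the product of commutators is a null family. *)
have res0 : zeta_residue (\tr P0 + \tr T0) (0%:Z - 3) = 0.
  rewrite (zeta_residueE (\tr P0 + \tr T0) 0) -horner_coef0 hornerD.
  have ev_tr (Q : 'M[{poly C}]_2) : (\tr Q).[0] = \tr (ev 0 Q).
    by rewrite trace_map_mx.
  by rewrite !ev_tr P00 T00 !mxtrace0 addr0 mul0r.
split=> //.
- by split; exact: (D_comm th01).
- have := block_is_tau four_gt0 (Dblock_adj th) (Dblock_sqr th01) (0%:Z - 3) 0 trX.
  by rewrite y3 res0.
- have := block_is_tau four_gt0 (Dblock_adj th) (Dblock_sqr th01) (0%:Z - 3) 1 trX.
  by rewrite y3.
by rewrite !mulr0 subrr.
Qed.

(** Half the trace of [a0] times the commutator of diag(1, -1) with [a1]. *)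
Definition kappa (a0 a1 : A) : C :=
  (a0 : 'M[C]_2) 1 0 * (a1 : 'M[C]_2) 0 1 - (a0 : 'M[C]_2) 0 1 * (a1 : 'M[C]_2) 1 0.

Lemma phi1_value (a0 a1 : A) :
  is_phi1 T (a0, [:: a1]) (7 * toC th / ln2 R * kappa a0 a1).
Proof.
exists a0, a1, (bop (comm_block th a1)), (7 * toC th / ln2 R * kappa a0 a1),
  0, 0, 0, 0, 0 => X0 X1 X2.
have f1 := null_poly_fam (comm_fam th a1); have f0 := rep_fam th a0.
have [M1 h1] := poly_fam_bnd th01 f1; have [M0 h0] := poly_fam_bnd th01 f0.
have n1 := nabla_null h1; have n2 := nabla_of_null n1.
(* The factor 2 counts the two diagonal blocks, each with coefficient [tau n]; y = -1 reads the
   coefficient of X^2. *)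
pose p : {poly C} := (2 * toC th * kappa a0 a1) *: 'X^2.
have trX0 : traced_by X0 (fun n => rep_mx a0 *m comm_block th a1 n) p.
  split=> [//|f _||n].
  - by rewrite /= /rep (bop_comp h1 (bnd_dom _ h0)).
  - exact: poly_fam_bnd (poly_famM th01 f0 f1).
  have key (a K U V : 'M[C]_2) (t : C) :
      \tr (block_mx a 0 0 a *m block_mx (t *: K) U V (t *: K)) = 2 * t * \tr (a *m K).
    rewrite mulmx_block !mul0mx addr0 add0r mxtrace_block -!scalemxAr !mxtraceZ.
    by rewrite add0r mxtraceZ; move: (\tr _) => x; ring.
  have trK : \tr ((a0 : 'M[C]_2) *m comm_diag a1) = kappa a0 a1.
    by rewrite trace_mx2 !mul_mx2 !mxE /= /kappa; ring.
  rewrite key trK /p hornerZ hornerXn /tau toCM toCX.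
  by move: (kappa _ _) (toC _) => u v; ring.
have y1 : (2%:Z - 3)%:~R = -1 :> C by [].
have ym1 : (-1 : int)%:~R = -1 :> C by [].
have ym3 : (-3 : int)%:~R = - 3 :> C by rewrite mulrNz.
have ym5 : (-5 : int)%:~R = - 5 :> C by rewrite mulrNz.
have res : zeta_residue p (2%:Z - 3) = 7 * toC th / ln2 R * kappa a0 a1.
  rewrite (zeta_residueE p 2) /p coefZ coefXn eqxx mulr1.
  have l0 : ln2 R != 0 by rewrite toC_eq0 gt_eqF ?ln2_gt0.
  by move: (kappa _ _) (ln2 R) l0 => x l l0; field.
split=> //.
- exact: (D_comm th01).
- split.
  + have := block_is_tau four_gt0 (Dblock_adj th) (Dblock_sqr th01) (2%:Z - 3) 0 trX0.
    by rewrite y1 res.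
  + by rewrite -ym1; exact: null_tau.
  + by rewrite -ym3; exact: null_tau.
- by rewrite -ym5; split; exact: null_tau.
by rewrite !mulr0 !subr0 !addr0.
Qed.

End Conditions.

(** * Degrees of universal forms, and the hermitian form 2 b^* db - d(b^* b) *)

Section Forms.
Variables (R : realType) (A : cstarType R).
Notation C := (cplx R).
Implicit Types (a b : A) (u v : uform A) (s : seq A) (m n : nat).

Definition has_degree n u : bool := all (fun t => size t.2 == n) u.

Lemma degree_cat n u v : has_degree n u -> has_degree n v -> has_degree n (u ++ v).
Proof. by rewrite /has_degree all_cat => -> ->. Qed.

Lemma degree_lmul n a u : has_degree n u -> has_degree n (form_lmul a u).
Proof. by rewrite /has_degree all_map. Qed.

Lemma degree_d n u : has_degree n u -> has_degree n.+1 (form_d u).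
Proof. by rewrite /has_degree all_map. Qed.

Lemma degree_dmul n s u : has_degree n u -> has_degree (size s + n) (form_dmul s u).
Proof.
move=> hu; elim: s => [//|a s IH] /=.
apply: degree_cat; first exact/degree_d/degree_lmul.
exact/degree_lmul/degree_lmul/degree_d.
Qed.

Lemma degree_mul m n u v :
  has_degree m u -> has_degree n v -> has_degree (m + n) (form_mul u v).
Proof.
move=> + hv; elim: u => [//|t u IH] /= /andP[/eqP mt hu].
apply: (@degree_cat _ (form_lmul _ _)); last exact: IH.
by rewrite -mt; apply: degree_lmul; exact: degree_dmul.
Qed.

Section Matrices.
Variable N : nat.
Implicit Types w : 'M[uform A]_N.

Definition mx_degree n w : Prop := forall i j, has_degree n (w i j).

Lemma mx_degree_mul m n w w' :
  mx_degree m w -> mx_degree n w' -> mx_degree (m + n) (mform_mul w w').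
Proof.
move=> hw hw' i j; rewrite mxE; elim/big_ind: _ => // [x y|l _].
  exact: degree_cat.
exact: degree_mul.
Qed.

(** As phi_3 vanishes on every elementary 3-form, the degree is all that has to be known about the
    cubic Chern-Simons form; its terms need not be expanded. *)
Lemma degree_cs_form (z : C) w : mx_degree 1 w ->
  has_degree 3 (mform_tr (mform_add (mform_mul w (mform_d w))
    (mform_scale z (mform_mul w (mform_mul w w))))).
Proof.
move=> hw; rewrite /mform_tr; elim/big_ind: _ => // [x y|i _].
  exact: degree_cat.
rewrite mxE; apply: degree_cat.
  by apply: (mx_degree_mul hw) => k l; rewrite mxE; exact: degree_d.
rewrite [mform_scale _ _ _ _]mxE; apply: degree_lmul.
exact: (mx_degree_mul hw (mx_degree_mul hw hw)).
Qed.

End Matrices.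

Lemma cmul0l a : 0 ** a = 0 :> A.
Proof.
have := cmulPl 1 0 0 a; rewrite !scale1r addr0 => /eqP.
by rewrite -[X in X == _]addr0 (inj_eq (addrI _)) eq_sym => /eqP.
Qed.

Lemma cmul0r a : a ** 0 = 0 :> A.
Proof.
have := cmulPr 1 0 0 a; rewrite !scale1r addr0 => /eqP.
by rewrite -[X in X == _]addr0 (inj_eq (addrI _)) eq_sym => /eqP.
Qed.

Lemma cmulNl a b : (- a) ** b = - (a ** b).
Proof. by have := cmulPl (-1) a 0 b; rewrite cmul0l !addr0 !scaleN1r. Qed.

Lemma cmulNr a b : b ** (- a) = - (b ** a).
Proof. by have := cmulPr (-1) a 0 b; rewrite cmul0r !addr0 !scaleN1r. Qed.

Lemma star_cone : star cone = cone :> A.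
Proof.
have := congr1 (@star R A) (cmul1r (star (cone : A))).
by rewrite starM !starK cmul1r.
Qed.

Lemma star0 : star 0 = 0 :> A.
Proof.
have := starP (1 : C) (0 : A) 0; rewrite rmorph1 !scale1r addr0 => /eqP.
by rewrite -[X in X == _]addr0 (inj_eq (addrI _)) eq_sym => /eqP.
Qed.

Lemma starN a : star (- a) = - star a.
Proof.
have := starP (-1 : C) a 0.
by rewrite star0 !addr0 rmorphN1 !scaleN1r.
Qed.

(* The form 2 b^* db - d(b^* b). *)
Definition modulus_form b : uform A :=
  [:: (star b, [:: b]); (star b, [:: b]); (- cone, [:: star b ** b])].

Lemma star_modulus_form b : let p := star b ** b in
  form_star (modulus_form b) =
  [:: (- cone, [:: p]); (star b, [:: b]); (- cone, [:: p]); (star b, [:: b]);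
      (- cone, [:: - p]); (p, [:: - cone])].
Proof.
rewrite /form_star /modulus_form /form_scale /form_d /form_lmul /=.
rewrite expr1 scaleN1r !starN starM !starK star_cone.
by rewrite !cmulNl !cmulNr !cmul1l !cmul1r !opprK.
Qed.

Lemma form_eq_scale1 (z : C) a b :
  form_eq setT [:: (a, [:: z *: b])] [:: (z *: a, [:: b])].
Proof. exact: (@form_eq_scale _ _ setT z a [::] b [::]). Qed.

Lemma form_eq_catr u v v' : form_eq (setT : set A) v v' ->
  form_eq setT (u ++ v) (u ++ v').
Proof. by move=> h; apply: form_eq_cat h; exact: form_eq_perm. Qed.

Lemma form_eq_scalar1 a (z : C) : form_eq setT [:: (a, [:: z *: cone])] [::].
Proof.
apply: form_eq_trans (form_eq_scale1 _ _ _) _.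
exact: (@form_eq_unit _ _ setT (z *: a) [::] [::]).
Qed.

Lemma form_eq_cancel a b :
  form_eq setT [:: (- a, [:: b]); (- a, [:: - b])] [::].
Proof.
apply: (@form_eq_trans _ _ _ _ ([:: (- a, [:: b])] ++ [:: (a, [:: b])])).
  apply: (@form_eq_catr [:: _] [:: _] [:: _]); have := form_eq_scale1 (-1) (- a) b.
  by rewrite !scaleN1r opprK.
apply: (@form_eq_trans _ _ _ _ [:: (- a + a, [:: b])]).
  by apply/form_eq_sym/form_eq_add0.
by rewrite addNr; exact: form_eq_zero.
Qed.

Lemma modulus_form_selfadjoint b :
  form_eq setT (form_star (modulus_form b)) (modulus_form b).
Proof.
rewrite star_modulus_form; set p := star b ** b.
(* After reordering, the adjoint is the form itself followed by - dp + dp and by p d(-1), both of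
   which vanish. *)
apply: (@form_eq_trans _ _ _ _ (modulus_form b ++
  ([:: (- cone, [:: p]); (- cone, [:: - p])] ++ [:: (p, [:: - cone])]))).
  apply: form_eq_perm; rewrite /modulus_form -/p /=.
  set x := (star b, _); set y := (- cone, [:: p]).
  by apply/permP => P /=; lia.
rewrite -[X in form_eq _ _ X]cats0; apply: form_eq_catr.
rewrite -[X in form_eq _ _ X]cats0; apply: form_eq_cat.
  exact: form_eq_cancel.
by have := form_eq_scalar1 p (-1); rewrite scaleN1r.
Qed.

Lemma modulus_form_hermitian b :
  hermitian_one_form setT (const_mx (modulus_form b) : 'M[uform A]_1).
Proof.
split=> i j; rewrite !mxE; last exact: modulus_form_selfadjoint.
by move=> t; rewrite !inE => /or3P[] /eqP ->.
Qed.

End Forms.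

(** * The Chern-Simons action of the hermitian form, and the conclusion *)

Section ChernSimonsValue.
Variables (R : realType) (th : R).
Hypothesis th01 : 0 <= th <= 1.
Notation A := (opmx R 2).
Notation T := (triple th01).

Lemma value_phi3 (u : uform A) : has_degree 3 u -> is_value (@is_phi3 _ _ T) u 0.
Proof.
move=> hu; exists (fun=> 0); split; last by rewrite big1.
move=> [a0 s] /(allP hu) /=; case: s => [|a1 [|a2 [|a3 []]]] // _.
exact: phi3_value.
Qed.

Lemma value_phi1 (u : uform A) : has_degree 1 u -> is_value (@is_phi1 _ _ T) u
  (\sum_(t <- u) 7 * toC th / ln2 R * kappa t.1 (head 0 t.2)).
Proof.
move=> hu; exists (fun t => 7 * toC th / ln2 R * kappa t.1 (head 0 t.2)).
split=> // -[a0 s] /(allP hu) /=; case: s => [|a1 []] // _.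
exact: phi1_value.
Qed.

Lemma modulus_chern_simons (k : int) :
  is_chern_simons T k (const_mx (modulus_form (delta_mx 0 1 : A)) : 'M[uform A]_1)
    (- (28 * toC pi * k%:~R * toC th / ln2 R)).
Proof.
set b : A := delta_mx 0 1; set w := const_mx _.
have hw : mx_degree 1 w by move=> i j; rewrite mxE.
have hu : mform_tr w = modulus_form b by rewrite /mform_tr big_ord1 mxE.
have vu := value_phi1 (u := modulus_form b) isT.
(* For the matrix unit b each of the two terms b^* db has kappa = 1, while the exact term has kappa
   = 0 because the unit matrix has no off-diagonal entry; hence 2 * 7. *)
exists 0, (14 * toC th / ln2 R); split.
- exact/value_phi3/degree_cs_form.
- rewrite hu; congr is_value: vu.
  rewrite !big_cons big_nil /= /kappa !mxE /= rmorph0 rmorph1 oppr0.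
  ring.
ring.
Qed.

End ChernSimonsValue.

Theorem theorem7p3 (R : realType) :
  exists (A : cstarType R) (T1 T2 : spectral_triple A),
    [/\ has_dimension (st_D T1) 3,
        regularity_condition T1
      & dimension_spectrum_condition T1] /\
    [/\ has_dimension (st_D T2) 3,
        regularity_condition T2
      & dimension_spectrum_condition T2] /\
    forall k : int, k != 0 ->
    exists (N : nat) (w : 'M[uform A]_N),
      hermitian_one_form (st_alg T1 `&` st_alg T2) w /\
      exists s1 s2 : cplx R,
        [/\ is_chern_simons T1 k w s1, is_chern_simons T2 k w s2
          & s1 <> s2].
Proof.
have th1 : 0 <= (1 : R) <= 1 by rewrite ler01 lexx.
have th0 : 0 <= (0 : R) <= 1 by rewrite lexx ler01.
exists (opmx R 2), (triple th1), (triple th0).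
split; last split.
- split; [exact: triple_dimension|exact: triple_regularity|].
  exact: triple_dimension_spectrum.
- split; [exact: triple_dimension|exact: triple_regularity|].
  exact: triple_dimension_spectrum.
move=> k k0; exists 1, (const_mx (modulus_form (delta_mx 0 1 : opmx R 2))).
split.
  have -> : st_alg (triple th1) `&` st_alg (triple th0) = setT by rewrite setTI.
  exact: modulus_form_hermitian.
exists (- (28 * toC pi * k%:~R * toC 1 / ln2 R)),
  (- (28 * toC pi * k%:~R * toC 0 / ln2 R)).
split; [exact: modulus_chern_simons|exact: modulus_chern_simons|].
move=> /eqP; rewrite toC0 toC1 mulr1 !mulr0 mul0r oppr0 oppr_eq0; apply/negP.
rewrite mulf_neq0 ?invr_eq0 ?mulf_neq0 ?intr_eq0 // toC_eq0 gt_eqF //.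
  exact: pi_gt0.
exact: ln2_gt0.
Qed.
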